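(* Let $E=[c_{2d},c_{2d-1}]\cup\dots\cup[c_2,c_1]$, $c_{2d}<c_{2d-1}<\dots<c_1$, be a union of $d$ real intervals and let $\theta$ be the conformal map, given by the Green function of the complement $E^c$ with pole at $\infty$, from the upper half-plane $\mathbb H$ to the comb region $$\mathcal C=\{w:\ \Im w>0,\ 0\le\Re w\le1\}\setminus\bigcup_{j=1}^{d-1}\{w:\ \Re w=q_j,\ 0\le\Im w\le h_j\}.$$ Then any isoharmonic deformation of $(E^c,\infty)$ keeps the points $q_j$, $j=1,\dots,d-1$, unchanged, i.e. the base of the comb is invariant under isoharmonic deformations. The deformation acts only vertically, by varying $h_j$ (the tips $q_j+\mathrm i h_j$ of the slits being the $\theta$-images of the critical points of the Green function) along the vertical rays based at $q_j$, for each $j=1,\dots,d-1$.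
   Context: Let $\mu^2=\prod_{j=1}^{2d}(z-c_j)$. The differential $\eta$ is the differential of the third kind with simple poles at the two points at infinity of this curve, with residues $\pm1$, satisfying $\int_{c_{2j+1}}^{c_{2j}}\eta=0$ for $j=1,\dots,d-1$; it has the form $\eta=k(z)dz/\mu$ with $k$ a real polynomial of degree $d-1$ having exactly one zero in each gap interval $(c_{2j+1},c_{2j})$ and no other zeros. Take the branch of $\eta$ on $\mathbb H$ with $\eta\sim dz/z$ at infinity. The Green function of $E^c$ with pole at infinity is $G_E(z,\infty)=\int_{c_{2d}}^z\eta$, and $\theta(z)=\frac{\mathrm i}{\pi}G_E(z,\infty)$, mapping infinity to infinity. The critical points of the Green function are the zeros of $\eta$ in the gap intervals. The equilibrium measure of an interval (its harmonic measure with pole $\infty$) is $\mathcal M_E([c_{2k},c_{2k-1}])=\frac1\pi\int_{c_{2k}}^{c_{2k-1}}|\eta|$. The frequencies are $f_j=\sum_{k=d+1-j}^d\mathcal M_E([c_{2k},c_{2k-1}])$, $j=1,\dots,d-1$; the slits of $\mathcal C$ are based at $q_j=f_j$. A deformation of the pair ($E^c$, pole) through complements of unions of $d$ real intervals (obtained by smoothly moving endpoints) is called isoharmonic if the harmonic measures, with respect to the pole, of all the $d$ intervals are preserved; here the pole is $\infty$ throughout. *)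

(* Defs.v *)
From HB Require Import structures.
From mathcomp Require Import all_boot all_order all_algebra.
From mathcomp Require Import complex.
From mathcomp Require Import all_classical all_reals all_analysis.

Set Implicit Arguments.
Unset Strict Implicit.
Unset Printing Implicit Defensive.

Import Order.TTheory GRing.Theory Num.Theory.
Import numFieldNormedType.Exports.

Local Open Scope classical_set_scope.
Local Open Scope ring_scope.
Local Open Scope complex_scope.

(* The endpoints of [E = [c_(2d), c_(2d-1)] U ... U [c_2, c_1]] are given by   *)
(* [c : nat -> R], of which only the values at 1, ..., 2d are ever used; in    *)
(* the same way the comb parameters [q], [h] are only used at 1, ..., d-1.     *)

Section Comb.
Variable R : realType.
Implicit Types (d i j m : nat) (c q h : nat -> R) (k : {poly R}) (z w : R[i]).

Definition ordered_endpoints d c : Prop :=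
  forall i j, (1 <= i)%N -> (i < j)%N -> (j <= 2 * d)%N -> c j < c i.

Definition upper_half_plane : set R[i] := [set z | 0 < complex.Im z].

(* [f] tends to [l] as [z] goes to infinity inside the upper half-plane. *)
Definition tends_at_infinity (f : R[i] -> R[i]) (l : R[i]) : Prop :=
  forall e : R, 0 < e -> exists M : R, forall z,
    upper_half_plane z -> M < Normc.normc z -> Normc.normc (f z - l) < e.

Definition fixes_infinity (f : R[i] -> R[i]) : Prop :=
  forall A : R, exists M : R, forall z,
    upper_half_plane z -> M < Normc.normc z -> A < Normc.normc (f z).

(* The square root of [prod_j (z - c_j)] on the closed upper half-plane that   *)
(* is asymptotic to [z ^ d] at infinity. [sqrtc] has argument arg(z)/2 for     *)
(* arg(z) in [0, pi], so that it is analytic on the open upper half-plane and  *)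
(* its values on the real line are the boundary values from above.             *)
Definition mu d c z : R[i] := \prod_(1 <= j < (2 * d).+1) sqrtc (z - (c j)%:C).

Lemma mu_sqr d c z : mu d c z ^+ 2 = \prod_(1 <= j < (2 * d).+1) (z - (c j)%:C).
Proof. by rewrite /mu -prodrXl; apply: eq_bigr => j _; rewrite sqr_sqrtc. Qed.

(* The coefficient of [dz] in the differential [k(z) dz / mu]. *)
Definition eta d c k z : R[i] := (map_poly (real_complex R) k).[z] / mu d c z.

Definition Cint (f : R -> R[i]) (a b : R) : R[i] :=
  (\int[lebesgue_measure]_(x in `[a, b]) complex.Re (f x))
  +i* (\int[lebesgue_measure]_(x in `[a, b]) complex.Im (f x)).

(* The residues at the two points at infinity are +1 and -1, on the sheets     *)
(* being chosen so that [eta ~ dz / z] at infinity on the upper half-plane.    *)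
Definition third_kind d c k : Prop :=
  [/\ size k = d,
      tends_at_infinity (fun z => z * eta d c k z) 1
    & forall j, (1 <= j)%N -> (j < d)%N ->
        Cint (fun x => eta d c k x%:C) (c (2 * j).+1) (c (2 * j)%N) = 0].

(* The complex Green function, the integral of [eta] from [c_(2d)] to [z],     *)
(* for [z] in the closed upper half-plane. The path is the line segment; the   *)
(* integral is path independent since the half-plane is simply connected, and  *)
(* the singularities at the endpoints are of type (z - c_j)^(-1/2), hence      *)
(* integrable.                                                                 *)
Definition green d c k z : R[i] :=
  let a := (c (2 * d)%N)%:C in
  (z - a) * Cint (fun s => eta d c k (a + s%:C * (z - a))) 0 1.

Definition theta d c k z : R[i] := (0 +i* 1) / pi%:C * green d c k z.

(* Critical points of the Green function in the gap [(c_(2m+1), c_(2m))]. *)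
Definition critical_point d c k m (x : R) : Prop :=
  c (2 * m).+1 < x < c (2 * m)%N /\ eta d c k x%:C = 0.

(* Equilibrium measure of the interval [[c_(2m), c_(2m-1)]]. *)
Definition harmonic_measure d c k m : R :=
  pi^-1 * \int[lebesgue_measure]_(x in `[c (2 * m)%N, c (2 * m).-1%N])
            Normc.normc (eta d c k x%:C).

Definition frequency d c k j : R :=
  \sum_(d.+1 - j <= m < d.+1) harmonic_measure d c k m.

Definition comb_parameters d q h : Prop :=
  (forall j, (1 <= j)%N -> (j < d)%N -> 0 < q j < 1 /\ 0 < h j) /\
  (forall i j, (1 <= i)%N -> (i < j)%N -> (j < d)%N -> q i < q j).

Definition slit (x y : R) : set R[i] :=
  [set w | complex.Re w = x /\ 0 <= complex.Im w <= y].

Definition comb d q h : set R[i] :=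
  [set w | 0 < complex.Im w /\ 0 <= complex.Re w <= 1] `\`
  \bigcup_(j in [set j | (1 <= j < d)%N]) slit (q j) (h j).

Definition holomorphic_on (D : set R[i]) (f : R[i] -> R[i]) : Prop :=
  forall z, D z -> derivable (f : R[i]^o -> R[i]^o) z 1.

Definition conformal_map (D D' : set R[i]) (f : R[i] -> R[i]) : Prop :=
  holomorphic_on D f /\ set_bij D D' f.

(* The image is the open comb region: [comb] contains the vertical sides       *)
(* Re w = 0 and Re w = 1, which are boundary values of the conformal map.      *)
Definition comb_map d c k q h : Prop :=
  [/\ comb_parameters d q h,
      conformal_map upper_half_plane (interior (comb d q h : set R[i]^o)) (theta d c k)
    & fixes_infinity (theta d c k)].

Definition smooth_on (U : set R) (f : R -> R) : Prop :=
  forall n t, U t -> derivable (derive1n n f) t 1.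

(* [c t] are the endpoints and [eta d (c t) (k t)] the differential at time t. *)
(* Smoothness up to a closed end of [J] means smooth extendability past it.    *)
Record isoharmonic_deformation d (J : interval R)
    (c : R -> nat -> R) (k : R -> {poly R}) : Prop := {
  deformation_smooth : exists U : set R,
    [/\ open U, [set` J] `<=` U
      & forall j, (1 <= j <= 2 * d)%N -> smooth_on U (fun t => c t j)];
  deformation_ordered : forall t, t \in J -> ordered_endpoints d (c t);
  deformation_differential : forall t, t \in J -> third_kind d (c t) (k t);
  deformation_isoharmonic : forall s t m, s \in J -> t \in J ->
    (1 <= m <= d)%N ->
    harmonic_measure d (c s) (k s) m = harmonic_measure d (c t) (k t) m }.

End Comb.

(* Main.v *)
Require Import Defs.
From mathcomp Require Import all_boot all_order all_algebra.
From mathcomp Require Import complex.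
From mathcomp Require polyrcf.
From mathcomp Require Import all_classical all_reals all_analysis.
From mathcomp Require Import measurable_realfun.
From mathcomp Require Import ring lra zify.

(** Let eta = k dz / mu. The map theta, with derivative (i / pi) eta, sends the real line to
the boundary of a comb whose base is determined by harmonic measures; the theorem follows
once theta is known to be a bijection onto the interior of that comb.

As the integral of eta over each of the d - 1 gaps vanishes, k has a zero in each of them,
and no others ([third_kind_zeros]). This gives the argument of eta as a sum of arguments of
z - x over the zeros x minus half such a sum over the endpoints. Because zeros and gaps
interlace, the argument lies strictly between - pi and 0 in the upper half-plane
([phase_bounds]). On the real line eta lies on the negative imaginary axis in the bands and
is real in the gaps, where it changes sign at the zero.

The derivative of theta therefore has a positive real part, so that theta is strictly
monotone as a map of the plane, in particular injective ([theta_monotone], [theta_inj]). On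
the real line, Re theta is constant in the gaps and grows over each band by its harmonic
measure ([harmonic_measureE]); it is 0 to the left of all bands and 1 to their right, because
eta is asymptotic to dz / z ([total_mass]). Hence its value in a gap is the corresponding
frequency ([frequencyE]). Im theta vanishes on the bands and is positive at the critical
points.

Surjectivity is proved along level curves of Re theta. By monotonicity the set where
Re theta = q is the graph of a continuous function of the height. It ends on the real line
at a foot, which is the point of a band where Re theta takes the value q or, when q is a
frequency, the critical point of the gap. Along the curve Im theta takes exactly the values
above the one at the foot ([theta_above], [theta_onto]); its growth comes again from
eta ~ dz / z ([Im_theta_grows]). So the image is the half-strip minus slits over the
frequencies that reach up to the images of the critical points ([theta_comb]).

That theta extends to the real line with these values rests on the integrability of the
inverse square roots in eta and on dominated convergence ([green_vertical],
[green_increment]); its derivative is found by differentiation under the integral sign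
([green_expansion]).

Finally a comb can be recovered from its interior ([open_comb_inj]), so that every comb
belonging to theta has its slits over the frequencies, with tips at the images of the
critical points ([comb_map_unique], [theta_critical]). The frequencies are sums of harmonic
measures, and these do not change in an isoharmonic deformation. *)

Set Implicit Arguments.
Unset Strict Implicit.
Unset Printing Implicit Defensive.

Import Order.TTheory GRing.Theory Num.Theory.
Import numFieldNormedType.Exports.

Local Open Scope classical_set_scope.
Local Open Scope ring_scope.
Local Open Scope complex_scope.

Local Notation nm := (@Normc.normc _).
Local Notation Re := (@complex.Re _).
Local Notation Im := (@complex.Im _).
Local Notation leb := (@lebesgue_measure _).

(** * Complex numbers in the closed upper half-plane *)

Section ComplexBasics.
Variable R : realType.
Implicit Types (z w p r : R[i]) (x y t : R).

Lemma cReD z w : Re (z + w) = Re z + Re w. Proof. by case: z; case: w. Qed.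
Lemma cImD z w : Im (z + w) = Im z + Im w. Proof. by case: z; case: w. Qed.
Lemma cReN z : Re (- z) = - Re z. Proof. by case: z. Qed.
Lemma cImN z : Im (- z) = - Im z. Proof. by case: z. Qed.
Lemma cReM z w : Re (z * w) = Re z * Re w - Im z * Im w.
Proof. by case: z; case: w. Qed.
Lemma cImM z w : Im (z * w) = Re z * Im w + Im z * Re w.
Proof. by case: z => ? ?; case: w => ? ? /=; rewrite [X in _ = _ + X]mulrC; ring. Qed.
Lemma cReV z : Re z^-1 = Re z / (Re z ^+ 2 + Im z ^+ 2).
Proof. by case: z. Qed.
Lemma cImV z : Im z^-1 = - Im z / (Re z ^+ 2 + Im z ^+ 2).
Proof. by case: z => x y; rewrite mulNr. Qed.
Definition ReImE := (cReD, cImD, cReN, cImN, cReM, cImM).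

Lemma complexP z w : Re z = Re w -> Im z = Im w -> z = w.
Proof. by case: z; case: w => /= ? ? ? ? -> ->. Qed.

Lemma nm_ge0 z : 0 <= nm z. Proof. by case: z => x y; exact: sqrtr_ge0. Qed.
Lemma nm_sqr z : nm z ^+ 2 = Re z ^+ 2 + Im z ^+ 2.
Proof. by case: z => x y /=; rewrite sqr_sqrtr// addr_ge0 ?sqr_ge0. Qed.
Lemma nmM z w : nm (z * w) = nm z * nm w. Proof. exact: Normc.normcM. Qed.
Lemma nmV z : nm z^-1 = (nm z)^-1. Proof. exact: Normc.normcV. Qed.
Lemma nmD z w : nm (z + w) <= nm z + nm w. Proof. exact: le_normcD. Qed.
Lemma nmN z : nm (- z) = nm z. Proof. exact: normcN. Qed.
Lemma nmB z w : nm (z - w) = nm (w - z). Proof. by rewrite -nmN opprB. Qed.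
Lemma nm0 : nm (0 : R[i]) = 0. Proof. exact: Normc.normc0. Qed.
Lemma nm1 : nm (1 : R[i]) = 1. Proof. exact: Normc.normc1. Qed.
Lemma nm_i : nm ('i%C : R[i]) = 1. Proof. by rewrite /= expr0n expr1n add0r sqrtr1. Qed.
Lemma nm_real x : nm x%:C = `|x|.
Proof. by rewrite /= expr0n/= addr0 sqrtr_sqr. Qed.
Lemma normE z : `|z| = (nm z)%:C. Proof. by case: z. Qed.
Lemma nm_eq0 z : (nm z == 0) = (z == 0).
Proof. by apply/eqP/eqP => [/Normc.eq0_normc//|->]; rewrite nm0. Qed.
Lemma nm_gt0 z : (0 < nm z) = (z != 0).
Proof. by rewrite lt_def nm_ge0 andbT nm_eq0. Qed.
Lemma nmX z n : nm (z ^+ n) = nm z ^+ n.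
Proof. by elim: n => [|n ih]; rewrite ?expr0 ?nm1// !exprS nmM ih. Qed.
Lemma nm_prod (I : Type) (s : seq I) (P : pred I) (F : I -> R[i]) :
  nm (\prod_(i <- s | P i) F i) = \prod_(i <- s | P i) nm (F i).
Proof. exact: (big_morph nm nmM nm1). Qed.

Lemma Re_nm z : `|Re z| <= nm z.
Proof.
rewrite -(ler_pXn2r (n:=2)) ?nnegrE ?nm_ge0// nm_sqr real_normK ?num_real//.
by rewrite lerDl sqr_ge0.
Qed.
Lemma Im_nm z : `|Im z| <= nm z.
Proof.
rewrite -(ler_pXn2r (n:=2)) ?nnegrE ?nm_ge0// nm_sqr real_normK ?num_real//.
by rewrite lerDr sqr_ge0.
Qed.
Lemma nm_ReIm z : nm z <= `|Re z| + `|Im z|.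
Proof.
rewrite -(ler_pXn2r (n:=2)) ?nnegrE ?nm_ge0 ?addr_ge0// nm_sqr sqrrD.
rewrite !real_normK ?num_real// -addrA lerD2l lerDr.
by rewrite mulrn_wge0// mulr_ge0.
Qed.

Lemma cReZ x z : Re (x%:C * z) = x * Re z. Proof. by rewrite cReM /= mul0r subr0. Qed.
Lemma cImZ x z : Im (x%:C * z) = x * Im z. Proof. by rewrite cImM /= mul0r addr0. Qed.

(** The first quadrant contains the values of sqrtc on the closed upper half-plane, and
determines a square root among the two. *)
Definition quadrant p := (0 <= Re p) && (0 <= Im p).

Lemma quadrant_sqr_inj p r : quadrant p -> quadrant r -> p ^+ 2 = r ^+ 2 -> p = r.
Proof.
move=> /andP[p1 p2] /andP[r1 r2] /eqP; rewrite eqf_sqr => /orP[/eqP//|/eqP E].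
move: p1 p2; rewrite E cReN cImN !oppr_ge0 => p1 p2.
have [e1 e2] : Re r = 0 /\ Im r = 0 by split; apply/eqP; rewrite eq_le ?p1 ?p2 ?r1 ?r2.
by apply: complexP; rewrite ?cReN ?cImN ?e1 ?e2 oppr0.
Qed.

(** Two points of the quadrant cannot cancel. *)
Lemma quadrant_addr p r : quadrant p -> quadrant r -> nm p <= nm (r + p).
Proof.
move=> /andP[p1 p2] /andP[r1 r2].
rewrite -(ler_pXn2r (n:=2)) ?nnegrE ?nm_ge0// !nm_sqr cReD cImD.
have := mulr_ge0 p1 r1; have := mulr_ge0 p2 r2; have := sqr_ge0 (Re r); have := sqr_ge0 (Im r).
nra.
Qed.

Lemma sqrtcE z : 0 <= Im z ->
  sqrtc z = Num.sqrt ((nm z + Re z) / 2) +i* Num.sqrt ((nm z - Re z) / 2).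
Proof.
case: z => x y /= y0; congr (_ +i* _).
case: eqP => [_|/eqP yn]; rewrite ?mul1r// gtr0_sg ?mul1r//.
by rewrite lt_def yn.
Qed.

Lemma quadrant_sqrtc z : 0 <= Im z -> quadrant (sqrtc z).
Proof. by move=> /sqrtcE ->; rewrite /quadrant /= !sqrtr_ge0. Qed.

Lemma nm_sqrtc z : nm (sqrtc z) = Num.sqrt (nm z).
Proof.
by rewrite -[in RHS](sqr_sqrtc z) nmX sqrtr_sqr ger0_norm// nm_ge0.
Qed.

Lemma sqrtc_neq0 z : z != 0 -> sqrtc z != 0.
Proof. by rewrite sqrtc_eq0. Qed.

Lemma sqrtc_scale x z : 0 <= x -> 0 <= Im z ->
  sqrtc (x%:C * z) = (Num.sqrt x)%:C * sqrtc z.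
Proof.
move=> x0 z0; apply: quadrant_sqr_inj.
- by apply: quadrant_sqrtc; rewrite cImZ mulr_ge0.
- have /andP[h1 h2] := quadrant_sqrtc z0.
  by rewrite /quadrant cReZ cImZ !mulr_ge0 ?sqrtr_ge0.
by rewrite exprMn !sqr_sqrtc -rmorphXn/= sqr_sqrtr.
Qed.

Definition cis t : R[i] := cos t +i* sin t.
Lemma cisD s t : cis (s + t) = cis s * cis t.
Proof. by apply: complexP; rewrite ?cReM ?cImM /= ?cosD ?sinD //; ring. Qed.
Lemma cis0 : cis 0 = 1. Proof. by rewrite /cis cos0 sin0. Qed.
Lemma nm_cis t : nm (cis t) = 1. Proof. by rewrite /= cos2Dsin2 sqrtr1. Qed.
Lemma cisN t : cis (- t) = (cis t)^-1.
Proof.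
have pt : cis t != 0 by rewrite -nm_gt0 nm_cis.
by apply: (mulIf pt); rewrite -cisD addNr cis0 mulVf.
Qed.
Lemma cis_sum (I : Type) (s : seq I) (P : pred I) (F : I -> R) :
  cis (\sum_(i <- s | P i) F i) = \prod_(i <- s | P i) cis (F i).
Proof. exact: (big_morph cis cisD cis0). Qed.

(** The argument in [0, pi], for points of the closed upper half-plane. *)
Definition arg z : R := acos (Re z / nm z).

Lemma arg_dom z : -1 <= Re z / nm z <= 1.
Proof.
have [->|z0] := eqVneq z 0; first by rewrite /= mul0r lerN10 ler01.
by rewrite -ler_norml normrM normfV (ger0_norm (nm_ge0 z)) ler_pdivrMr ?nm_gt0// mul1r Re_nm.
Qed.

Lemma arg_ge0 z : 0 <= arg z. Proof. by apply: acos_ge0; exact: arg_dom. Qed.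
Lemma arg_lepi z : arg z <= pi. Proof. by apply: acos_lepi; exact: arg_dom. Qed.

Lemma polarE z : 0 <= Im z -> z = (nm z)%:C * cis (arg z).
Proof.
move=> z0; have [->|zn] := eqVneq z 0; first by rewrite nm0 mul0r.
have n0 : 0 < nm z by rewrite nm_gt0.
have cE : cos (arg z) = Re z / nm z by rewrite acosK//; exact: arg_dom.
apply: complexP; rewrite ?cReZ ?cImZ /=.
  by rewrite cE mulrC divfK// gt_eqF.
rewrite /arg sin_acos; last exact: arg_dom.
rewrite -{1}(ger0_norm (nm_ge0 z)) -sqrtr_sqr -sqrtrM ?sqr_ge0//.
rewrite mulrBr mulr1 expr_div_n mulrC divfK ?expf_neq0 ?gt_eqF// nm_sqr.
by rewrite addrAC subrr add0r sqrtr_sqr ger0_norm.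
Qed.

Lemma sqrtc_polar z : 0 <= Im z ->
  sqrtc z = (Num.sqrt (nm z))%:C * cis (arg z / 2).
Proof.
move=> z0; apply: quadrant_sqr_inj; first exact: quadrant_sqrtc.
- have a0 := arg_ge0 z; have api := arg_lepi z; have ppi := @pi_gt0 R.
  have c0 : 0 <= cos (arg z / 2) by apply: cos_ge0_pihalf; apply/andP; split; lra.
  have s0 : 0 <= sin (arg z / 2) by apply: sin_ge0_pi; apply/andP; split; lra.
  by rewrite /quadrant cReZ cImZ !mulr_ge0 ?sqrtr_ge0.
rewrite sqr_sqrtc exprMn -rmorphXn/= sqr_sqrtr ?nm_ge0//.
by rewrite {1}(polarE z0) expr2 -cisD -splitr.
Qed.

Lemma arg_gt0 z : 0 < Im z -> 0 < arg z.
Proof.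
move=> z0; rewrite lt_def arg_ge0 andbT; apply/eqP => a0.
have := polarE (ltW z0); rewrite a0 cis0 mulr1 => E.
by move: z0; rewrite E /= ltxx.
Qed.

Lemma arg_ltpi z : 0 < Im z -> arg z < pi.
Proof.
move=> z0; rewrite lt_def arg_lepi andbT; apply/eqP => a0.
have := polarE (ltW z0); rewrite -a0 /cis cospi sinpi => E.
by move: z0; rewrite E cImZ /= mulr0 ltxx.
Qed.

Lemma arg_real_lt0 x : x < 0 -> arg x%:C = pi.
Proof.
move=> x0; rewrite /arg nm_real /= ltr0_norm// invrN mulrN divff ?lt_eqF//.
exact: acosN1.
Qed.

Lemma arg_real_gt0 x : 0 < x -> arg x%:C = 0.
Proof. by move=> x0; rewrite /arg nm_real /= gtr0_norm// divff ?gt_eqF// acos1. Qed.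

(** An observer moving to the right along the real line sees z turn to the left. The
cosines of the two angles are compared after squaring, according to their signs. *)
Lemma arg_sub_homo z x y : 0 < Im z -> x <= y -> arg (z - x%:C) <= arg (z - y%:C).
Proof.
move=> z0 xy.
have nz t : z - t%:C != 0.
  by apply/eqP => /(congr1 Im); rewrite cImD /= oppr0 addr0 => E; rewrite E ltxx in z0.
have adom w : arg w \in `[0, pi] by rewrite in_itv/= arg_ge0 arg_lepi.
rewrite leNgt -(ltr_cos (adom _) (adom _)) /arg !(acosK (arg_dom _)) -leNgt !cReD /=.
set b := Re z; set t := Im z in z0 *.
have nE s : nm (z - s%:C) = Num.sqrt ((b - s) ^+ 2 + t ^+ 2).
  by rewrite -[LHS]ger0_norm ?nm_ge0// -sqrtr_sqr nm_sqr !ReImE/= oppr0 addr0.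
have n0 s : 0 < nm (z - s%:C) by rewrite nm_gt0 nz.
rewrite ler_pdivrMr// mulrAC ler_pdivlMr//.
have A0 := n0 x; have B0 := n0 y.
have hA : nm (z - x%:C) ^+ 2 = (b - x) ^+ 2 + t ^+ 2.
  by rewrite nm_sqr !ReImE/= oppr0 addr0.
have hB : nm (z - y%:C) ^+ 2 = (b - y) ^+ 2 + t ^+ 2.
  by rewrite nm_sqr !ReImE/= oppr0 addr0.
move: (nm _) (nm _) A0 B0 hA hB => A B A0 B0 hA hB {nE n0}.
set p := b - y; set q := b - x; have pq : p <= q by rewrite lerB.
rewrite -/p in hB; rewrite -/q in hA.
have [q0|q0] := leP 0 q; last first.
  have p0 : p < 0 by exact: le_lt_trans q0.
  have [A1 B1 q1 p1] := And4 (ltW A0) (ltW B0) (ltW q0) (ltW p0).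
  rewrite -lerN2 -!mulNr -(ler_pXn2r (n:=2)) ?nnegrE ?mulr_ge0 ?oppr_ge0//.
  rewrite !exprMn hA hB !sqrrN.
  have : q ^+ 2 <= p ^+ 2 by nra.
  by move=> /(ler_wpM2r (sqr_ge0 t)); lra.
have [p0|p0] := ltP p 0.
  apply: (@le_trans _ _ 0); last by rewrite mulr_ge0// ltW.
  by rewrite nmulr_rle0// ltW.
have [A1 B1] := conj (ltW A0) (ltW B0).
rewrite -(ler_pXn2r (n:=2)) ?nnegrE ?mulr_ge0//.
rewrite !exprMn hA hB.
have : p ^+ 2 <= q ^+ 2 by rewrite ler_pXn2r ?nnegrE.
by move=> /(ler_wpM2r (sqr_ge0 t)); lra.
Qed.

End ComplexBasics.

(** * Limits and integrals of complex-valued functions *)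

Section ComplexLimits.
Variable R : realType.
Context {T : Type} {F : set_system T} {FF : Filter F}.
Implicit Types (f g : T -> R[i]) (l m : R[i]).

(** Limits are taken coordinatewise, so that the theory of real functions applies. *)
Definition ccvg f l :=
  (Re (f t) @[t --> F] --> Re l) /\ (Im (f t) @[t --> F] --> Im l).

Lemma ccvg_cst l : ccvg (fun=> l) l.
Proof. by split; exact: cvg_cst. Qed.

Lemma ccvg_real (f : T -> R) (x : R) : f @ F --> x -> ccvg (fun t => (f t)%:C) x%:C.
Proof. by move=> fx; split => //=; exact: cvg_cst. Qed.

Lemma ccvgD f g l m : ccvg f l -> ccvg g m -> ccvg (fun t => f t + g t) (l + m).
Proof.
move=> [f1 f2] [g1 g2]; split; rewrite ?cReD ?cImD.
  by under eq_fun do rewrite cReD; exact: cvgD.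
by under eq_fun do rewrite cImD; exact: cvgD.
Qed.

Lemma ccvgM f g l m : ccvg f l -> ccvg g m -> ccvg (fun t => f t * g t) (l * m).
Proof.
move=> [f1 f2] [g1 g2]; split; rewrite ?cReM ?cImM.
  by under eq_fun do rewrite cReM; apply: cvgB; exact: cvgM.
by under eq_fun do rewrite cImM; apply: cvgD; exact: cvgM.
Qed.

Lemma sqr_nm_neq0 l : l != 0 -> Re l ^+ 2 + Im l ^+ 2 != 0.
Proof. by move=> l0; rewrite -nm_sqr expf_neq0// nm_eq0. Qed.

Lemma cvg_sqr (f : T -> R) (x : R) : f @ F --> x -> (f t ^+ 2) @[t --> F] --> x ^+ 2.
Proof. by move=> fx; rewrite expr2; under eq_fun do rewrite expr2; exact: cvgM. Qed.

Lemma ccvgV f l : l != 0 -> ccvg f l -> ccvg (fun t => (f t)^-1) l^-1.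
Proof.
move=> l0 [f1 f2].
have fn : (Re (f t) ^+ 2 + Im (f t) ^+ 2)^-1 @[t --> F] -->
    (Re l ^+ 2 + Im l ^+ 2)^-1.
  by apply: cvgV; [exact: sqr_nm_neq0|apply: cvgD; exact: cvg_sqr].
split; rewrite ?cReV ?cImV.
  by under eq_fun do rewrite cReV; exact: cvgM.
by under eq_fun do rewrite cImV; apply: cvgM => //; exact: cvgN.
Qed.

Lemma ccvg_prod (I : Type) (s : seq I) (P : pred I) (f : I -> T -> R[i]) (l : I -> R[i]) :
  (forall i, P i -> ccvg (f i) (l i)) ->
  ccvg (fun t => \prod_(i <- s | P i) f i t) (\prod_(i <- s | P i) l i).
Proof.
move=> fl; elim: s => [|i s ih].
  by rewrite big_nil; under eq_fun do rewrite big_nil; exact: ccvg_cst.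
rewrite big_cons; under eq_fun do rewrite big_cons.
by case: ifPn => // Pi; apply: ccvgM => //; exact: fl.
Qed.

Lemma nmE l : nm l = Num.sqrt (Re l ^+ 2 + Im l ^+ 2).
Proof. by rewrite -nm_sqr sqrtr_sqr ger0_norm ?nm_ge0. Qed.

Lemma cvg_sqrt (f : T -> R) (x : R) :
  f @ F --> x -> (Num.sqrt (f t)) @[t --> F] --> Num.sqrt x.
Proof. by move=> fx; apply: continuous_cvg => //; exact: sqrt_continuous. Qed.

Lemma ccvg_nm f l : ccvg f l -> (nm (f t)) @[t --> F] --> nm l.
Proof.
move=> [f1 f2]; rewrite nmE; under eq_fun do rewrite nmE.
by apply: cvg_sqrt; apply: cvgD; exact: cvg_sqr.
Qed.

(** The branch of the square root is continuous up to the real line, because there its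
coordinates are real square roots of the continuous functions |z| + Re z and |z| - Re z,
up to a factor. *)
Lemma ccvg_sqrtc f l : 0 <= Im l -> (\forall t \near F, 0 <= Im (f t)) ->
  ccvg f l -> ccvg (fun t => sqrtc (f t)) (sqrtc l).
Proof.
move=> l0 f0 fl; have fn := ccvg_nm fl; have [f1 f2] := fl.
rewrite sqrtcE//; split => /=.
  suff : Num.sqrt ((nm (f t) + Re (f t)) / 2) @[t --> F] --> Num.sqrt ((nm l + Re l) / 2).
    apply: cvg_trans; apply: near_eq_cvg; near=> t.
    by rewrite sqrtcE//; near: t.
  by apply: cvg_sqrt; apply: cvgM; [exact: cvgD|exact: cvg_cst].
suff : Num.sqrt ((nm (f t) - Re (f t)) / 2) @[t --> F] --> Num.sqrt ((nm l - Re l) / 2).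
  apply: cvg_trans; apply: near_eq_cvg; near=> t.
  by rewrite sqrtcE//; near: t.
by apply: cvg_sqrt; apply: cvgM; [exact: cvgB|exact: cvg_cst].
Unshelve. all: by end_near. Qed.

Lemma ccvg_ext f g l : f =1 g -> ccvg f l -> ccvg g l.
Proof. by move=> /funext ->. Qed.

End ComplexLimits.
Arguments ccvg {R T} F f l.

Section ComplexIntegral.
Variable R : realType.
Implicit Types (f g : R -> R[i]) (D : set R).

Definition cmeas D f := measurable_fun D (Re \o f) /\ measurable_fun D (Im \o f).

Lemma cmeas_cst D w : cmeas D (fun=> w).
Proof. by split; exact: measurable_cst. Qed.

Lemma cmeas_ext D f g : f =1 g -> cmeas D f -> cmeas D g.
Proof. by move=> /funext ->. Qed.

Lemma cmeasD D f g : cmeas D f -> cmeas D g -> cmeas D (fun t => f t + g t).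
Proof.
move=> [f1 f2] [g1 g2]; split.
  rewrite (_ : Re \o _ = (Re \o f) \+ (Re \o g)); first exact: measurable_funD.
  by apply/funext => t /=; rewrite cReD.
rewrite (_ : Im \o _ = (Im \o f) \+ (Im \o g)); first exact: measurable_funD.
by apply/funext => t /=; rewrite cImD.
Qed.

Lemma cmeasM D f g : cmeas D f -> cmeas D g -> cmeas D (fun t => f t * g t).
Proof.
move=> [f1 f2] [g1 g2]; split.
  rewrite (_ : Re \o _ = ((Re \o f) \* (Re \o g)) \- ((Im \o f) \* (Im \o g))).
    by apply: measurable_funB; exact: measurable_funM.
  by apply/funext => t /=; rewrite cReM.
rewrite (_ : Im \o _ = ((Re \o f) \* (Im \o g)) \+ ((Im \o f) \* (Re \o g))).
  by apply: measurable_funD; exact: measurable_funM.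
by apply/funext => t /=; rewrite cImM.
Qed.

Lemma measurable_sqrt D (f : R -> R) :
  measurable_fun D f -> measurable_fun D (fun t => Num.sqrt (f t)).
Proof.
move=> mf; apply: (measurableT_comp (f:=@Num.sqrt R)) => //.
by apply: continuous_measurable_fun; exact: sqrt_continuous.
Qed.

(** For a nonnegative function the inverse is the real power with exponent -1. *)
Lemma measurable_inv D (f : R -> R) :
  (forall t, 0 <= f t) -> measurable_fun D f -> measurable_fun D (fun t => (f t)^-1).
Proof.
move=> f0 mf; under eq_fun do rewrite -powR_inv1//.
by apply: (measurableT_comp (f:=@powR R ^~ (-1))) => //; exact: measurable_powR.
Qed.

Lemma cmeas_nm D f : cmeas D f -> measurable_fun D (fun t => nm (f t)).
Proof.
move=> [f1 f2]; under eq_fun do rewrite nmE; apply: measurable_sqrt.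
by apply: measurable_funD; exact: measurable_funX.
Qed.

Lemma cmeasV D f : cmeas D f -> cmeas D (fun t => (f t)^-1).
Proof.
move=> [f1 f2].
have fn : measurable_fun D (fun t => (Re (f t) ^+ 2 + Im (f t) ^+ 2)^-1).
  apply: measurable_inv; first by move=> t; rewrite addr_ge0 ?sqr_ge0.
  by apply: measurable_funD; exact: measurable_funX.
split.
  rewrite (_ : Re \o _ = (Re \o f) \* (fun t => (Re (f t) ^+ 2 + Im (f t) ^+ 2)^-1)).
    exact: measurable_funM.
  by apply/funext => t /=; rewrite cReV.
rewrite (_ : Im \o _ = (\- (Im \o f)) \* (fun t => (Re (f t) ^+ 2 + Im (f t) ^+ 2)^-1)).
  by apply: measurable_funM => //; exact: measurable_funN.
by apply/funext => t /=; rewrite cImV.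
Qed.

Lemma cmeas_prod D (I : Type) (s : seq I) (P : pred I) (f : I -> R -> R[i]) :
  (forall i, P i -> cmeas D (f i)) -> cmeas D (fun t => \prod_(i <- s | P i) f i t).
Proof.
move=> fl; elim: s => [|i s ih].
  by under eq_fun do rewrite big_nil; exact: cmeas_cst.
case Pi : (P i); last by under eq_fun do rewrite big_cons Pi.
by under eq_fun do rewrite big_cons Pi; apply: cmeasM => //; exact: fl.
Qed.

Lemma cmeas_sqrtc D f : (forall t, D t -> 0 <= Im (f t)) ->
  cmeas D f -> cmeas D (fun t => sqrtc (f t)).
Proof.
move=> f0 mf; have mn := cmeas_nm mf; have [f1 f2] := mf; split.
  apply: (@eq_measurable_fun _ _ _ _ _ (fun t => Num.sqrt ((nm (f t) + Re (f t)) / 2))).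
    by move=> t; rewrite inE => Dt /=; rewrite sqrtcE//; exact: f0.
  apply: measurable_sqrt; apply: measurable_funM; last exact: measurable_cst.
  exact: measurable_funD.
apply: (@eq_measurable_fun _ _ _ _ _ (fun t => Num.sqrt ((nm (f t) - Re (f t)) / 2))).
  by move=> t; rewrite inE => Dt /=; rewrite sqrtcE//; exact: f0.
apply: measurable_sqrt; apply: measurable_funM; last exact: measurable_cst.
exact: measurable_funB.
Qed.

Lemma measurable_affine D (a b : R) : measurable_fun D (fun t => a + t * b).
Proof.
by apply: measurable_funD => //; apply: measurable_funM.
Qed.

Lemma cmeas_affine D (a b : R[i]) : cmeas D (fun t : R => a + t%:C * b).
Proof.
split.
  rewrite (_ : Re \o _ = (fun t : R => Re a + t * Re b)); first exact: measurable_affine.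
  by apply/funext => t /=; rewrite cReD cReZ.
rewrite (_ : Im \o _ = (fun t : R => Im a + t * Im b)); first exact: measurable_affine.
by apply/funext => t /=; rewrite cImD cImZ.
Qed.

Definition rintegrable D (f : R -> R) := leb.-integrable D (EFin \o f).
Definition cintegrable D f := rintegrable D (Re \o f) /\ rintegrable D (Im \o f).

Lemma rintegrable_le D (f g : R -> R) : measurable D -> measurable_fun D f ->
  (forall t, D t -> `|f t| <= g t) -> rintegrable D g -> rintegrable D f.
Proof.
move=> mD mf fg ig; apply: (@le_integrable _ _ _ leb D mD _ (EFin \o g)) => //.
  exact/measurable_EFinP.
by move=> t Dt /=; rewrite lee_fin (le_trans (fg _ Dt))// ler_norm.
Qed.

Lemma cintegrable_le D f (g : R -> R) : measurable D -> cmeas D f ->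
  (forall t, D t -> nm (f t) <= g t) -> rintegrable D g -> cintegrable D f.
Proof.
move=> mD [f1 f2] fg ig; split; apply: (rintegrable_le mD _ _ ig) => // t Dt /=.
  by rewrite (le_trans (Re_nm _))// fg.
by rewrite (le_trans (Im_nm _))// fg.
Qed.

Lemma rintegrable_cst (a b x : R) : rintegrable `[a, b] (fun=> x).
Proof.
apply: measurable_bounded_integrable => //.
- by rewrite /= lebesgue_measure_itv/=; case: ifP => // _; rewrite ltry.
- exact: bounded_cst.
Qed.

Lemma rintegrableD D (f g : R -> R) : measurable D ->
  rintegrable D f -> rintegrable D g -> rintegrable D (fun t => f t + g t).
Proof.
move=> mD fi gi; rewrite /rintegrable.
by apply: (@integrableD _ _ _ leb D _ (EFin \o f) (EFin \o g)).
Qed.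

Lemma rintegrableZ D (x : R) (f : R -> R) : measurable D ->
  rintegrable D f -> rintegrable D (fun t => x * f t).
Proof.
move=> mD fi; rewrite /rintegrable.
by apply: (@integrableZl _ _ _ leb D _ x (EFin \o f)).
Qed.

Lemma rintegrableS D E (f : R -> R) : measurable D -> measurable E ->
  D `<=` E -> rintegrable E f -> rintegrable D f.
Proof. by move=> mD mE DE; exact: integrableS. Qed.

Lemma rintegrable_mf D (f : R -> R) : rintegrable D f -> measurable_fun D f.
Proof. by move=> /measurable_int /measurable_EFinP. Qed.

Lemma cintegrableZ D (w : R[i]) f : measurable D ->
  cintegrable D f -> cintegrable D (fun t => w * f t).
Proof.
move=> mD [f1 f2]; split.
  rewrite (_ : Re \o _ = (fun t => Re w * (Re \o f) t + (- Im w) * (Im \o f) t)).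
    by apply: rintegrableD => //; exact: rintegrableZ.
  by apply/funext => t /=; rewrite cReM mulNr.
rewrite (_ : Im \o _ = (fun t => Re w * (Im \o f) t + (Im w) * (Re \o f) t)).
  by apply: rintegrableD => //; exact: rintegrableZ.
by apply/funext => t /=; rewrite cImM.
Qed.

Lemma cintegrableD D f g : measurable D ->
  cintegrable D f -> cintegrable D g -> cintegrable D (fun t => f t + g t).
Proof.
move=> mD [f1 f2] [g1 g2]; split.
  rewrite (_ : Re \o _ = (fun t => (Re \o f) t + (Re \o g) t)); first exact: rintegrableD.
  by apply/funext => t /=; rewrite cReD.
rewrite (_ : Im \o _ = (fun t => (Im \o f) t + (Im \o g) t)); first exact: rintegrableD.
by apply/funext => t /=; rewrite cImD.
Qed.

Lemma CintD (a b : R) f g : cintegrable `[a, b] f -> cintegrable `[a, b] g ->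
  Cint (fun t => f t + g t) a b = Cint f a b + Cint g a b.
Proof.
move=> [f1 f2] [g1 g2]; rewrite /Cint; apply: complexP => /=.
  by under eq_Rintegral do rewrite cReD; rewrite RintegralD.
by under eq_Rintegral do rewrite cImD; rewrite RintegralD.
Qed.

Lemma CintZ (a b : R) w f : cintegrable `[a, b] f ->
  Cint (fun t => w * f t) a b = w * Cint f a b.
Proof.
move=> [f1 f2]; rewrite /Cint; apply: complexP; rewrite ?cReM ?cImM /=.
  under eq_Rintegral do rewrite cReM.
  by rewrite RintegralB ?RintegralZl//; exact: rintegrableZ.
under eq_Rintegral do rewrite cImM.
by rewrite RintegralD ?RintegralZl//; exact: rintegrableZ.
Qed.

Lemma CintB (a b : R) f g : cintegrable `[a, b] f -> cintegrable `[a, b] g ->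
  Cint (fun t => f t - g t) a b = Cint f a b - Cint g a b.
Proof.
move=> fi gi; have gi' := cintegrableZ (-1) (measurable_itv `[a, b]) gi.
under [X in Cint X]eq_fun do rewrite -mulN1r.
by rewrite CintD// CintZ// mulN1r.
Qed.

(** The factor 2 comes from bounding the two coordinates separately. *)
Lemma Cint_bound (a b : R) f (g : R -> R) : cmeas `[a, b] f ->
  (forall t, a <= t <= b -> nm (f t) <= g t) -> rintegrable `[a, b] g ->
  nm (Cint f a b) <= 2 * \int[leb]_(t in `[a, b]) g t.
Proof.
move=> mf fg ig; rewrite (le_trans (nm_ReIm _))// mulr_natl mulr2n.
have fgD t : `[a, b]%classic t -> nm (f t) <= g t.
  by rewrite /= in_itv/= => /fg.
have [f1 f2] := cintegrable_le (measurable_itv `[a, b]) mf fgD ig.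
have key (h : R -> R) : rintegrable `[a, b] h ->
    (forall t, `[a, b]%classic t -> `|h t| <= g t) ->
    `|\int[leb]_(t in `[a, b]) h t| <= \int[leb]_(t in `[a, b]) g t.
  move=> hi hg; rewrite (le_trans (le_normr_Rintegral _ hi))//.
  by apply: le_Rintegral => //; apply: integrable_norm.
apply: lerD; apply: key => // t Dt; rewrite (le_trans _ (fgD _ Dt))//.
  exact: Re_nm.
exact: Im_nm.
Qed.

(** Dominated convergence for the two coordinates, which the modulus dominates. *)
Lemma Cint_dominated (a b : R) (f_ : nat -> R -> R[i]) f (g : R -> R) :
  (forall n, cmeas `[a, b] (f_ n)) -> cmeas `[a, b] f ->
  {ae leb, forall t, `[a, b]%classic t -> ccvg \oo (fun n => f_ n t) (f t)} ->
  {ae leb, forall t n, `[a, b]%classic t -> nm (f_ n t) <= g t} ->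
  rintegrable `[a, b] g ->
  cintegrable `[a, b] f /\ ccvg \oo (fun n => Cint (f_ n) a b) (Cint f a b).
Proof.
move=> mf_ mf ff fg ig; have aeF := ae_filter_ringOfSetsType leb.
have key (p : R[i] -> R) : (forall w, `|p w| <= nm w) ->
    (forall n, measurable_fun `[a, b] (p \o f_ n)) -> measurable_fun `[a, b] (p \o f) ->
    {ae leb, forall t, `[a, b]%classic t -> p (f_ n t) @[n --> \oo] --> p (f t)} ->
    rintegrable `[a, b] (p \o f) /\
    \int[leb]_(t in `[a, b]) p (f_ n t) @[n --> \oo] --> \int[leb]_(t in `[a, b]) p (f t).
  move=> pn mpf_ mpf pff; rewrite /Rintegral.
  have h1 : {ae leb, forall t, `[a, b]%classic t ->
      (p (f_ n t))%:E @[n --> \oo] --> (p (f t))%:E}.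
    by apply: filterS pff => t h Dt; apply: cvg_EFin; [near=> n|exact: h].
  have h2 : {ae leb, forall t n, `[a, b]%classic t -> (`|(p (f_ n t))%:E| <= (g t)%:E)%E}.
    by apply: filterS fg => t h n Dt /=; rewrite lee_fin (le_trans (pn _))// h.
  have [ipf _ c] := @dominated_convergence _ _ _ leb `[a, b]%classic
    (measurable_itv _) (fun n t => (p (f_ n t))%:E) (fun t => (p (f t))%:E)
    (EFin \o g) (fun n => (measurable_EFinP _ _).2 (mpf_ n)) ((measurable_EFinP _ _).2 mpf)
    h1 ig h2.
  split; first exact: ipf.
  by apply: fine_cvg; rewrite fineK//; exact: integrable_fin_num.
have ff1 : {ae leb, forall t, `[a, b]%classic t -> Re (f_ n t) @[n --> \oo] --> Re (f t)}.
  by apply: filterS ff => t h Dt; exact: (h Dt).1.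
have ff2 : {ae leb, forall t, `[a, b]%classic t -> Im (f_ n t) @[n --> \oo] --> Im (f t)}.
  by apply: filterS ff => t h Dt; exact: (h Dt).2.
have [i1 l1] := key Re (@Re_nm R) (fun n => (mf_ n).1) mf.1 ff1.
have [i2 l2] := key Im (@Im_nm R) (fun n => (mf_ n).2) mf.2 ff2.
by split.
Unshelve. all: by end_near. Qed.

End ComplexIntegral.

(** * The fundamental theorem of calculus with singular ends *)

Section Calculus.
Variable R : realType.
Implicit Types (f g F : R -> R) (a b x y : R).

(** A quadratic error term, unlike a limit, results directly from explicit estimates. *)
Lemma quad_derive f x l (C d : R) : 0 < d ->
  (forall t, `|t| < d -> `|f (x + t) - f x - t * l| <= C * t ^+ 2) ->
  is_derive x 1 f l.
Proof.
move=> d0 H.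
suff D : (fun h => h^-1 *: ((f \o shift x) (h *: (1 : R)) - f x)) @ 0^' --> l.
  by apply: DeriveDef; [apply/cvg_ex; exists l|exact/cvg_lim].
apply/cvgrPdist_le => e e0; near=> t.
have t0 : t != 0 by near: t; exact: nbhs_dnbhs_neq.
rewrite /= scaler1 addrC [t + x]addrC /= -[_ *: _]/(_ * _).
have -> : - (t^-1 * (f (x + t) - f x)) + l = - (t^-1 * (f (x + t) - f x - t * l)).
  by rewrite [in RHS]mulrBr mulKf// opprB addrC.
rewrite normrN normrM normfV mulrC ler_pdivrMr ?normr_gt0//.
apply: le_trans (H t _) _.
  near: t; apply/nbhs_dnbhs => //=; exact: (@nbhs0_lt R R).
have -> : C * t ^+ 2 = (C * `|t|) * `|t|.
  by rewrite -mulrA -expr2 real_normK ?num_real.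
rewrite ler_wpM2r//; apply: (@le_trans _ _ ((`|C| + 1) * `|t|)).
  by rewrite ler_wpM2r// (le_trans (ler_norm C))// lerDl.
rewrite mulrC -ler_pdivlMr ?ltr_wpDl//.
near: t; apply/nbhs_dnbhs => //=; apply: (@nbhs0_le R R).
by rewrite divr_gt0// ltr_wpDl.
Unshelve. all: by end_near. Qed.

Lemma is_derive_cont f x l : is_derive x 1 f l -> {for x, continuous f}.
Proof.
move=> D; apply: differentiable_continuous; apply/derivable1_diffP.
exact: (@ex_derive _ _ _ _ _ _ _ D).
Qed.

Lemma cont_within f (A : set R) : (forall x, A x -> {for x, continuous f}) ->
  {within A, continuous f}.
Proof.
move=> H; apply: continuous_in_subspaceT => x; rewrite inE => Ax; exact: H.
Qed.

Lemma regular_FTC f F a b : a < b ->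
  (forall x, a <= x <= b -> {for x, continuous f}) ->
  (forall x, a <= x <= b -> is_derive x 1 F (f x)) ->
  (\int[leb]_(x in `[a, b]) (f x)%:E = (F b)%:E - (F a)%:E)%E.
Proof.
move=> ab cf dF; have inab x : x \in `]a, b[ -> a <= x <= b.
  by rewrite in_itv/= => /andP[/ltW -> /ltW ->].
have cF x : a <= x <= b -> {for x, continuous F}.
  by move=> /dF; exact: is_derive_cont.
apply: continuous_FTC2 => //.
- by apply: cont_within => x; rewrite /= in_itv/=; exact: cf.
- split.
  + by move=> x /inab /dF D; exact: (@ex_derive _ _ _ _ _ _ _ D).
  + by apply: cvg_at_right_filter; apply: cF; rewrite lexx ltW.
  + by apply: cvg_at_left_filter; apply: cF; rewrite lexx ltW.
- by move=> x /inab /dF D; rewrite derive1E derive_val.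
Qed.

Lemma measurable_itv_oo_cc a b f : measurable_fun `]a, b[ f -> measurable_fun `[a, b] f.
Proof.
by move=> mf; apply: (@measurable_fun_itv_cc R a b false true f).
Qed.

Lemma rintegrable_oo_cc a b f : rintegrable `]a, b[ f -> rintegrable `[a, b] f.
Proof.
have [ab|ba] := ltP a b; last first.
  move=> _; have [->|nab] := eqVneq a b; last first.
    rewrite set_itv_ge ?bnd_simp -?ltNge ?lt_neqAle ?ba 1?eq_sym ?nab//.
    exact: integrable_set0.
  rewrite set_itv1; apply/integrableP; split.
    by apply/measurable_EFinP; exact: measurable_fun_set1.
  by rewrite integral_set1.
move=> /integrableP[mf fi].
have mf1 : measurable_fun `]a, b[ f by exact/measurable_EFinP.
apply/integrableP; split; first by apply/measurable_EFinP; exact: measurable_itv_oo_cc.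
have mf2 : measurable_fun `]a, b[ (fun x => `|(f x)%:E|%E).
  by apply: measurableT_comp => //; exact/measurable_EFinP.
rewrite -integral_itv_obnd_cbnd; last first.
  by apply/emeasurable_fun_itv_obnd_cbndP; apply: emeasurable_fun_itv_cc mf2.
rewrite -integral_itv_bndo_bndc//.
Qed.

(** The fundamental theorem bounds the integral over every compact subinterval by the
oscillation of the primitive; monotone convergence does the rest. *)
Lemma improper_integrable f F a b (M : R) :
  (forall x, a < x < b -> 0 <= f x) ->
  (forall x, a < x < b -> {for x, continuous f}) ->
  (forall x, a < x < b -> is_derive x 1 F (f x)) ->
  (forall x, a < x < b -> `|F x| <= M) ->
  rintegrable `[a, b] f.
Proof.
move=> f0 cf dF FM; apply: rintegrable_oo_cc.
pose S n : set R := `[a + n.+1%:R^-1, b - n.+1%:R^-1]%classic.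
have Sab n x : S n x -> a < x < b.
  rewrite /S /= in_itv/= => /andP[h1 h2]; apply/andP; split.
    by rewrite (lt_le_trans _ h1)// ltrDl.
  by rewrite (le_lt_trans h2)// ltrBlDr ltrDl.
have SU : \bigcup_n S n = `]a, b[%classic.
  apply/seteqP; split => x /=; first by move=> [n _ /Sab]; rewrite in_itv.
  rewrite in_itv/= => /andP[ax xb].
  have [e [e0 ea eb]] : exists e, [/\ 0 < e, e <= x - a & e <= b - x].
    exists (Num.min (x - a) (b - x)).
    by rewrite lt_min !subr_gt0 ax xb !ge_min !lexx orbT.
  exists (Num.truncn e^-1) => //.
  have : ((Num.truncn e^-1).+1%:R)^-1 <= e.
    by rewrite invf_ple ?posrE// ltW// truncnS_gt.
  rewrite /S /= in_itv/=; move: (_^-1) => q h; apply/andP; split; lra.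
have mS n : measurable (S n) by exact: measurable_itv.
have cS n : {within S n, continuous f}.
  by apply: cont_within => x /Sab; exact: cf.
have mf n : measurable_fun (S n) f.
  by apply: subspace_continuous_measurable_fun.
have mfab : measurable_fun `]a, b[ f.
  rewrite -SU; apply/measurable_fun_bigcup => //.
have ndS : nondecreasing_seq S.
  apply/nondecreasing_seqP => n; apply/subsetPset => x.
  rewrite /S /= !in_itv/= => /andP[h1 h2].
  have h : n.+2%:R^-1 <= n.+1%:R^-1 :> R by rewrite lef_pV2 ?posrE// ler_nat.
  by move: (_^-1) (_^-1) h h1 h2 => q r h h1 h2; apply/andP; split; lra.
have IS n : (\int[leb]_(x in S n) (f x)%:E <= (`|M| + `|M|)%:E)%E.
  have [ab|ba] := ltP (a + n.+1%:R^-1) (b - n.+1%:R^-1).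
    have abn x : a + n.+1%:R^-1 <= x <= b - n.+1%:R^-1 -> a < x < b.
      by move=> h; apply: (Sab n); rewrite /S /= in_itv.
    have -> := @regular_FTC f F _ _ ab (fun x h => cf x (abn x h))
                                       (fun x h => dF x (abn x h)).
    rewrite -EFinB lee_fin (le_trans (ler_norm _))// (le_trans (ler_normB _ _))//.
    by apply: lerD; rewrite (le_trans (FM _ _)) ?ler_norm//; apply: abn; rewrite lexx ltW.
  have [E|E] := eqVneq (a + n.+1%:R^-1) (b - n.+1%:R^-1).
    by rewrite /S E set_itv1 integral_set1 lee_fin addr_ge0.
  rewrite /S set_itv_ge ?integral_set0 ?lee_fin ?addr_ge0//.
  by rewrite bnd_simp -ltNge lt_neqAle eq_sym E ba.
apply/integrableP; split; first exact/measurable_EFinP.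
have -> : (\int[leb]_(x in `]a, b[) `|(EFin \o f) x| = \int[leb]_(x in `]a, b[) (f x)%:E)%E.
  apply: eq_integral => x; rewrite inE /= in_itv/= => /f0 h.
  by rewrite ger0_norm.
apply: (@le_lt_trans _ _ (`|M| + `|M|)%:E); last by rewrite ltry.
have f0' n x : S n x -> (0 <= (EFin \o f) x)%E.
  by move=> /Sab /f0 h /=; rewrite lee_fin.
have := @ge0_nondecreasing_set_cvg_integral _ (measurableTypeR R) R S (EFin \o f) leb ndS mS
  (fun n => (measurable_EFinP _ _).2 (mf n)) f0'.
rewrite SU => cv; rewrite -(cvg_lim _ cv)//.
by apply: lime_le; [apply/cvg_ex; eexists; exact: cv|exact: nearW].
Qed.

(** The indefinite integral of f and F have the same derivative inside the interval and are
both continuous up to its ends, where f may be singular. *)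
Lemma improper_FTC f F a b : a < b ->
  rintegrable `[a, b] f ->
  (forall x, a < x < b -> {for x, continuous f}) ->
  (forall x, a < x < b -> is_derive x 1 F (f x)) ->
  {within `[a, b], continuous F} ->
  \int[leb]_(x in `[a, b]) f x = F b - F a.
Proof.
move=> ab fi cf dF cF.
pose G x := parameterized_integral leb a x f.
have cG : {within `[a, b], continuous G}.
  by apply: parameterized_integral_continuous => //; exact: ltW.
have dG x : x \in `]a, b[ -> is_derive x 1 (G - F) ((fun=> 0) x).
  rewrite in_itv/= => /andP[ax xb]; have axb : a < x < b by rewrite ax.
  have [dg eg] := @continuous_FTC1_closed _ f a x b xb fi ax (cf x axb).
  have dg' : is_derive x 1 G (f x).
    by apply: (DeriveDef dg); rewrite -derive1E; exact: eg.
  have df' := dF x axb.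
  by rewrite /= -(subrr (f x)); exact: is_deriveB.
have cGF : {within `[a, b], continuous (G - F)}.
  by move=> x; apply: continuousB; [exact: cG|exact: cF].
have [c _] := MVT ab dG cGF.
rewrite mul0r => /eqP; rewrite subr_eq0 => /eqP.
have Ga : G a = 0 by rewrite /G /parameterized_integral set_itv1 Rintegral_set1.
rewrite !fctE Ga /G /parameterized_integral sub0r => /eqP.
by rewrite subr_eq addrC => /eqP ->.
Qed.

(** Otherwise f would vanish almost everywhere. *)
Lemma Rintegral_gt0 f a b : a < b -> rintegrable `[a, b] f ->
  (forall x, a < x < b -> 0 < f x) -> 0 < \int[leb]_(x in `[a, b]) f x.
Proof.
move=> ab fi f0.
have fio : rintegrable `]a, b[ f.
  by apply: rintegrableS fi => //; exact: subset_itv_oo_cc.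
have -> : \int[leb]_(x in `[a, b]) f x = \int[leb]_(x in `]a, b[) f x.
  rewrite -Rintegral_itv_obnd_cbnd; last first.
    by apply: rintegrableS fi => //; exact: subset_itv_oc_cc.
  by rewrite -Rintegral_itv_bndo_bndc.
rewrite lt_def; apply/andP; split; last first.
  by apply: Rintegral_ge0 => x /=; rewrite in_itv/= => /f0/ltW.
apply/eqP => I0.
have mf : measurable_fun `]a, b[ (EFin \o f) by case/integrableP : fio.
have /(ae_eq_integral_abs leb (measurable_itv `]a, b[) mf).1 :
    (\int[leb]_(x in `]a, b[) `|(EFin \o f) x| = 0)%E.
  have -> : (\int[leb]_(x in `]a, b[) `|(EFin \o f) x| = \int[leb]_(x in `]a, b[) (f x)%:E)%E.
    by apply: eq_integral => x; rewrite inE /= in_itv/= => /f0/ltW h; rewrite ger0_norm.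
  have <- : (fine (\int[leb]_(x in `]a, b[) (f x)%:E))%:E = (\int[leb]_(x in `]a, b[) (f x)%:E)%E.
    by rewrite fineK//; exact: integrable_fin_num.
  by rewrite -[fine _]/(\int[leb]_(x in `]a, b[) f x) I0.
move=> [N [mN N0 sub]].
have : (leb `]a, b[%classic <= leb N)%E.
  apply: le_measure; rewrite ?inE// => x xab; apply: sub => /= /(_ xab) [] E.
  by move: xab; rewrite /= in_itv/= => /f0; rewrite E ltxx.
by rewrite N0 /= lebesgue_measure_itv/= lte_fin ab lee_fin leNgt subr_gt0 ab.
Qed.

End Calculus.

Section MeanValue.
Variable R : realType.
Implicit Types (f df : R -> R) (x y m : R).

Lemma mean_value f df x y : x < y ->
  (forall t, x <= t <= y -> is_derive t 1 f (df t)) ->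
  exists2 t, x < t < y & f y - f x = df t * (y - x).
Proof.
move=> xy D; have [t|z|t] := @MVT R f df x y xy.
- by rewrite in_itv/= => /andP[/ltW h1 /ltW h2]; apply: D; rewrite h1.
- apply: cont_within => {}z /=; rewrite in_itv/= => /D; exact: is_derive_cont.
- by rewrite in_itv/=; exists t.
Qed.

Lemma mean_value_le f df x y m : x <= y ->
  (forall t, x <= t <= y -> is_derive t 1 f (df t)) ->
  (forall t, x < t < y -> `|df t| <= m) -> `|f y - f x| <= m * (y - x).
Proof.
rewrite le_eqVlt => /predU1P[-> _ _|xy D H]; first by rewrite !subrr normr0 mulr0.
have [t /H h ->] := mean_value xy D.
by rewrite normrM [X in _ * X]gtr0_norm ?subr_gt0// ler_wpM2r// subr_ge0 ltW.
Qed.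

Lemma cvg_ge {T : Type} {F : set_system T} {FF : ProperFilter F} (f : T -> R) l m :
  f @ F --> l -> (\forall t \near F, m <= f t) -> m <= l.
Proof.
move=> fl H; rewrite -(cvg_lim _ fl)//.
by apply: limr_ge => //; apply/cvg_ex; exists l.
Qed.

Lemma cvg_le {T : Type} {F : set_system T} {FF : ProperFilter F} (f : T -> R) l m :
  f @ F --> l -> (\forall t \near F, f t <= m) -> l <= m.
Proof.
move=> fl H; rewrite -(cvg_lim _ fl)//.
by apply: limr_le => //; apply/cvg_ex; exists l.
Qed.
End MeanValue.

(** * Integrability of inverse square roots *)

Section InverseSquareRoots.
Variable R : realType.
Implicit Types (f g F : R -> R) (a b x y r t : R).

(** The size of the singular factors of eta on the real line. *)
Definition invsqrt x : R := (Num.sqrt `|x|)^-1.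

Lemma invsqrt_ge0 x : 0 <= invsqrt x. Proof. by rewrite invr_ge0 sqrtr_ge0. Qed.

Lemma invsqrtM x y : invsqrt (x * y) = invsqrt x * invsqrt y.
Proof. by rewrite /invsqrt normrM sqrtrM// invfM. Qed.

Lemma invsqrt_le (e x : R) : 0 < e -> e <= `|x| -> invsqrt x <= invsqrt e.
Proof.
move=> e0 ex; have x0 : 0 < `|x| by exact: lt_le_trans ex.
rewrite /invsqrt (gtr0_norm e0) lef_pV2 ?posrE ?sqrtr_gt0//.
by rewrite ler_wsqrtr.
Qed.

Lemma measurable_invsqrt (D : set R) f : measurable_fun D f -> measurable_fun D (invsqrt \o f).
Proof.
move=> mf; apply: measurable_inv; first by move=> t; exact: sqrtr_ge0.
by apply: measurable_sqrt; apply: measurableT_comp.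
Qed.

Lemma continuous_invsqrt x : x != 0 -> {for x, continuous invsqrt}.
Proof.
move=> x0; apply: cvgV; first by rewrite sqrtr_eq0 -ltNge normr_gt0.
by apply: cvg_sqrt; apply: cvg_norm; exact: cvg_id.
Qed.

(** The primitive 2 sqrt(t - r) is bounded. *)
Lemma invsqrt_integrable_right r L : rintegrable `[r, r + L] (fun t => invsqrt (t - r)).
Proof.
apply: (@improper_integrable _ _ (fun t => 2 * Num.sqrt (t - r)) _ _ (2 * Num.sqrt L)).
- by move=> x _; exact: invsqrt_ge0.
- move=> x /andP[rx _]; apply: (@continuous_comp _ _ _ (fun t => t - r) invsqrt).
    by apply: cvgB; [exact: cvg_id|exact: cvg_cst].
  by apply: continuous_invsqrt; rewrite subr_eq0 gt_eqF.
- move=> x /andP[rx _]; have rx0 : 0 < x - r by rewrite subr_gt0.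
  have := @is_derive1_comp R Num.sqrt (fun t => t - r) x (2 * Num.sqrt (x - r))^-1 1
    (is_derive1_sqrt rx0) _.
  move=> H.
  have D1 : is_derive x 1 (fun t => t - r) 1.
    by rewrite -[X in is_derive _ _ _ X]subr0; apply: is_deriveB.
  have /(is_deriveZ 2) := H D1.
  rewrite mulr1 /invsqrt gtr0_norm// -[_ *: _]/(_ * _) invfM mulrA mulfV ?mul1r//.
- move=> x /andP[rx xL]; rewrite normrM !ger0_norm ?sqrtr_ge0//.
  rewrite ler_wpM2l// ler_wsqrtr// lerBlDl; exact: ltW.
Qed.

Lemma invsqrt_integrable_left r L : rintegrable `[r - L, r] (fun t => invsqrt (t - r)).
Proof.
apply: (@improper_integrable _ _ (fun t => (-2) * Num.sqrt (r - t)) _ _ (2 * Num.sqrt L)).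
- by move=> x _; exact: invsqrt_ge0.
- move=> x /andP[_ rx]; apply: (@continuous_comp _ _ _ (fun t => t - r) invsqrt).
    by apply: cvgB; [exact: cvg_id|exact: cvg_cst].
  by apply: continuous_invsqrt; rewrite subr_eq0 lt_eqF.
- move=> x /andP[_ rx]; have rx0 : 0 < r - x by rewrite subr_gt0.
  have D1 : is_derive x 1 (fun t => r - t) (-1).
    by rewrite -[X in is_derive _ _ _ X]sub0r; apply: is_deriveB.
  have := @is_derive1_comp R Num.sqrt (fun t => r - t) x (2 * Num.sqrt (r - x))^-1 (-1)
    (is_derive1_sqrt rx0) D1.
  move=> /(is_deriveZ (-2)).
  rewrite mulrN1 /invsqrt distrC gtr0_norm// -[_ *: _]/(_ * _) mulrNN invfM mulrA mulfV ?mul1r//.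
- move=> x /andP[rx xL]; rewrite normrM normrN !ger0_norm ?sqrtr_ge0//.
  rewrite ler_wpM2l// ler_wsqrtr// lerBlDl -lerBlDr; exact: ltW.
Qed.

Lemma rintegrableU (A B : set R) f : measurable A -> measurable B ->
  rintegrable A f -> rintegrable B f -> rintegrable (A `|` B) f.
Proof.
move=> mA mB fA fB; have fBA : rintegrable (B `\` A) f.
  by apply: rintegrableS fB => //; exact: measurableD.
have -> : A `|` B = A `|` (B `\` A).
  apply/seteqP; split => x [Ax|]; [by left| |by left|by move=> []; right].
  by have [Ax|nAx] := pselect (A x); [left|right].
have mBA : measurable (B `\` A) by exact: measurableD.
have mf : measurable_fun (A `|` (B `\` A)) f.
  by apply/measurable_funU => //; split; exact: rintegrable_mf.
apply/integrableP; split; first exact/measurable_EFinP.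
rewrite (@ge0_integral_setU _ (measurableTypeR R))//.
- by apply: lte_add_pinfty; [case/integrableP : fA|case/integrableP : fBA].
- by apply: measurableT_comp => //; exact/measurable_EFinP.
- by apply/disj_set2P; rewrite setDE setICA setICr setI0.
Qed.

Lemma invsqrt_integrable p q x y : (x != 0) || (y != 0) ->
  rintegrable `[p, q] (fun t => invsqrt (x + t * y)).
Proof.
have [->|y0 _] := eqVneq y 0.
  move=> _; rewrite (_ : (fun t : R => _) = (fun=> invsqrt x)); first exact: rintegrable_cst.
  by apply/funext => t; rewrite mulr0 addr0.
pose r := - x / y.
have E t : invsqrt (x + t * y) = invsqrt y * invsqrt (t - r).
  rewrite -invsqrtM; congr invsqrt; rewrite /r; field.
  exact: y0.
rewrite (_ : (fun t : R => _) = (fun t => invsqrt y * invsqrt (t - r))); last exact/funext.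
apply: rintegrableZ => //.
pose L := `|p - r| + `|q - r|.
have mf D : measurable_fun D (fun t => invsqrt (t - r)).
  by apply: measurable_invsqrt; exact: measurable_funB.
have U : rintegrable (`[r - L, r] `|` `[r, r + L]) (fun t => invsqrt (t - r)).
  by apply: rintegrableU => //; [exact: invsqrt_integrable_left|exact: invsqrt_integrable_right].
apply: rintegrableS U => //; first exact: measurableU.
move=> t /=; rewrite !in_itv/= => /andP[pt tq].
have h1 := ler_norm (q - r); have h2 := ler_norm (- (p - r)); rewrite normrN in h2.
have h3 := normr_ge0 (q - r); have h4 := normr_ge0 (p - r).
by have [tr|rt] := leP t r; [left|right]; apply/andP; split => //; rewrite /L; lra.
Qed.

(** Distinct singular factors are never singular together, which makes their product
integrable. *)
Definition jointly_bounded_below f g :=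
  exists2 e, 0 < e & forall t, (e <= `|f t|) || (e <= `|g t|).

(** At each point at most one factor is large, so that the product is dominated by the sum. *)
Lemma invsqrt_prod_bound (I : eqType) (s : seq I) (f : I -> R -> R) :
  uniq s -> (forall i j, i \in s -> j \in s -> i != j -> jointly_bounded_below (f i) (f j)) ->
  exists2 C, 0 <= C & forall t,
    \prod_(i <- s) invsqrt (f i t) <= C * (1 + \sum_(i <- s) invsqrt (f i t)).
Proof.
elim: s => [_ _|i s ih /= /andP[nis us] sep].
  by exists 1 => // t; rewrite !big_nil addr0 mulr1.
have [//|C C0 HC] := ih us _.
  by move=> j k js ks; apply: sep; rewrite in_cons ?js ?ks orbT.
have [e [e0 He]] : exists e, 0 < e /\ forall t j, j \in s ->
    (e <= `|f i t|) || (e <= `|f j t|).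
  have sep' j : j \in s -> jointly_bounded_below (f i) (f j).
    move=> js; apply: sep; rewrite ?mem_head ?in_cons ?js ?orbT//.
    by apply: contraNneq nis => ->.
  elim: s sep' {ih nis us sep C C0 HC} => [_|k s ih sep]; first by exists 1.
  have [|e [e0 He]] := ih _.
    by move=> j js; apply: sep; rewrite in_cons js orbT.
  have [e' e'0 He'] := sep k (mem_head _ _).
  exists (Num.min e e'); split; first by rewrite lt_min e0.
  move=> t j; rewrite in_cons !ge_min => /predU1P[->|/(He t) /orP[->//|->]].
    by have /orP[->|->] := He' t; rewrite ?orbT.
  by rewrite ?orbT.
exists (C * (1 + invsqrt e * (1 + (size s)%:R))).
  by rewrite mulr_ge0// addr_ge0// mulr_ge0 ?invsqrt_ge0 ?addr_ge0.
move=> t; rewrite !big_cons.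
set u := invsqrt (f i t); set S := \sum_(j <- s) _.
have u0 : 0 <= u := invsqrt_ge0 _.
have S0 : 0 <= S by apply: sumr_ge0 => j _; exact: invsqrt_ge0.
have uS : u * S <= invsqrt e * ((size s)%:R * u + S).
  rewrite /S mulr_sumr; elim: s {ih nis us sep HC S S0} He => [_|k s ih He].
    by rewrite !big_nil mul0r addr0 mulr0.
  rewrite !big_cons [size _]/= -natr1; set v := invsqrt _; set V := \sum_(_ <- _) invsqrt _.
  have -> : invsqrt e * (((size s)%:R + 1) * u + (v + V)) =
            invsqrt e * (u + v) + invsqrt e * ((size s)%:R * u + V) by ring.
  apply: lerD; last by apply: ih => t' j js; apply: He; rewrite in_cons js orbT.
  have v0 : 0 <= v := invsqrt_ge0 _.
  have /orP[h|h] := He t k (mem_head _ _); rewrite mulrDr.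
    apply: ler_wpDl; first by rewrite mulr_ge0 ?invsqrt_ge0.
    by rewrite ler_wpM2r// invsqrt_le.
  apply: ler_wpDr; first by rewrite mulr_ge0 ?invsqrt_ge0.
  by rewrite mulrC ler_wpM2r// invsqrt_le.
have e1 : 0 <= invsqrt e := invsqrt_ge0 _.
apply: (@le_trans _ _ (u * (C * (1 + S)))); first by rewrite ler_wpM2l.
rewrite mulrCA -mulrA ler_wpM2l// mulrDr mulr1.
have n0 : 0 <= (size s)%:R :> R by [].
move: (_%:R) n0 uS => n n0 uS.
have h1 := mulr_ge0 e1 n0; have h2 := mulr_ge0 h1 S0; have h3 := mulr_ge0 h1 u0.
have h4 := mulr_ge0 e1 u0.
nra.
Qed.

Lemma invsqrt_prod_integrable (I : eqType) (s : seq I) (x y : I -> R) (p q : R) :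
  uniq s -> (forall i, i \in s -> (x i != 0) || (y i != 0)) ->
  (forall i j, i \in s -> j \in s -> i != j ->
     jointly_bounded_below (fun t => x i + t * y i) (fun t => x j + t * y j)) ->
  rintegrable `[p, q] (fun t => \prod_(i <- s) invsqrt (x i + t * y i)).
Proof.
move=> us nz sep; have [C C0 HC] := invsqrt_prod_bound us sep.
apply: (@rintegrable_le _ _ _ (fun t => C * (1 + \sum_(i <- s) invsqrt (x i + t * y i)))) => //.
- elim: s {us nz sep HC} => [|i s ih].
    rewrite (_ : (fun t : R => _) = (fun=> 1)); first exact: measurable_cst.
    by apply/funext => t; rewrite big_nil.
  rewrite (_ : (fun t : R => _) =
    (fun t => invsqrt (x i + t * y i)) \* (fun t => \prod_(j <- s) invsqrt (x j + t * y j))).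
    apply: measurable_funM => //.
    by apply: measurable_invsqrt; exact: measurable_affine.
  by apply/funext => t; rewrite big_cons.
- move=> t _; rewrite ger0_norm//.
  by elim: (s) => [|i s' ih]; rewrite ?big_nil ?big_cons// mulr_ge0 ?invsqrt_ge0.
apply: rintegrableZ => //; apply: rintegrableD => //; first exact: rintegrable_cst.
elim: s nz {us sep HC} => [_|i s ih nz].
  rewrite (_ : (fun t : R => _) = (fun=> 0)); first exact: rintegrable_cst.
  by apply/funext => t; rewrite big_nil.
rewrite (_ : (fun t : R => _) = (fun t =>
  invsqrt (x i + t * y i) + \sum_(j <- s) invsqrt (x j + t * y j))).
  apply: rintegrableD => //; first by apply: invsqrt_integrable; apply: nz; rewrite mem_head.
  by apply: ih => j js; apply: nz; rewrite in_cons js orbT.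
by apply/funext => t; rewrite big_cons.
Qed.

(** The combination x y' - x' y of the two functions is a nonzero constant. *)
Lemma jointly_bounded_below_affine x y x' y' : x * y' != x' * y ->
  jointly_bounded_below (fun t => x + t * y) (fun t => x' + t * y').
Proof.
move=> n0; pose D := `|y| + `|y'|; pose k := `|x * y' - x' * y|.
have k0 : 0 < k by rewrite normr_gt0 subr_eq0.
have D0 : 0 <= D by rewrite addr_ge0.
exists (k / (D + 1)); first by rewrite divr_gt0// ltr_wpDl.
move=> t; rewrite -implyNb -ltNge; apply/implyP => h; rewrite leNgt; apply/negP => h'.
have /negP[] : ~~ (k < k) by rewrite ltxx.
have D1 : 0 < D + 1 by rewrite ltr_wpDl.
rewrite ltr_pdivlMr// in h; rewrite ltr_pdivlMr// in h'.
have {1}-> : k = `|(x + t * y) * y' - (x' + t * y') * y|.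
  by rewrite /k; congr (`|_|); ring.
apply: (le_lt_trans (ler_normB _ _)); rewrite !normrM.
set u := `|_ + _| in h *; set v := `|_ + _| in h' *.
have u0 : 0 <= u := normr_ge0 _; have v0 : 0 <= v := normr_ge0 _.
have y0 : 0 <= `|y| := normr_ge0 _; have y'0 : 0 <= `|y'| := normr_ge0 _.
rewrite /D in h h' D0 D1 *; move: (`|y|) (`|y'|) y0 y'0 h h' D0 D1 => Y Y' *.
nra.
Qed.

Lemma ae_notin (s : seq R) : {ae leb, forall t, t \notin s}.
Proof.
exists [set` s]; split.
- apply: countable_measurable => //; apply: finite_set_countable; exact: finite_seq.
- by apply: countable_lebesgue_measure0; apply: finite_set_countable; exact: finite_seq.
- by move=> t /= /negP; rewrite negbK.
Qed.

End InverseSquareRoots.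

(** * Values of real polynomials *)

Section PolynomialValues.
Variable R : realType.
Implicit Types (k : {poly R}).

Definition pval k (z : R[i]) : R[i] := (map_poly (real_complex R) k).[z].

Lemma pval0 z : pval 0 z = 0.
Proof. by rewrite /pval rmorph0 horner0. Qed.

Lemma pval_ind k (x : R) z : pval (k * 'X + x%:P) z = pval k z * z + x%:C.
Proof. by rewrite /pval rmorphD rmorphM /= map_polyX map_polyC /= hornerMXaddC. Qed.

Lemma pval_real k (x : R) : pval k x%:C = (k.[x])%:C.
Proof. by rewrite /pval horner_map. Qed.

Lemma pval_bounded k (r : R) : exists2 M, 0 <= M & forall z, nm z <= r -> nm (pval k z) <= M.
Proof.
elim/poly_ind: k => [|k x [M M0 HM]].
  by exists 0 => // z _; rewrite pval0 nm0.
exists (M * `|r| + `|x|); first by rewrite addr_ge0// mulr_ge0.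
move=> z zr; rewrite pval_ind (le_trans (nmD _ _))// nm_real lerD2r nmM.
by apply: ler_pM; rewrite ?nm_ge0 ?HM// (le_trans zr)// ler_norm.
Qed.

Lemma cmeas_pval (D : set R) k f : cmeas D f -> cmeas D (fun t => pval k (f t)).
Proof.
move=> mf; elim/poly_ind: k => [|k x ih].
  by apply: (cmeas_ext (f:=fun=> 0)) => [t|]; [rewrite pval0|exact: cmeas_cst].
apply: (cmeas_ext (f:=fun t => pval k (f t) * f t + x%:C)).
  by move=> t; rewrite pval_ind.
by apply: cmeasD; [exact: cmeasM|exact: cmeas_cst].
Qed.

Lemma ccvg_pval {T : Type} {F : set_system T} {FF : Filter F} k (f : T -> R[i]) l :
  ccvg F f l -> ccvg F (fun t => pval k (f t)) (pval k l).
Proof.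
move=> fl; elim/poly_ind: k => [|k x ih].
  by rewrite pval0; apply: (ccvg_ext (f:=fun=> 0)) => [t|]; [rewrite pval0|exact: ccvg_cst].
rewrite pval_ind; apply: (ccvg_ext (f:=fun t => pval k (f t) * f t + x%:C)).
  by move=> t; rewrite pval_ind.
by apply: ccvgD; [exact: ccvgM|exact: ccvg_cst].
Qed.
End PolynomialValues.

(** * Interlacing sums *)

Section SequenceSums.
Variable R : realType.
Implicit Types (A B : nat -> R) (d : nat).

(** The endpoints are paired gap by gap, the two extreme ones remaining single. *)
Lemma sum_pairs A d : (1 <= d)%N ->
  \sum_(1 <= j < (2 * d).+1) A j =
  A 1%N + A (2 * d)%N + \sum_(1 <= m < d) (A (2 * m)%N + A (2 * m).+1).
Proof.
case: d => // d _; elim: d => [|d ih].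
  by rewrite muln1 big_nat_recr//= big_nat1 [X in _ = _ + X]big_geq// addr0.
have E : (2 * d.+2 = (2 * d.+1).+2)%N by rewrite mulnS.
rewrite [in RHS]big_nat_recr// E 2?[in LHS]big_nat_recr// ih/=; ring.
Qed.

Lemma sum_gaps_le A d : (1 <= d)%N ->
  (forall j, (1 <= j)%N -> (j < 2 * d)%N -> A j.+1 <= A j) ->
  \sum_(1 <= m < d) (A (2 * m)%N - A (2 * m).+1) <= A 1%N - A (2 * d)%N.
Proof.
case: d => // d _; elim: d => [|d ih] dA.
  by rewrite big_geq// subr_ge0; apply: dA.
rewrite big_nat_recr//=.
have E : (2 * d.+2 = (2 * d.+1).+2)%N by rewrite mulnS.
have h2 : \sum_(1 <= m < d.+1) (A (2 * m)%N - A (2 * m).+1) <= A 1%N - A (2 * d.+1)%N.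
  by apply: ih => j j1 jd; apply: dA => //; rewrite E ltnS ltnW// ltnS ltnW.
have h1 : A (2 * d.+1).+2 <= A (2 * d.+1).+1 by apply: dA => //; rewrite E.
rewrite E; lra.
Qed.

(** Each B m lies between the values of A at the two ends of its gap, so that the sums
telescope. With arguments in the place of A and B this bounds the argument of eta. *)
Lemma alternating_bounds A B d : (1 <= d)%N ->
  (forall j, (1 <= j)%N -> (j < 2 * d)%N -> A j.+1 <= A j) ->
  (forall m, (1 <= m)%N -> (m < d)%N -> A (2 * m).+1 <= B m <= A (2 * m)%N) ->
  - A 1%N <= \sum_(1 <= m < d) B m - (\sum_(1 <= j < (2 * d).+1) A j) / 2 <= - A (2 * d)%N.
Proof.
move=> d1 dA AB; have gl := sum_gaps_le d1 dA; rewrite sum_pairs//.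
have h1 : \sum_(1 <= m < d) B m <= \sum_(1 <= m < d) (A (2 * m)%N).
  by rewrite !big_nat; apply: ler_sum => m /andP[m1 md]; have /andP[] := AB m m1 md.
have h2 : \sum_(1 <= m < d) A (2 * m).+1 <= \sum_(1 <= m < d) B m.
  by rewrite !big_nat; apply: ler_sum => m /andP[m1 md]; have /andP[] := AB m m1 md.
rewrite sumrB in gl; rewrite big_split/=.
move: (\sum_(1 <= m < d) A (2 * m)%N) (\sum_(1 <= m < d) A (2 * m).+1) h1 h2 gl => s t *.
apply/andP; split; lra.
Qed.

(** A gap at whose ends and zero the arguments agree contributes nothing. *)
Lemma paired_sum A B d : (1 <= d)%N ->
  (forall m, (1 <= m)%N -> (m < d)%N -> A (2 * m).+1 = A (2 * m)%N /\ B m = A (2 * m)%N) ->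
  \sum_(1 <= m < d) B m - (\sum_(1 <= j < (2 * d).+1) A j) / 2 = - (A 1%N + A (2 * d)%N) / 2.
Proof.
move=> d1 AB; rewrite sum_pairs//.
have -> : \sum_(1 <= m < d) (A (2 * m)%N + A (2 * m).+1) = 2 * \sum_(1 <= m < d) B m.
  rewrite mulr_sumr !big_nat; apply: eq_bigr => m /andP[m1 md].
  by have [-> ->] := AB m m1 md; rewrite mulr_natl mulr2n.
by field.
Qed.

Lemma paired_sum_but1 A B d m0 : (1 <= m0)%N -> (m0 < d)%N ->
  (forall m, (1 <= m)%N -> (m < d)%N -> m != m0 ->
     A (2 * m).+1 = A (2 * m)%N /\ B m = A (2 * m)%N) ->
  \sum_(1 <= m < d) B m - (\sum_(1 <= j < (2 * d).+1) A j) / 2 =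
  - (A 1%N + A (2 * d)%N) / 2 + (B m0 - (A (2 * m0)%N + A (2 * m0).+1) / 2).
Proof.
move=> m1 md AB; rewrite sum_pairs; last exact: leq_trans md.
have m0i : m0 \in index_iota 1 d by rewrite mem_index_iota m1.
rewrite !(bigD1_seq m0) ?iota_uniq//=.
have -> : \sum_(i <- index_iota 1 d | i != m0) (A (2 * i)%N + A (2 * i).+1) =
          2 * \sum_(i <- index_iota 1 d | i != m0) B i.
  rewrite mulr_sumr [LHS]big_nat_cond [RHS]big_nat_cond.
  apply: eq_bigr => m /andP[/andP[hm1 hmd] hm].
  by have [-> ->] := AB m hm1 hmd hm; rewrite mulr_natl mulr2n.
by field.
Qed.
End SequenceSums.

(** * First-order expansions *)

Section ComplexFTC.
Variable R : realType.
Implicit Types (F f : R -> R[i]) (a b x t : R).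

(** A derivative with a quadratic error: the form in which differentiation under the
integral sign delivers it. *)
Definition has_expansion F x (l : R[i]) := exists C d, 0 < d /\
  forall t, `|t| < d -> nm (F (x + t) - F x - t%:C * l) <= C * t ^+ 2.

Lemma expansion_Re F x l : has_expansion F x l -> is_derive x 1 (Re \o F) (Re l).
Proof.
move=> [C [d [d0 H]]]; apply: (@quad_derive _ _ _ _ C d d0) => t /H.
by apply: le_trans; rewrite (le_trans _ (Re_nm _))// !(cReD, cReN) cReZ.
Qed.

Lemma expansion_Im F x l : has_expansion F x l -> is_derive x 1 (Im \o F) (Im l).
Proof.
move=> [C [d [d0 H]]]; apply: (@quad_derive _ _ _ _ C d d0) => t /H.
by apply: le_trans; rewrite (le_trans _ (Im_nm _))// !(cImD, cImN) cImZ.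
Qed.

Lemma expansionZ w F x l : has_expansion F x l -> has_expansion (fun t => w * F t) x (w * l).
Proof.
move=> [C [d [d0 H]]]; exists (nm w * C), d; split => // t /H h.
have -> : w * F (x + t) - w * F x - t%:C * (w * l) = w * (F (x + t) - F x - t%:C * l).
  by ring.
by rewrite nmM -mulrA ler_wpM2l// nm_ge0.
Qed.

Lemma cont_itv_cc (g : R -> R) a b : a < b ->
  (forall x, a < x < b -> {for x, continuous g}) ->
  g @ a^'+ --> g a -> g @ b^'- --> g b -> {within `[a, b], continuous g}.
Proof.
move=> ab cg ga gb; apply/continuous_within_itvP => //; split => //.
Qed.

Lemma complex_FTC F f a b : a < b -> cintegrable `[a, b] f ->
  (forall x, a < x < b -> ccvg (nbhs x) f (f x)) ->
  (forall x, a < x < b -> has_expansion F x (f x)) ->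
  ccvg (a^'+) F (F a) -> ccvg (b^'-) F (F b) ->
  Cint f a b = F b - F a.
Proof.
move=> ab [f1 f2] cf dF [Fa1 Fa2] [Fb1 Fb2].
apply: complexP; rewrite ?(cReD, cReN, cImD, cImN) /=.
  apply: (@improper_FTC R (Re \o f) (Re \o F)) => //.
  - by move=> x /cf [].
  - by move=> x /dF/expansion_Re.
  - by apply: cont_itv_cc => // x /dF/expansion_Re/is_derive_cont.
apply: (@improper_FTC R (Im \o f) (Im \o F)) => //.
- by move=> x /cf [].
- by move=> x /dF/expansion_Im.
- by apply: cont_itv_cc => // x /dF/expansion_Im/is_derive_cont.
Qed.

Lemma expansion_ccvg F x l : has_expansion F x l -> ccvg (nbhs x) F (F x).
Proof.
move=> h; split; first exact: (is_derive_cont (expansion_Re h)).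
exact: (is_derive_cont (expansion_Im h)).
Qed.

Lemma ccvg_nm0 {T : Type} {G : set_system T} {FG : Filter G} (f : T -> R[i]) (g : T -> R) :
  (\forall s \near G, nm (f s) <= g s) -> g @ G --> (0 : R) -> ccvg G f 0.
Proof.
move=> fg g0; split; apply/cvgr0Pnorm_le => e e0 /=; move/cvgr0Pnorm_le : g0 => /(_ e e0) h.
  near=> s; rewrite (le_trans (Re_nm _))//.
  apply: (@le_trans _ _ (g s)); first by near: s.
  by apply: le_trans (ler_norm _) _; near: s.
near=> s; rewrite (le_trans (Im_nm _))//.
apply: (@le_trans _ _ (g s)); first by near: s.
by apply: le_trans (ler_norm _) _; near: s.
Unshelve. all: by end_near. Qed.

End ComplexFTC.

Section QuadraticApproximation.
Variable R : realType.
Implicit Types (f g : R -> R[i] -> R[i]) (s t : R) (h w : R[i]).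

(** A first-order expansion in h that is uniform in the parameter s of a path of integration,
with terms continuous in s: what differentiation under the integral sign requires. *)
Definition uniform_expansion f (f1 : R -> R[i]) :=
  [/\ exists M e, [/\ 0 <= M, 0 < e, e <= 1 & forall s h, 0 < s <= 1 -> nm h <= e ->
        [/\ nm (f s 0) <= M, nm (f1 s) <= M & nm (f s h - f s 0 - h * f1 s) <= M * nm h ^+ 2]],
      forall s, 0 < s -> ccvg (nbhs s) (f^~ 0) (f s 0)
    & forall s, 0 < s -> ccvg (nbhs s) f1 (f1 s)].

Definition uniformly_expandable f := exists f1 : R -> R[i], uniform_expansion f f1.

Lemma expandable_affine (w : R -> R[i]) (r : R -> R) (M : R) :
  (forall s, 0 < s <= 1 -> nm (w s) <= M) -> (forall s, 0 < s <= 1 -> 0 <= r s <= 1) ->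
  (forall s, 0 < s -> ccvg (nbhs s) w (w s)) -> (forall s, 0 < s -> {for s, continuous r}) ->
  uniformly_expandable (fun s h => w s + (r s)%:C * h).
Proof.
move=> wM r1 cw cr; exists (fun s => (r s)%:C); split.
- exists (`|M| + 1), 1; split => //.
  move=> s h s01 _; rewrite mulr0 addr0; split.
  + by rewrite (le_trans (wM _ s01))// (le_trans (ler_norm M))// lerDl.
  + have /andP[r0 r1'] := r1 s s01.
    by rewrite nm_real ger0_norm// (le_trans r1')// lerDr.
  + have -> : w s + (r s)%:C * h - w s - h * (r s)%:C = 0 by ring.
    by rewrite nm0 mulr_ge0 ?sqr_ge0 ?addr_ge0.
- move=> s s0; apply: ccvg_ext (ccvgD (cw s s0) (ccvg_cst (F:=nbhs s) ((r s)%:C * 0))) => t.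
  by rewrite !mulr0.
- by move=> s s0; apply: ccvg_real; exact: cr.
Qed.

Lemma expandableM f g : uniformly_expandable f -> uniformly_expandable g ->
  uniformly_expandable (fun s h => f s h * g s h).
Proof.
move=> [f1 [[M [e [M0 e0 e1 Hf]]] cf cf1]] [g1 [[N [r [N0 r0 r1 Hg]]] cg cg1]].
exists (fun s => f1 s * g s 0 + f s 0 * g1 s); split.
(* The three error terms cost 3, 2 and 1 times M N |h|^2. *)
- exists (6 * (M * N)), (Num.min e r); split.
  + by rewrite !mulr_ge0.
  + by rewrite lt_min e0.
  + by rewrite ge_min e1.
  move=> s h s01; rewrite le_min => /andP[he hr].
  have [f0M f1M fhM] := Hf s h s01 he; have [g0N g1N ghN] := Hg s h s01 hr.
  have h1 : nm h <= 1 by exact: le_trans e1.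
  have h0 := nm_ge0 h; have h2 : nm h ^+ 2 <= 1 by rewrite expr_le1.
  have MN : 0 <= M * N by rewrite mulr_ge0.
  set E := _ - _ - _ in fhM; set E' := _ - _ - _ in ghN.
  split.
  + rewrite nmM (le_trans (ler_pM (nm_ge0 _) (nm_ge0 _) f0M g0N))//; lra.
  + rewrite (le_trans (nmD _ _))// !nmM.
    have := ler_pM (nm_ge0 _) (nm_ge0 _) f1M g0N; have := ler_pM (nm_ge0 _) (nm_ge0 _) f0M g1N.
    lra.
  have -> : f s h * g s h - f s 0 * g s 0 - h * (f1 s * g s 0 + f s 0 * g1 s) =
      E * (g s 0 + h * g1 s + E') + (f s 0 + h * f1 s) * E' + h ^+ 2 * (f1 s * g1 s).
    by rewrite /E /E'; ring.
  rewrite (le_trans (nmD _ _))//.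
  have b1 : nm (h ^+ 2 * (f1 s * g1 s)) <= (M * N) * nm h ^+ 2.
    by rewrite nmM nmX nmM mulrC ler_wpM2r ?sqr_ge0// ler_pM ?nm_ge0.
  have hf1 : nm (h * f1 s) <= M.
    by rewrite nmM -[leRHS]mul1r ler_pM ?nm_ge0.
  have hg1 : nm (h * g1 s) <= N.
    by rewrite nmM -[leRHS]mul1r ler_pM ?nm_ge0.
  have b2 : nm ((f s 0 + h * f1 s) * E') <= 2 * (M * N) * nm h ^+ 2.
    rewrite nmM mulrA -mulrA ler_pM ?nm_ge0// (le_trans (nmD _ _))//; lra.
  have E'N : nm E' <= N.
    by rewrite (le_trans ghN)// -[leRHS]mulr1 ler_wpM2l.
  have b3 : nm (E * (g s 0 + h * g1 s + E')) <= 3 * (M * N) * nm h ^+ 2.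
    rewrite nmM; have -> : 3 * (M * N) * nm h ^+ 2 = (M * nm h ^+ 2) * (3 * N) by ring.
    rewrite ler_pM ?nm_ge0// (le_trans (nmD _ _))//.
    have := nmD (g s 0) (h * g1 s); lra.
  have := nmD (E * (g s 0 + h * g1 s + E')) ((f s 0 + h * f1 s) * E').
  move: (nm h ^+ 2) b1 b2 b3 => H *; lra.
- by move=> s s0; apply: ccvgM; [exact: cf|exact: cg].
- move=> s s0; apply: ccvgD; apply: ccvgM;
    [exact: cf1|exact: cg|exact: cf|exact: cg1].
Qed.

Lemma expandable_cst (w : R[i]) : uniformly_expandable (fun _ _ => w).
Proof.
have := @expandable_affine (fun=> w) (fun=> 0) (nm w).
case=> // [s _|s _|s _|f1 H]; first by rewrite lexx ler01.
- exact: ccvg_cst.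
- exact: cvg_cst.
exists f1; rewrite (_ : (fun _ _ => w) = (fun _ h => w + 0%:C * h))//.
by apply/funext => s; apply/funext => h; rewrite mul0r addr0.
Qed.

Lemma expandable_prod (I : eqType) (r : seq I) (f : I -> R -> R[i] -> R[i]) :
  (forall i, i \in r -> uniformly_expandable (f i)) ->
  uniformly_expandable (fun s h => \prod_(i <- r) f i s h).
Proof.
elim: r => [_|i r ih H].
  rewrite (_ : (fun s h => _) = (fun _ _ => 1)); first exact: expandable_cst.
  by apply/funext => s; apply/funext => h; rewrite big_nil.
rewrite (_ : (fun s h => _) = (fun s h => f i s h * \prod_(j <- r) f j s h)).
  apply: expandableM; first by apply: H; rewrite mem_head.
  by apply: ih => j jr; apply: H; rewrite in_cons jr orbT.
by apply/funext => s; apply/funext => h; rewrite big_cons.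
Qed.

(** The remainder of the expansion of 1 / r around p as functions of the squares. Its
denominator contains only r, p and r + p, none of which is small in the quadrant. *)
Lemma isqrt_expansion (p r : R[i]) : p != 0 -> r != 0 -> r + p != 0 ->
  r^-1 - p^-1 - (r ^+ 2 - p ^+ 2) * - (2 * p ^+ 3)^-1 =
  (r ^+ 2 - p ^+ 2) ^+ 2 * ((2 * p + r) / (2 * r * p ^+ 3 * (r + p) ^+ 2)).
Proof.
move=> p0 r0 rp; field.
by rewrite p0 r0 rp.
Qed.

Lemma nm_two : nm (2 : R[i]) = 2.
Proof.
have -> : (2 : R[i]) = (2 : R)%:C by rewrite rmorph_nat.
by rewrite nm_real ger0_norm.
Qed.

Lemma isqrt_remainder (p r : R[i]) (m : R) : 0 < m -> quadrant p -> quadrant r ->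
  m <= nm p -> m <= nm r ->
  nm ((2 * p + r) / (2 * r * p ^+ 3 * (r + p) ^+ 2)) <= (m ^+ 5)^-1.
Proof.
move=> m0 qp qr mp mr; have prp := quadrant_addr qp qr.
rewrite nmM nmV !(nmX, nmM) nm_two.
have num : nm (2 * p + r) <= 2 * nm (r + p).
  have -> : 2 * p + r = p + (r + p) by ring.
  rewrite (le_trans (nmD _ _))//; lra.
set y := nm (r + p) in prp num *; set u := nm p in mp prp *; set v := nm r in mr *.
have u0 : 0 < u := lt_le_trans m0 mp; have v0 : 0 < v := lt_le_trans m0 mr.
have y0 : 0 < y := lt_le_trans u0 prp.
rewrite ler_pdivrMr; last by rewrite !mulr_gt0// exprn_gt0.
rewrite (le_trans num)// [leRHS]mulrC ler_pdivlMr ?exprn_gt0//.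
have -> : 2 * v * u ^+ 3 * y ^+ 2 = 2 * y * (v * u ^+ 3 * y) by ring.
rewrite ler_wpM2l ?mulr_ge0 ?(ltW y0)//.
have -> : m ^+ 5 = m * m ^+ 3 * m by ring.
apply: ler_pM; rewrite ?mulr_ge0 ?exprn_ge0 ?(ltW m0)//; last exact: le_trans prp.
apply: ler_pM; rewrite ?exprn_ge0 ?(ltW m0)//.
by rewrite lerXn2r ?nnegrE ?(ltW m0) ?(ltW u0).
Qed.

(** A lower bound for the modulus controls the remainder, because the values of sqrtc stay
in the quadrant. *)
Lemma expandable_isqrt (w : R -> R[i]) (r : R -> R) (m e : R) : 0 < m -> 0 < e -> e <= 1 ->
  (forall s h, 0 < s <= 1 -> nm h <= e ->
     0 <= Im (w s + (r s)%:C * h) /\ m ^+ 2 <= nm (w s + (r s)%:C * h)) ->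
  (forall s, 0 < s <= 1 -> 0 <= r s <= 1) ->
  (forall s, 0 < s -> 0 <= Im (w s) /\ w s != 0) ->
  (forall s, 0 < s -> ccvg (nbhs s) w (w s)) -> (forall s, 0 < s -> {for s, continuous r}) ->
  uniformly_expandable (fun s h => (sqrtc (w s + (r s)%:C * h))^-1).
Proof.
move=> m0 e0 e1 wm r1 w0 cw cr.
have csq s : 0 < s -> ccvg (nbhs s) (fun t => sqrtc (w t)) (sqrtc (w s)).
  move=> s0; apply: ccvg_sqrtc; [exact: (w0 s s0).1| |exact: cw].
  near=> t; apply: (w0 t _).1; near: t; exact: lt_nbhsr.
exists (fun s => (r s)%:C * - (2 * sqrtc (w s) ^+ 3)^-1); split.
- exists (m^-1 + (2 * m ^+ 3)^-1 + (m ^+ 5)^-1), e; split => //.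
    by rewrite !addr_ge0 ?invr_ge0 ?mulr_ge0 ?exprn_ge0// ltW.
  move=> s h s01 he.
  have [iw0 mw0] : 0 <= Im (w s) /\ m ^+ 2 <= nm (w s).
    by have := wm s 0 s01; rewrite nm0 mulr0 addr0; apply; exact: ltW.
  have [iwh mwh] := wm s h s01 he.
  have /andP[r0 r1'] := r1 s s01.
  have mle z : m ^+ 2 <= nm z -> m <= nm (sqrtc z).
    move=> mz; rewrite nm_sqrtc -(ger0_norm (ltW m0)) -sqrtr_sqr.
    by rewrite ler_wsqrtr.
  rewrite mulr0 addr0; set p := sqrtc (w s); set q := sqrtc (w s + _).
  have mp : m <= nm p by exact: mle.
  have mq : m <= nm q by exact: mle.
  have p0 : 0 < nm p := lt_le_trans m0 mp.
  have q0 : 0 < nm q := lt_le_trans m0 mq.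
  have i1 : 0 <= m^-1 by rewrite invr_ge0 ltW.
  have i2 : 0 <= (2 * m ^+ 3)^-1 by rewrite invr_ge0 mulr_ge0 ?exprn_ge0// ltW.
  have i3 : 0 <= (m ^+ 5)^-1 by rewrite invr_ge0 exprn_ge0// ltW.
  split.
  + rewrite nmV; have : (nm p)^-1 <= m^-1 by rewrite lef_pV2 ?posrE.
    lra.
  + rewrite nmM nm_real ger0_norm// nmN nmV !(nmX, nmM) nm_two.
    have : (2 * nm p ^+ 3)^-1 <= (2 * m ^+ 3)^-1.
      rewrite lef_pV2 ?posrE ?mulr_gt0 ?exprn_gt0// ler_pM2l//.
      by rewrite lerXn2r ?nnegrE ?(ltW m0) ?(ltW p0).
    have : r s * (2 * nm p ^+ 3)^-1 <= (2 * nm p ^+ 3)^-1.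
      by rewrite ler_piMl// invr_ge0 mulr_ge0// exprn_ge0// ltW.
    lra.
  have qp : quadrant p by exact: quadrant_sqrtc.
  have qq : quadrant q by exact: quadrant_sqrtc.
  have pn0 : p != 0 by rewrite -nm_gt0.
  have qn0 : q != 0 by rewrite -nm_gt0.
  have pq0 : q + p != 0 by rewrite -nm_gt0 (lt_le_trans p0)// quadrant_addr.
  have dE : q ^+ 2 - p ^+ 2 = (r s)%:C * h by rewrite !sqr_sqrtc addrC addKr.
  have -> : q^-1 - p^-1 - h * ((r s)%:C * - (2 * p ^+ 3)^-1) =
      q^-1 - p^-1 - (q ^+ 2 - p ^+ 2) * - (2 * p ^+ 3)^-1.
    by rewrite dE; congr (_ - _); rewrite mulrCA mulrA.
  rewrite isqrt_expansion// dE nmM nmX nmM nm_real ger0_norm// exprMn.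
  have X := isqrt_remainder m0 qp qq mp mq.
  set Y := nm _ in X *; have Y0 : 0 <= Y := nm_ge0 _.
  have h0 : 0 <= nm h ^+ 2 by exact: sqr_ge0.
  have r2 : r s ^+ 2 <= 1 by rewrite expr_le1.
  rewrite mulrAC ler_wpM2r//; apply: (@le_trans _ _ Y); last lra.
  by rewrite ler_piMl.
- move=> s s0; rewrite mulr0 addr0; apply: (ccvg_ext (f:=fun t => (sqrtc (w t))^-1)).
    by move=> t; rewrite mulr0 addr0.
  apply: ccvgV; last exact: csq.
  by apply: sqrtc_neq0; exact: (w0 s s0).2.
- move=> s s0; apply: ccvgM; first by apply: ccvg_real; exact: cr.
  have E (z : R[i]) : - z = (-1) * z by rewrite mulN1r.
  rewrite E; apply: (ccvg_ext (f:=fun t => (-1) * (2 * sqrtc (w t) ^+ 3)^-1)).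
    by move=> t; rewrite mulN1r.
  apply: ccvgM; first exact: ccvg_cst.
  have p0 : sqrtc (w s) != 0 by apply: sqrtc_neq0; exact: (w0 s s0).2.
  apply: ccvgV; first by rewrite mulf_neq0 ?pnatr_eq0// expf_neq0.
  apply: ccvgM; first exact: ccvg_cst.
  rewrite 2!exprS expr1.
  apply: (ccvg_ext (f:=fun t => sqrtc (w t) * (sqrtc (w t) * sqrtc (w t)))) => //.
  by apply: ccvgM; [exact: csq|apply: ccvgM; exact: csq].
Unshelve. all: by end_near. Qed.

End QuadraticApproximation.

(** * Estimates in real variables *)

Lemma eq_expansion (R : realType) (F G : R -> R[i]) (x : R) (l : R[i]) :
  F =1 G -> has_expansion F x l -> has_expansion G x l.
Proof. by move=> /funext ->. Qed.

Lemma three_term_estimate (R : realType) (g1 g2 A b n : R) :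
  `|g1 + A - (g2 + - A)| <= n -> `|g1 - - b| <= n -> `|g2 - 0| <= n -> `|2 * A - b| <= 3 * n.
Proof.
rewrite !ler_norml => /andP[x1 x2] /andP[x3 x4] /andP[x5 x6].
by apply/andP; split; lra.
Qed.

Lemma near_value (R : realType) (p g1 g0 b e : R) : 0 < p ->
  `|g1 - g0| <= e * p -> - (g0 / p) = b -> b - e <= - (g1 / p) /\ - (g1 / p) <= b + e.
Proof.
move=> p0 + <-; rewrite ler_norml => /andP[h1 h2].
have E : g1 / p - g0 / p = (g1 - g0) / p by rewrite mulrBl.
have : (g1 - g0) / p <= e by rewrite ler_pdivrMr.
have : - e <= (g1 - g0) / p by rewrite ler_pdivlMr// mulNr.
by rewrite -E; move: (g1 / p) (g0 / p) => u v *; split; lra.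
Qed.

Lemma same_height_lt (R : realType) (x p y u1 u2 v1 v2 : R) : x < p ->
  0 < (p - x) * (u2 - u1) + (y - y) * (v2 - v1) -> u1 < u2.
Proof. by move=> xp; rewrite subrr mul0r addr0 pmulr_rgt0 subr_gt0. Qed.

Lemma reach (R : realType) (f : R -> R) (p s q : R) : p <= s ->
  {within `[p, s], continuous f} -> f p <= q -> q <= f s ->
  exists2 x, p <= x <= s & f x = q.
Proof.
move=> ps cf fp fs; have [|x] := IVT ps cf (v := q).
  by rewrite (min_idPl (le_trans fp fs)) (max_idPr (le_trans fp fs)) fp.
by rewrite in_itv/=; exists x.
Qed.

Lemma scaled_bound (R : realType) (g1 g2 m s p : R) : 0 < s ->
  `|g2 - g1| <= m * p -> `|g2 / s - g1 / s| <= m / s * p.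
Proof.
move=> s0 h; rewrite -mulrBl normrM [`|s^-1|]gtr0_norm ?invr_gt0// mulrAC.
by apply: ler_wpM2r => //; rewrite invr_ge0 ltW.
Qed.

Lemma near_right0 (R : realType) (P : R -> Prop) : (\forall y \near (0 : R)^'+, P y) ->
  exists2 r, 0 < r & forall y, 0 < y < r -> P y.
Proof.
move=> [r /= r0 H]; exists r => // y /andP[y0 yr]; apply: H => //=.
by rewrite sub0r normrN gtr0_norm.
Qed.

(** By the mean value theorem g decreases, so it lies below its values closer to 0. *)
Lemma below_limit (R : realType) (g dg : R -> R) (l e : R) :
  (forall y : R, 0 < y -> is_derive y 1 g (dg y)) -> (forall y : R, 0 < y < e -> dg y < 0) ->
  g @ 0^'+ --> l -> forall y, 0 < y < e -> g y < l.
Proof.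
move=> D N gl y /andP[y0 ye].
have dec s t : 0 < s -> s < t -> t < e -> g t < g s.
  move=> s0 st te.
  have [|u /andP[su ut] E] := @mean_value R g dg s t st.
    by move=> u /andP[su _]; apply: D; exact: lt_le_trans su.
  have : dg u < 0 by apply: N; rewrite (lt_trans s0 su) (lt_trans ut te).
  move=> du; rewrite -subr_lt0 E nmulr_rlt0// subr_gt0//.
have y2 : 0 < y / 2 by rewrite divr_gt0.
have yy : y / 2 < y by lra.
apply: (lt_le_trans (dec _ _ y2 yy ye)); apply: (cvg_ge gl).
near=> t; apply/ltW/dec; last exact: lt_trans yy ye.
  by near: t; exact: nbhs_right_gt.
by near: t; exact: nbhs_right_lt.
Unshelve. all: by end_near. Qed.

Lemma above_limit (R : realType) (g dg : R -> R) (l e : R) :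
  (forall y : R, 0 < y -> is_derive y 1 g (dg y)) -> (forall y : R, 0 < y < e -> 0 < dg y) ->
  g @ 0^'+ --> l -> forall y, 0 < y < e -> l < g y.
Proof.
move=> D P gl y ye; rewrite -ltrN2.
apply: (@below_limit R (fun t => - g t) (fun t => - dg t) (- l) e) => //.
- by move=> t t0; have ? := D t t0; exact: is_deriveN.
- by move=> t te; rewrite oppr_lt0 P.
- exact: cvgN.
Qed.

Lemma cvg_right0 (R : realType) (g : R -> R) (l e : R) : g @ 0^'+ --> l -> 0 < e ->
  exists2 r, 0 < r & forall y, 0 < y < r -> `|g y - l| < e.
Proof.
move=> /cvgrPdist_lt H e0; have [r r0 Hr] := near_right0 (H e e0).
by exists r => // y yr; rewrite distrC; exact: Hr.
Qed.

Lemma near_lt (R : realType) (g l m : R) : `|g - l| < m - l -> g < m.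
Proof. by move=> h; have := le_lt_trans (ler_norm _) h; rewrite ltrD2r. Qed.

Lemma near_gt (R : realType) (g l m : R) : `|g - l| < l - m -> m < g.
Proof. by rewrite distrC => h; have := le_lt_trans (ler_norm _) h; rewrite ltrD2l ltrN2. Qed.

(** Re (w e) differs from w / (t w) = 1 / t by at most half of it. *)
Lemma radial_bound (R : realType) (w e : R[i]) (t : R) : nm w = 1 -> 0 < t ->
  nm (e - (t%:C * w)^-1) <= 2^-1 / t -> 0 <= Re (w * e) - 2^-1 * t^-1.
Proof.
move=> nw t0 h.
have w0 : w != 0 by rewrite -nm_eq0 nw oner_eq0.
have tC : t%:C != 0 :> R[i] by apply/eqP => /complexI tt; move: t0; rewrite tt ltxx.
have E : w * e = (t^-1)%:C + w * (e - (t%:C * w)^-1).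
  by rewrite fmorphV mulrBr invfM mulrCA divff// mulr1 addrC subrK.
have b : - (2^-1 / t) <= Re (w * (e - (t%:C * w)^-1)).
  rewrite lerNl; apply: (le_trans (ler_norm _)); rewrite normrN.
  by apply: (le_trans (Re_nm _)); rewrite nmM nw mul1r.
rewrite E cReD /=; move: b; lra.
Qed.

(** * Level curves of a monotone map *)

Section LevelCurve.
(** Here u + i v is a map of the upper half-plane with values given in coordinates. By
monotonicity u increases along horizontal lines, so that the level set u = q is the graph
of a function of y. The hypotheses on b say that this curve ends at b: just above the real
line u is below q to the left of b and above q to its right, and v has the limit top. *)
Variables (R : realType) (u v : R -> R -> R) (q b top : R).
Implicit Types (x y e : R).

Hypothesis mono : forall x y x' y', 0 < y -> 0 < y' -> (x != x') || (y != y') ->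
  0 < (x' - x) * (u x' y' - u x y) + (y' - y) * (v x' y' - v x y).
Hypothesis cont : forall x y e, 0 < y -> 0 < e -> exists2 r, 0 < r & forall x' y',
  `|x' - x| < r -> `|y' - y| < r -> `|u x' y' - u x y| < e /\ `|v x' y' - v x y| < e.
Hypothesis level : forall y, 0 < y -> exists x, u x y = q.
Hypothesis left_b : exists2 r, 0 < r & forall x, b - r < x < b ->
  exists2 e, 0 < e & forall y, 0 < y < e -> u x y < q.
Hypothesis right_b : exists2 r, 0 < r & forall x, b < x < b + r ->
  exists2 e, 0 < e & forall y, 0 < y < e -> q < u x y.
Hypothesis slope_b : exists B r, [/\ 0 <= B, 0 < r & forall x y,
  `|x - b| < r -> 0 < y < r -> `|v x y - v b y| <= B * `|x - b|].
Hypothesis lim_u : forall e, 0 < e -> exists2 r, 0 < r & forall y, 0 < y < r ->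
  `|u b y - q| < e.
Hypothesis lim_v : forall e, 0 < e -> exists2 r, 0 < r & forall y, 0 < y < r ->
  `|v b y - top| < e.

(** A point of the curve below the level top, and a point low above b, would contradict
monotonicity: the horizontal term is small there and the vertical term is negative. *)
Lemma level_ge x y : 0 < y -> u x y = q -> top <= v x y.
Proof.
move=> y0 uq; rewrite leNgt; apply/negP => vt.
pose e := top - v x y; have e0 : 0 < e by rewrite subr_gt0.
pose D := `|x - b| + 1; have D0 : 0 < D by rewrite ltr_wpDl.
(* With this bound the horizontal term is at most y e / 8, whereas the vertical one will be
   at most - y e / 4. *)
have f0 : 0 < y * e / (8 * D) by rewrite divr_gt0 ?mulr_gt0.
have [r1 r10 H1] := lim_u f0.
have e2 : 0 < e / 2 by rewrite divr_gt0.
have [r2 r20 H2] := lim_v e2.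
pose y' := Num.min (y / 2) (Num.min (r1 / 2) (r2 / 2)).
have y'0 : 0 < y' by rewrite !lt_min !divr_gt0.
have y'1 : y' <= y / 2 by rewrite ge_min lexx.
have y'2 : y' < r1.
  by apply: (@le_lt_trans _ _ (r1 / 2)); [rewrite !ge_min lexx !orbT|lra].
have y'3 : y' < r2.
  by apply: (@le_lt_trans _ _ (r2 / 2)); [rewrite !ge_min lexx !orbT|lra].
have h1 : `|u b y' - q| < y * e / (8 * D) by apply: H1; rewrite y'0.
have h2 : `|v b y' - top| < e / 2 by apply: H2; rewrite y'0.
have yn : y' != y by rewrite lt_eqF//; lra.
have := @mono b y' x y y'0 y0; rewrite yn orbT uq => /(_ isT).
apply/negP; rewrite -leNgt.
have a1 : (x - b) * (q - u b y') <= D * (y * e / (8 * D)).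
  rewrite (le_trans (ler_norm _))// normrM distrC ler_pM//; last by rewrite distrC ltW.
  by rewrite distrC /D lerDl.
have a2 : D * (y * e / (8 * D)) = y * e / 8 by field; rewrite gt_eqF.
have a3 : v x y - v b y' <= - (e / 2).
  move: h2; rewrite ltr_norml => /andP[h2 _]; rewrite /e in h2 *; lra.
have a4 : (y - y') * (v x y - v b y') <= (y / 2) * (- (e / 2)).
  have b1 : (y - y') * (v x y - v b y') <= (y - y') * - (e / 2).
    by rewrite ler_wpM2l//; lra.
  have b2 : (y - y') * - (e / 2) <= (y / 2) * - (e / 2).
    by rewrite ler_nM2r; lra.
  exact: le_trans b2.
have := mulr_gt0 y0 e0; lra.
Qed.

(** Along the curve v increases strictly with y, so a lower point of it gives strictness. *)
Lemma level_gt x y : 0 < y -> u x y = q -> top < v x y.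
Proof.
move=> y0 uq; have y2 : 0 < y / 2 by rewrite divr_gt0.
have [x' uq'] := level y2; apply: le_lt_trans (level_ge y2 uq') _.
have yn : y / 2 != y by rewrite lt_eqF//; lra.
have := @mono x' (y / 2) x y y2 y0; rewrite yn orbT uq uq' subrr mulr0 add0r => /(_ isT).
by rewrite pmulr_rgt0 ?subr_gt0//; lra.
Qed.

Lemma mono_x x x' y : 0 < y -> x < x' -> u x y < u x' y.
Proof.
move=> y0 xx; have := @mono x y x' y y0 y0; rewrite lt_eqF// => /(_ isT).
by rewrite subrr mul0r addr0 pmulr_rgt0 subr_gt0.
Qed.

Hypothesis grow : forall A, exists M, forall x y, 0 < y -> M < y -> A < v x y.

(** The level curve is the graph of a continuous function of y. Close to the real line it is
trapped near b, where v is close to top, and v is large far up; the intermediate value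
theorem applies to v along the curve. *)
Lemma level_onto t : top < t -> exists x y, [/\ 0 < y, u x y = q & v x y = t].
Proof.
move=> tt.
have /choice[X XE] : forall y, exists x, 0 < y -> u x y = q.
  by move=> y; have [y0|_] := ltP 0 y; [have [x ?] := level y0; exists x|exists 0].
have trap x y : 0 < y -> u x y < q -> x < X y.
  move=> y0 ux; rewrite ltNge; apply/negP; rewrite le_eqVlt => /predU1P[E|h].
    by move: ux; rewrite -E XE ?ltxx.
  by have := lt_trans (mono_x y0 h) ux; rewrite XE ?ltxx.
have trap' x y : 0 < y -> q < u x y -> X y < x.
  move=> y0 ux; rewrite ltNge; apply/negP; rewrite le_eqVlt => /predU1P[E|h].
    by move: ux; rewrite E XE ?ltxx.
  by have := lt_trans ux (mono_x y0 h); rewrite XE ?ltxx.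
have Xc y0 e : 0 < y0 -> 0 < e -> exists2 r, 0 < r & forall y, `|y - y0| < r ->
    `|X y - X y0| < e.
  move=> y00 e0.
  have ul : u (X y0 - e) y0 < q by rewrite -(XE y0 y00); apply: mono_x => //; lra.
  have ur : q < u (X y0 + e) y0 by rewrite -(XE y0 y00); apply: mono_x => //; lra.
  have dl : 0 < q - u (X y0 - e) y0 by rewrite subr_gt0.
  have dr : 0 < u (X y0 + e) y0 - q by rewrite subr_gt0.
  have [r1 r10 H1] := cont (X y0 - e) y00 dl.
  have [r2 r20 H2] := cont (X y0 + e) y00 dr.
  exists (Num.min y0 (Num.min r1 r2)); first by rewrite !lt_min y00 r10.
  move=> y; rewrite !lt_min => /and3P[h0 h1 h2].
  have yp : 0 < y by move: h0; rewrite ltr_norml => /andP[]; lra.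
  have [] := H1 (X y0 - e) y; rewrite ?subrr ?normr0// ltr_norml => /andP[_ k1] _.
  have [] := H2 (X y0 + e) y; rewrite ?subrr ?normr0// ltr_norml => /andP[k2 _] _.
  have m1 : X y0 - e < X y by apply: trap => //; lra.
  have m2 : X y < X y0 + e by apply: trap' => //; lra.
  by rewrite ltr_norml; apply/andP; split; lra.
pose V y := v (X y) y.
have Vc y0 : 0 < y0 -> {for y0, continuous V}.
  move=> y00; apply/cvgrPdist_lt => e e0.
  have [r r0 H] := cont (X y0) y00 e0; have [r' r'0 H'] := Xc y0 r y00 r0.
  exists (Num.min r r'); first by rewrite /= lt_min r0.
  move=> y /=; rewrite lt_min distrC => /andP[h1 h2].
  by rewrite distrC; apply: (H _ _ (H' _ h2) h1).2.
have [y1 y10 Vy1] : exists2 y, 0 < y & V y < t.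
  pose e := t - top; have e0 : 0 < e by rewrite subr_gt0.
  have e2 : 0 < e / 2 by rewrite divr_gt0.
  have [rl rl0 Hl] := left_b; have [rr rr0 Hr] := right_b.
  have [B [rs [B0 rs0 Hs]]] := slope_b; have [rv rv0 Hv] := lim_v e2.
  have B1 : 0 < B + 1 by rewrite ltr_wpDl.
  pose r := Num.min (Num.min (rl / 2) (rr / 2)) (Num.min (rs / 2) (e / 2 / (B + 1))).
  have r0 : 0 < r by rewrite !lt_min !divr_gt0.
  have r1 : r <= rl / 2 by rewrite !ge_min lexx.
  have r2 : r <= rr / 2 by rewrite !ge_min lexx !orbT.
  have r3 : r <= rs / 2 by rewrite !ge_min lexx !orbT.
  have r4 : r <= e / 2 / (B + 1) by rewrite !ge_min lexx !orbT.
  have [|el el0 Hel] := Hl (b - r); first by apply/andP; split; lra.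
  have [|er er0 Her] := Hr (b + r); first by apply/andP; split; lra.
  pose y := Num.min (Num.min (el / 2) (er / 2)) (Num.min (rs / 2) (rv / 2)).
  have y0 : 0 < y by rewrite !lt_min !divr_gt0.
  have yl : y <= el / 2 by rewrite !ge_min lexx.
  have yr : y <= er / 2 by rewrite !ge_min lexx !orbT.
  have ys : y <= rs / 2 by rewrite !ge_min lexx !orbT.
  have yv : y <= rv / 2 by rewrite !ge_min lexx !orbT.
  have X1 : b - r < X y by apply: trap => //; apply: Hel; rewrite y0; lra.
  have X2 : X y < b + r by apply: trap' => //; apply: Her; rewrite y0; lra.
  have Xb : `|X y - b| < r by rewrite ltr_norml; apply/andP; split; lra.
  have s1 : `|v (X y) y - v b y| <= B * `|X y - b|.
    by apply: Hs; [lra|rewrite y0; lra].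
  have s2 : `|v b y - top| < e / 2 by apply: Hv; rewrite y0; lra.
  have s3 : B * `|X y - b| <= e / 2.
    apply: (@le_trans _ _ ((B + 1) * r)).
      by apply: ler_pM => //; [lra|exact: ltW].
    by move: r4; rewrite ler_pdivlMr// mulrC.
  exists y => //; rewrite /V.
  move: s1 s2; rewrite ler_norml ltr_norml => /andP[_ s1] /andP[_ s2].
  by rewrite /e in s1 s2 s3; lra.
have [M HM] := grow t.
pose y2 := Num.max y1 M + 1.
have y12 : y1 < y2 by rewrite /y2 (@le_lt_trans _ _ (Num.max y1 M)) ?le_max ?lexx// ltrDl.
have y20 : 0 < y2 := lt_trans y10 y12.
have Vy2 : t < V y2.
  by apply: HM => //; rewrite /y2 (@le_lt_trans _ _ (Num.max y1 M)) ?le_max ?lexx ?orbT// ltrDl.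
have cV : {within `[y1, y2], continuous V}.
  apply: cont_within => y /=; rewrite in_itv/= => /andP[h _]; apply: Vc.
  exact: lt_le_trans h.
have [|y yin Vy] := IVT (ltW y12) cV (v := t).
  have VV := ltW (lt_trans Vy1 Vy2).
  by rewrite (min_idPl VV) (max_idPr VV) !ltW.
move: yin; rewrite in_itv/= => /andP[h _].
have yp : 0 < y := lt_le_trans y10 h.
by exists (X y), y; split => //; exact: XE.
Qed.

End LevelCurve.

(** * The interior of a comb *)

Section CombGeometry.
Variable R : realType.
Implicit Types (d j : nat) (q h : nat -> R) (z w : R[i]).

Lemma nbhs_plane w (A : set R[i]) :
  nbhs (w : R[i]^o) A <-> exists2 r : R, 0 < r & forall z, nm (z - w) < r -> A z.
Proof.
split=> [/nbhs_ballP[e /= e0 H]|[r r0 H]].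
  have eE : e = (Re e)%:C by apply/esym/RRe_real/gtr0_real.
  exists (Re e); first by move: e0; rewrite eE ltcR.
  move=> z zw; apply: H; have : `|z - w| < e by rewrite (normE (z - w)) eE ltcR.
  by rewrite distrC.
have rC : 0 < r%:C by rewrite ltcE /= eqxx.
apply/nbhs_ballP; exists r%:C => //.
by move=> z zb; have : `|w - z| < r%:C := zb; rewrite distrC (normE (z - w)) ltcR => /H.
Qed.

Definition open_comb d q h : set R[i] := [set w | [/\ 0 < Re w < 1, 0 < Im w &
  forall j, (1 <= j < d)%N -> Re w = q j -> h j < Im w]].

(** Each of the finitely many conditions is open. *)
Lemma avoid_slits n q h w : (forall j, (1 <= j < n)%N -> Re w = q j -> h j < Im w) ->
  exists2 r : R, 0 < r & forall z, nm (z - w) < r ->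
    forall j, (1 <= j < n)%N -> Re z = q j -> h j < Im z.
Proof.
elim: n => [|n IH] H; first by exists 1 => // z _ j; rewrite ltn0 andbF.
have [|r r0 Hr] := IH.
  by move=> j /andP[j1 jn]; apply: H; rewrite j1 ltnS ltnW.
have [r' r'0 Hr'] : exists2 r' : R, 0 < r' & forall z, nm (z - w) < r' ->
    (1 <= n)%N -> Re z = q n -> h n < Im z.
  have [n0|n1] := leqP n 0; first by exists 1 => // z _; rewrite ltnNge n0.
  have [E|N] := eqVneq (Re w) (q n).
    have hn : h n < Im w by apply: H => //; rewrite n1 ltnS leqnn.
    exists (Im w - h n); first by rewrite subr_gt0.
    move=> z zw _ _; have := le_lt_trans (Im_nm _) zw.
    by rewrite cImD cImN ltr_norml => /andP[+ _]; lra.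
  exists `|Re w - q n|; first by rewrite normr_gt0 subr_eq0.
  move=> z zw _ E; have := le_lt_trans (Re_nm _) zw.
  by rewrite cReD cReN E distrC ltxx.
exists (Num.min r r'); first by rewrite lt_min r0.
move=> z; rewrite lt_min => /andP[zr zr'] j /andP[j1]; rewrite ltnS leq_eqVlt.
move=> /predU1P[E|jn]; first by rewrite E; apply: Hr' => //; rewrite -E.
by apply: Hr => //; rewrite j1.
Qed.

(** The interior loses the two vertical sides and nothing else, the slits being closed and
finitely many. *)
Lemma interior_comb d q h : interior (comb d q h : set R[i]^o) = open_comb d q h.
Proof.
apply/seteqP; split=> [w /nbhs_plane[r r0 H]|w [/andP[w0 w1] iw sw]].
  have [[iw _] ns] : comb d q h w by apply: H; rewrite subrr nm0.
  have r2 : 0 < r / 2 by rewrite divr_gt0.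
  have side s : `|s| = r / 2 -> 0 <= Re w + s <= 1.
    move=> sr; have [[_ +] _] : comb d q h ((Re w + s) +i* Im w); last by [].
    apply: H; have -> : ((Re w + s) +i* Im w) - w = s%:C.
      by apply: complexP; rewrite ?cReD ?cImD ?cReN ?cImN /=; ring.
    by rewrite nm_real sr; lra.
  split=> [||j jd E] //.
    have n2 : `|r / 2| = r / 2 by rewrite gtr0_norm.
    have /andP[_ s2] := side _ n2; rewrite -normrN in n2; have /andP[s1 _] := side _ n2.
    by apply/andP; split; lra.
  by rewrite ltNge; apply/negP => hj; apply: ns; exists j => //; split=> //; rewrite hj ltW.
have [r r0 Hr] := avoid_slits sw.
apply/nbhs_plane; exists (Num.min r (Num.min (Im w) (Num.min (Re w) (1 - Re w)))).
  by rewrite !lt_min r0 iw w0 subr_gt0.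
move=> z; rewrite !lt_min => /and4P[z1 z2 z3 z4].
have := le_lt_trans (Im_nm _) z2; rewrite cImD cImN ltr_norml => /andP[i1 _].
have := le_lt_trans (Re_nm _) z3; rewrite cReD cReN ltr_norml => /andP[i2 _].
have := le_lt_trans (Re_nm _) z4; rewrite cReD cReN ltr_norml => /andP[_ i3].
split=> [|[j jd [E /andP[_ hj]]]].
  by split; [lra|apply/andP; split; lra].
by have := Hr z z1 j jd E; rewrite ltNge hj.
Qed.

(** By strong induction: a value of q at j that q' takes at a smaller index would also be
taken by q there. *)
Lemma increasing_unique d (q q' : nat -> R) :
  (forall i j, (1 <= i)%N -> (i < j)%N -> (j < d)%N -> q i < q j) ->
  (forall i j, (1 <= i)%N -> (i < j)%N -> (j < d)%N -> q' i < q' j) ->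
  (forall j, (1 <= j < d)%N -> exists2 i, (1 <= i < d)%N & q j = q' i) ->
  (forall j, (1 <= j < d)%N -> exists2 i, (1 <= i < d)%N & q' j = q i) ->
  forall j, (1 <= j < d)%N -> q j = q' j.
Proof.
move=> iq iq' s s' j; have [n] := ubnP j; elim: n j => // n IH j; rewrite ltnS => jn jd.
have ih i : (i < j)%N -> (1 <= i)%N -> q i = q' i.
  by move=> ij i1; apply: IH; lia.
have mono (p : nat -> R) : (forall i j, (1 <= i)%N -> (i < j)%N -> (j < d)%N -> p i < p j) ->
    forall i, (i < d)%N -> (j <= i)%N -> p j <= p i.
  move=> ip i id; rewrite leq_eqVlt => /predU1P[->//|ji].
  by apply/ltW/ip => //; case/andP: jd.
have /andP[j1 jd'] := jd.
apply/eqP; rewrite eq_le; apply/andP; split.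
  have [i /andP[i1 id] E] := s' j jd; rewrite E; have [ji|ij] := leqP j i; first exact: mono.
  by have := iq' i j i1 ij jd'; rewrite -ih// E ltxx.
have [i /andP[i1 id] E] := s j jd; rewrite E; have [ji|ij] := leqP j i; first exact: mono.
by have := iq i j i1 ij jd'; rewrite ih// E ltxx.
Qed.

(** The slits of a comb can be read off its interior: their abscissae are those at which some
point of the half-strip is missing, and their heights bound the missing ordinates. *)
Lemma open_comb_inj d q h q' h' : comb_parameters d q h -> comb_parameters d q' h' ->
  open_comb d q h = open_comb d q' h' ->
  forall j, (1 <= j < d)%N -> q j = q' j /\ h j = h' j.
Proof.
move=> P P' E.
have abscissa (p g p' g' : nat -> R) :
    comb_parameters d p g -> open_comb d p g = open_comb d p' g' ->
    forall j, (1 <= j < d)%N -> exists2 i, (1 <= i < d)%N & p j = p' i.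
  move=> [pp _] e j jd; have /andP[j1 j2] := jd; have [pj gj] := pp j j1 j2.
  apply: contrapT => N; have : open_comb d p' g' (p j +i* g j).
    by split => //= i id ji; case: N; exists i.
  by rewrite -e => -[_ _ /(_ j jd erefl)] /=; rewrite ltxx.
have [p1 i1] := P; have [p2 i2] := P'.
have qE := increasing_unique i1 i2 (abscissa _ _ _ _ P E) (abscissa _ _ _ _ P' (esym E)).
have height (p g p' g' : nat -> R) : comb_parameters d p g -> comb_parameters d p' g' ->
    open_comb d p g = open_comb d p' g' -> (forall j, (1 <= j < d)%N -> p j = p' j) ->
    forall j, (1 <= j < d)%N -> g' j <= g j.
  move=> [pp ip] [pp' _] e pE j jd; have /andP[j1 j2] := jd; have [pj _] := pp j j1 j2.
  rewrite leNgt; apply/negP => lt; have [_ gj'] := pp' j j1 j2.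
  have : open_comb d p g (p j +i* g' j).
    split => //= i id ij; suff -> : i = j by [].
    have /andP[ci1 ci2] := id.
    apply/eqP; rewrite eqn_leq; apply/andP; split; rewrite leqNgt; apply/negP => l.
      by have := ip j i j1 l ci2; rewrite ij ltxx.
    by have := ip i j ci1 l j2; rewrite ij ltxx.
  by rewrite e => -[_ _ /(_ j jd)] /=; rewrite pE// ltxx => /(_ erefl).
move=> j jd; split; first exact: qE.
apply/eqP; rewrite eq_le; apply/andP; split.
  by apply: (height q' h' q h) => // i id; rewrite qE.
exact: (height q h q' h').
Qed.

End CombGeometry.

(** * The differential on the real line *)

Section Differential.
Variables (R : realType) (d : nat) (c : nat -> R) (k : {poly R}).
Hypotheses (d1 : (1 <= d)%N) (oc : ordered_endpoints d c).
Local Notation eta := (eta d c k).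
Local Notation mu := (mu d c).
Implicit Types (z w : R[i]) (x y p q t : R).

Lemma endpoints_le i j : (1 <= i)%N -> (i <= j)%N -> (j <= 2 * d)%N -> c j <= c i.
Proof.
move=> i1; rewrite leq_eqVlt => /predU1P[->//|ij jd]; apply: ltW; exact: oc.
Qed.

Lemma endpoints_neq i j : (1 <= i <= 2 * d)%N -> (1 <= j <= 2 * d)%N -> i != j -> c i != c j.
Proof.
move=> /andP[i1 i2] /andP[j1 j2]; rewrite neq_ltn => /orP[h|h].
  by rewrite gt_eqF// oc.
by rewrite lt_eqF// oc.
Qed.

Lemma eta_pval z : eta z = pval k z / mu z. Proof. by []. Qed.

Lemma nm_mu z : nm (mu z) = \prod_(1 <= j < (2 * d).+1) Num.sqrt (nm (z - (c j)%:C)).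
Proof. by rewrite nm_prod; apply: eq_bigr => j _; rewrite nm_sqrtc. Qed.

Lemma mu_neq0 z : (forall j, (1 <= j <= 2 * d)%N -> z != (c j)%:C) -> mu z != 0.
Proof.
move=> zc; rewrite -nm_eq0 nm_mu prodf_seq_neq0; apply/allP => j.
rewrite mem_index_iota ltnS => /zc zj /=.
by rewrite sqrtr_eq0 -ltNge nm_gt0 subr_eq0.
Qed.

Lemma cmeas_mu (D : set R) f : (forall t, D t -> 0 <= Im (f t)) -> cmeas D f ->
  cmeas D (fun t => mu (f t)).
Proof.
move=> f0 mf; apply: cmeas_prod => j _; apply: cmeas_sqrtc.
  by move=> t Dt; rewrite cImD /= oppr0 addr0 f0.
by apply: cmeasD => //; exact: cmeas_cst.
Qed.

Lemma cmeas_eta (D : set R) f : (forall t, D t -> 0 <= Im (f t)) -> cmeas D f ->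
  cmeas D (fun t => eta (f t)).
Proof.
move=> f0 mf; apply: cmeasM; first exact: cmeas_pval.
by apply: cmeasV; exact: cmeas_mu.
Qed.

Lemma ccvg_eta {T : Type} {F : set_system T} {FF : Filter F} (f : T -> R[i]) l :
  0 <= Im l -> (\forall s \near F, 0 <= Im (f s)) ->
  (forall j, (1 <= j <= 2 * d)%N -> l != (c j)%:C) ->
  ccvg F f l -> ccvg F (fun s => eta (f s)) (eta l).
Proof.
move=> l0 f0 lc fl; apply: ccvgM; first exact: ccvg_pval.
apply: ccvgV; first exact: mu_neq0.
apply: ccvg_prod => j _; apply: ccvg_sqrtc.
- by rewrite cImD /= oppr0 addr0.
- by apply: filterS f0 => t; rewrite cImD /= oppr0 addr0.
- by apply: ccvgD => //; exact: ccvg_cst.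
Qed.

(** The size of 1 / mu on the real line. *)
Definition weight x : R := \prod_(1 <= j < (2 * d).+1) invsqrt (x - c j).

Lemma weight_ge0 x : 0 <= weight x.
Proof. by apply: prodr_ge0 => j _; exact: invsqrt_ge0. Qed.

Lemma nm_eta_real x : nm (eta x%:C) = `|k.[x]| * weight x.
Proof.
rewrite eta_pval nmM nmV pval_real nm_real nm_mu -prodfV; congr (_ * _).
by apply: eq_bigr => j _; rewrite -rmorphB nm_real.
Qed.

Lemma real_sub_nm z (x : R) : `|Re z - x| <= nm (z - x%:C).
Proof. by rewrite (le_trans _ (Re_nm _))// cReD. Qed.

Lemma invsqrt_nm_le z x : Re z != x -> (Num.sqrt (nm (z - x%:C)))^-1 <= invsqrt (Re z - x).
Proof.
move=> zx; have h : 0 < `|Re z - x| by rewrite normr_gt0 subr_eq0.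
have h' := real_sub_nm z x.
by rewrite /invsqrt lef_pV2 ?posrE ?sqrtr_gt0 ?(lt_le_trans h)// ler_wsqrtr.
Qed.

(** A point is at least as far from an endpoint as its projection to the real line, which
makes the bound uniform in the height. *)
Lemma nm_eta_le z (M : R) : 0 <= M -> nm (pval k z) <= M ->
  (forall j, (1 <= j <= 2 * d)%N -> Re z != c j) -> nm (eta z) <= M * weight (Re z).
Proof.
move=> M0 zM zc; rewrite eta_pval nmM nmV nm_mu -prodfV; apply: ler_pM => //.
- exact: nm_ge0.
- by apply: prodr_ge0 => j _; rewrite invr_ge0 sqrtr_ge0.
rewrite /weight !big_nat; apply: ler_prod => j; rewrite ltnS => hj.
by rewrite invr_ge0 sqrtr_ge0 invsqrt_nm_le// zc.
Qed.

Lemma weight_integrable p q : rintegrable `[p, q] weight.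
Proof.
have := @invsqrt_prod_integrable R nat (index_iota 1 (2 * d).+1) (fun j => - c j) (fun=> 1) p q.
rewrite (_ : (fun t : R => _) = weight); last first.
  by apply/funext => t; apply: eq_bigr => j _; rewrite mulr1 addrC.
apply; first exact: iota_uniq.
  by move=> j _; rewrite oner_neq0 orbT.
move=> i j; rewrite !mem_index_iota !ltnS => hi hj ij; apply: jointly_bounded_below_affine.
by rewrite !mulr1 eqr_opp endpoints_neq.
Qed.

Lemma cintegrable_eta p q : cintegrable `[p, q] (fun x => eta x%:C).
Proof.
have mr (D : set R) : cmeas D (fun x : R => x%:C).
  by split; [exact: measurable_id|exact: measurable_cst].
have [M M0 HM] := pval_bounded k (`|p| + `|q|).
apply: (@cintegrable_le _ _ _ (fun x => M * weight x)) => //.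
- by apply: cmeas_eta => // t _ /=.
- move=> t; rewrite /= in_itv/= => /andP[pt tq].
  rewrite -[nm _]/(nm (eta t%:C)) nm_eta_real ler_wpM2r ?weight_ge0//.
  rewrite -nm_real -pval_real; apply: HM; rewrite nm_real.
  have := ler_norm p; have := ler_norm q; have := ler_norm (- p); have := ler_norm (- q).
  rewrite !normrN => *; rewrite ler_norml; apply/andP; split; have := normr_ge0 p; have := normr_ge0 q; lra.
- by apply: rintegrableZ => //; exact: weight_integrable.
Qed.

Lemma sqrtc_neg x : x < 0 -> sqrtc x%:C = 'i%C * (Num.sqrt `|x|)%:C.
Proof.
move=> x0; rewrite sqrtcE//= expr0n/= addr0 sqrtr_sqr ltr0_norm// addNr mul0r sqrtr0.
have -> : (- x - x) / 2 = - x by field.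
by apply: complexP; rewrite ?cReM ?cImM /=; ring.
Qed.

Lemma sqrtc_pos x : 0 <= x -> sqrtc x%:C = (Num.sqrt `|x|)%:C.
Proof. by move=> x0; rewrite sqrtc_sqrtr ?ler0c//= ger0_norm. Qed.

Lemma realCB x y : (x - y)%:C = x%:C - y%:C. Proof. exact: rmorphB. Qed.

(** To the left of exactly 2m endpoints, 2m of the square roots are imaginary. *)
Lemma eta_gap m x : (1 <= m)%N -> (m < d)%N -> c (2 * m).+1 < x < c (2 * m)%N ->
  eta x%:C = ((-1) ^+ m * k.[x] * weight x)%:C.
Proof.
move=> m1 md /andP[x1 x2].
have md2 : (2 * m < 2 * d)%N by rewrite ltn_pmul2l.
have muE : mu x%:C = (\prod_(1 <= j < (2 * m).+1) sqrtc (x%:C - (c j)%:C)) *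
    \prod_((2 * m).+1 <= j < (2 * d).+1) sqrtc (x%:C - (c j)%:C).
  by rewrite /mu (big_cat_nat (n := (2 * m).+1))//; rewrite ltnS ltnW.
rewrite eta_pval pval_real muE.
have -> : \prod_(1 <= j < (2 * m).+1) sqrtc (x%:C - (c j)%:C) =
    ((-1) ^+ m * \prod_(1 <= j < (2 * m).+1) Num.sqrt `|x - c j|)%:C.
  rewrite rmorphM rmorphXn rmorphN rmorph1 rmorph_prod.
  have -> : (-1 : R[i]) ^+ m = \prod_(1 <= j < (2 * m).+1) 'i%C.
    rewrite prodr_const_nat subSS subn0 exprM; congr (_ ^+ _).
    by rewrite sqr_i.
  rewrite -big_split big_nat [RHS]big_nat; apply: eq_bigr => j /andP[j1 jm].
  rewrite -realCB sqrtc_neg// subr_lt0 (lt_le_trans x2)// endpoints_le//.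
  exact: ltnW.
have -> : \prod_((2 * m).+1 <= j < (2 * d).+1) sqrtc (x%:C - (c j)%:C) =
    (\prod_((2 * m).+1 <= j < (2 * d).+1) Num.sqrt `|x - c j|)%:C.
  rewrite rmorph_prod !big_nat; apply: eq_bigr => j /andP[jm jd].
  rewrite -realCB sqrtc_pos// subr_ge0 (le_trans _ (ltW x1))// endpoints_le//.
set P := \prod_(1 <= j < _) _; set Q := \prod_(_ <= j < _) _.
have wE : weight x = P^-1 * Q^-1.
  rewrite /weight (big_cat_nat (n := (2 * m).+1)) ?ltnS ?(ltnW md2)//.
  by rewrite /P /Q -!prodfV.
have sE : (((-1) ^+ m)^-1 : R) = (-1) ^+ m by rewrite -exprVn invrN1.
rewrite -rmorphM -fmorphV -rmorphM; congr (_%:C).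
by rewrite wE invfM invfM sE; ring.
Qed.

Lemma gap_lt m : (1 <= m)%N -> (m < d)%N -> c (2 * m).+1 < c (2 * m)%N.
Proof. by move=> m1 md; apply: oc => //; [rewrite muln_gt0|rewrite ltn_pmul2l]. Qed.

(** Without a zero in the gap, eta would be real of constant sign there. *)
Lemma gap_root m : (1 <= m)%N -> (m < d)%N ->
  Cint (fun x => eta x%:C) (c (2 * m).+1) (c (2 * m)%N) = 0 ->
  exists x, c (2 * m).+1 < x < c (2 * m)%N /\ root k x.
Proof.
move=> m1 md I0; apply: contrapT => /forallNP nr.
set a := c (2 * m).+1 in I0 nr *; set b := c (2 * m)%N in I0 nr *.
have ab : a < b by exact: gap_lt.
pose x0 := (a + b) / 2.
have x0ab : a < x0 < b by rewrite /x0; apply/andP; split; lra.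
have kn0 x : a < x < b -> k.[x] != 0.
  by move=> xab; apply/negP => kx; apply: (nr x).
have same x : a < x < b -> 0 < k.[x] * k.[x0].
  move=> xab; rewrite lt_def mulf_neq0 ?kn0//= leNgt; apply/negP => h.
  have ivt p q : a < p < b -> a < q < b -> p <= q -> k.[p] * k.[q] < 0 -> False.
    move=> /andP[ap pb] /andP[aq qb] pq h'.
    have [r] := polyrcf.poly_ivtoo pq h'; rewrite in_itv/= => /andP[pr rq] rr.
    by apply: (nr r); rewrite (lt_trans ap pr) (lt_trans rq qb).
  have [xx|xx] := leP x x0; first exact: ivt xab x0ab xx h.
  by apply: ivt x0ab xab (ltW xx) _; rewrite mulrC.
have wt0 x : a < x < b -> 0 < weight x.
  move=> xab; rewrite lt_def weight_ge0 andbT prodf_seq_neq0; apply/allP => j.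
  rewrite mem_index_iota ltnS => hj /=; rewrite invr_eq0 sqrtr_eq0 -ltNge normr_gt0 subr_eq0.
  apply/eqP => xc; move: xab; rewrite xc /a /b => /andP[].
  have [jm|jm] := leqP j (2 * m).
    by move=> _; rewrite ltNge endpoints_le//; [case/andP : hj|rewrite leq_pmul2l// ltnW].
  by rewrite ltNge endpoints_le//; case/andP : hj.
pose s := (-1) ^+ m * k.[x0].
have : 0 < \int[leb]_(x in `[a, b]) (s * Re (eta x%:C)).
  apply: Rintegral_gt0 => //.
    by apply: rintegrableZ => //; exact: (cintegrable_eta a b).1.
  move=> x xab; rewrite (eta_gap m1 md xab) /= /s.
  have -> : (-1) ^+ m * k.[x0] * ((-1) ^+ m * k.[x] * weight x) =
            ((-1) ^+ m * (-1) ^+ m) * ((k.[x] * k.[x0]) * weight x) by ring.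
  by rewrite -exprMn mulrNN mulr1 expr1n mul1r mulr_gt0 ?same ?wt0.
rewrite RintegralZl//; last exact: (cintegrable_eta a b).1.
by move: I0 => /(congr1 Re) /= ->; rewrite mulr0 ltxx.
Qed.

End Differential.

Section Zeros.
Variables (R : realType) (d : nat) (c : nat -> R) (k : {poly R}).
Hypotheses (d1 : (1 <= d)%N) (oc : ordered_endpoints d c).

Definition gap_points (x : nat -> R) : Prop :=
  forall m, (1 <= m)%N -> (m < d)%N -> c (2 * m).+1 < x m < c (2 * m)%N.

Definition zeros_at (x : nat -> R) : Prop :=
  k = lead_coef k *: \prod_(1 <= m < d) ('X - (x m)%:P).

Lemma gap_points_lt (x : nat -> R) m n : gap_points x ->
  (1 <= m)%N -> (m < n)%N -> (n < d)%N -> x n < x m.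
Proof.
move=> gx m1 mn nd; have /andP[_ h1] := gx n (leq_trans m1 (ltnW mn)) nd.
have /andP[h2 _] := gx m m1 (ltn_trans mn nd).
apply: (lt_le_trans h1); apply: le_trans (ltW h2); apply: (endpoints_le oc) => //.
  by rewrite ltn_pmul2l.
by rewrite leq_pmul2l// ltnW.
Qed.

(** One zero in each of the d - 1 gaps exhausts the degree of k. *)
Lemma third_kind_zeros : third_kind d c k ->
  exists x, gap_points x /\ zeros_at x.
Proof.
move=> [sk _ I0].
have /choice[x hx] : forall m, exists y, (1 <= m)%N -> (m < d)%N ->
    c (2 * m).+1 < y < c (2 * m)%N /\ root k y.
  move=> m; have [/andP[m1 md]|h] := boolP ((1 <= m)%N && (m < d)%N).
    by have [y hy] := gap_root oc m1 md (I0 m m1 md); exists y.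
  by exists 0 => m1 md; rewrite m1 md in h.
have gx : gap_points x by move=> m m1 md; have [] := hx m m1 md.
exists x; split => //.
have := @all_roots_prod_XsubC R k [seq x m | m <- index_iota 1 d].
rewrite /zeros_at big_map; apply.
- by rewrite sk size_map size_iota subn1 prednK.
- by apply/allP => z /mapP[m]; rewrite mem_index_iota => /andP[m1 md] ->; have [] := hx m m1 md.
rewrite uniq_rootsE map_inj_in_uniq ?iota_uniq// => m n.
rewrite !mem_index_iota => /andP[m1 md] /andP[n1 nd] xmn.
have [h|h|//] := ltngtP m n.
  by have := gap_points_lt gx m1 h nd; rewrite xmn ltxx.
by have := gap_points_lt gx n1 h md; rewrite xmn ltxx.
Qed.
End Zeros.

(** * The argument of the differential *)

Section PolarForm.
Variables (R : realType) (d : nat) (c : nat -> R) (k : {poly R}) (xr : nat -> R).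
Hypotheses (d1 : (1 <= d)%N) (oc : ordered_endpoints d c).
Hypotheses (gx : gap_points d c xr) (kE : zeros_at d k xr).
Local Notation eta := (eta d c k).
Local Notation mu := (mu d c).
Local Notation l := (lead_coef k).
Implicit Types (z w : R[i]) (x y p q t : R).

Lemma pval_prod z : pval k z = l%:C * \prod_(1 <= m < d) (z - (xr m)%:C).
Proof.
rewrite /pval kE map_polyZ /= hornerZ rmorph_prod horner_prod -kE; congr (_ * _).
by apply: eq_bigr => m _; rewrite rmorphB /= map_polyX map_polyC /= hornerXsubC.
Qed.

(** The argument of eta up to the sign of the leading coefficient of k. *)
Definition phase z : R := \sum_(1 <= m < d) arg (z - (xr m)%:C) -
  (\sum_(1 <= j < (2 * d).+1) arg (z - (c j)%:C)) / 2.

Definition modulus z : R := (\prod_(1 <= m < d) nm (z - (xr m)%:C)) *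
  \prod_(1 <= j < (2 * d).+1) (Num.sqrt (nm (z - (c j)%:C)))^-1.

Lemma eta_polar z : 0 <= Im z -> eta z = (l * modulus z)%:C * cis (phase z).
Proof.
move=> z0; have zc (x : R) : 0 <= Im (z - x%:C) by rewrite cImD /= oppr0 addr0.
rewrite eta_pval pval_prod /modulus /phase cisD cisN mulr_suml !cis_sum !rmorphM /=.
have -> : \prod_(1 <= m < d) (z - (xr m)%:C) =
    (\prod_(1 <= m < d) nm (z - (xr m)%:C))%:C * \prod_(1 <= m < d) cis (arg (z - (xr m)%:C)).
  by rewrite rmorph_prod -big_split; apply: eq_bigr => m _; exact: polarE.
have -> : mu z = (\prod_(1 <= j < (2 * d).+1) Num.sqrt (nm (z - (c j)%:C)))%:C *
    \prod_(1 <= j < (2 * d).+1) cis (arg (z - (c j)%:C) / 2).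
  by rewrite rmorph_prod -big_split; apply: eq_bigr => m _; exact: sqrtc_polar.
rewrite prodfV fmorphV invfM.
by rewrite -!mulrA; do 2 congr (_ * _); rewrite mulrCA.
Qed.

Lemma modulus_ge0 z : 0 <= modulus z.
Proof.
by rewrite mulr_ge0//; apply: prodr_ge0 => j _; rewrite ?invr_ge0 ?sqrtr_ge0 ?nm_ge0.
Qed.

Lemma modulus_gt0 z : (forall m, (1 <= m < d)%N -> z != (xr m)%:C) ->
  (forall j, (1 <= j <= 2 * d)%N -> z != (c j)%:C) -> 0 < modulus z.
Proof.
move=> zx zc; rewrite lt_def modulus_ge0 andbT mulf_neq0//.
  rewrite prodf_seq_neq0; apply/allP => m; rewrite mem_index_iota => /zx h /=.
  by rewrite nm_eq0 subr_eq0.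
rewrite prodf_seq_neq0; apply/allP => m; rewrite mem_index_iota ltnS => /zc h /=.
by rewrite invr_eq0 sqrtr_eq0 -ltNge nm_gt0 subr_eq0.
Qed.

(** As the zeros of k lie in the gaps, the arguments cancel up to a quantity between those
of the two extreme factors. *)
Lemma phase_bounds z : 0 < Im z -> - pi < phase z < 0.
Proof.
move=> z0; have zc (x : R) : 0 < Im (z - x%:C) by rewrite cImD /= oppr0 addr0.
have /andP[h1 h2] : - arg (z - (c 1%N)%:C) <= phase z <= - arg (z - (c (2 * d)%N)%:C).
  apply: (alternating_bounds d1) => [j j1 jd|m m1 md].
    by apply: arg_sub_homo => //; apply: ltW; exact: oc.
  by have /andP[x1 x2] := gx m1 md; rewrite !arg_sub_homo// ltW.
rewrite (lt_le_trans _ h1) ?(le_lt_trans h2)//.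
  by rewrite oppr_lt0 arg_gt0.
by rewrite ltrN2 arg_ltpi.
Qed.

(** The leading coefficient is kept, its sign being determined only by the behaviour at
infinity. *)
Lemma sg_eta_upper z : 0 < Im z -> l != 0 -> Num.sg l * Im (eta z) < 0.
Proof.
move=> z0 l0; rewrite eta_polar ?ltW// cImZ.
have zr (x : R) : z != x%:C.
  by apply/eqP => /(congr1 Im) /= E; rewrite E ltxx in z0.
have h0 : 0 < `|l| * modulus z by rewrite mulr_gt0 ?normr_gt0// modulus_gt0.
rewrite mulrA [_ * (l * _)]mulrA -normrEsg (pmulr_rlt0 _ h0).
have /andP[p1 p2] := phase_bounds z0.
rewrite /= -oppr_gt0 -sinN sin_gt0_pi// oppr_gt0 p2/=.
by rewrite ltrNl.
Qed.

Lemma arg_left x (a : R) : x < a -> arg (x%:C - a%:C) = pi.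
Proof. by move=> xa; rewrite -realCB arg_real_lt0// subr_lt0. Qed.
Lemma arg_right x (a : R) : a < x -> arg (x%:C - a%:C) = 0.
Proof. by move=> xa; rewrite -realCB arg_real_gt0// subr_gt0. Qed.

Lemma cis_half : cis (- (pi / 2)) = - 'i%C :> R[i].
Proof. by apply: complexP; rewrite /= ?cosN ?sinN ?cos_pihalf ?sin_pihalf ?oppr0. Qed.
Lemma cis_pi : cis (- pi) = -1 :> R[i].
Proof. by apply: complexP; rewrite /= ?cosN ?sinN ?cospi ?sinpi ?oppr0. Qed.

(** A gap that does not contain x contributes nothing to the phase at x. *)
Lemma unseparated x m : (1 <= m)%N -> (m < d)%N ->
  x < c (2 * m).+1 \/ c (2 * m)%N < x ->
  arg (x%:C - (c (2 * m).+1)%:C) = arg (x%:C - (c (2 * m)%N)%:C) /\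
  arg (x%:C - (xr m)%:C) = arg (x%:C - (c (2 * m)%N)%:C).
Proof.
move=> m1 md; have /andP[h1 h2] := gx m1 md; have h3 := lt_trans h1 h2.
move=> [h|h].
  by have [g1 g2] := conj (lt_trans h h1) (lt_trans h h3); rewrite !arg_left.
by have [g1 g2] := conj (lt_trans h2 h) (lt_trans h3 h); rewrite !arg_right.
Qed.

Lemma phase_left x : x < c (2 * d)%N -> phase x%:C = - pi.
Proof.
move=> xd; have xc j : (1 <= j)%N -> (j <= 2 * d)%N -> x < c j.
  by move=> j1 jd; rewrite (lt_le_trans xd)// (endpoints_le oc).
rewrite /phase (paired_sum d1); last first.
  move=> m m1 md; apply: unseparated => //; left; apply: xc => //.
  by rewrite ltn_pmul2l.
have d2 : (1 <= 2 * d)%N by lia.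
rewrite !arg_left ?xc//.
by field.
Qed.

Lemma phase_right x : c 1%N < x -> phase x%:C = 0.
Proof.
move=> xd; have xc j : (1 <= j)%N -> (j <= 2 * d)%N -> c j < x.
  by move=> j1 jd; rewrite (le_lt_trans _ xd)// (endpoints_le oc).
rewrite /phase (paired_sum d1); last first.
  move=> m m1 md; apply: unseparated => //; right; apply: xc => //.
    by rewrite muln_gt0.
  by rewrite leq_pmul2l// ltnW.
have d2 : (1 <= 2 * d)%N by lia.
rewrite !arg_right ?xc//.
by rewrite addr0 oppr0 mul0r.
Qed.

Lemma phase_band m x : (1 <= m <= d)%N -> c (2 * m)%N < x < c (2 * m).-1%N ->
  phase x%:C = - (pi / 2).
Proof.
move=> /andP[m1 md] /andP[x1 x2].
have e1 : ((2 * m).-1 < 2 * m)%N by rewrite ltn_predL muln_gt0.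
have xl j : (1 <= j)%N -> (j < 2 * m)%N -> x < c j.
  move=> j1 jm; rewrite (lt_le_trans x2)// (endpoints_le oc)//.
    by rewrite -ltnS (ltn_predK jm).
  by rewrite (leq_trans (ltnW e1))// leq_pmul2l.
have xg j : (2 * m <= j)%N -> (j <= 2 * d)%N -> c j < x.
  by move=> mj jd; rewrite (le_lt_trans _ x1)// (endpoints_le oc)// muln_gt0.
rewrite /phase (paired_sum d1); last first.
  move=> n n1 nd; apply: unseparated => //.
  have [h|h] := leqP m n; [right|left].
    by apply: xg; rewrite leq_pmul2l// ltnW.
  by apply: xl; lia.
rewrite arg_left ?xl//; last by lia.
rewrite arg_right ?xg ?leq_pmul2l//.
by rewrite addr0 mulNr.
Qed.

Lemma phase_gap m x : (1 <= m)%N -> (m < d)%N -> c (2 * m).+1 < x < c (2 * m)%N ->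
  phase x%:C = arg (x%:C - (xr m)%:C) - pi.
Proof.
move=> m1 md /andP[x1 x2].
have xl j : (1 <= j)%N -> (j <= 2 * m)%N -> x < c j.
  move=> j1 jm; rewrite (lt_le_trans x2)// (endpoints_le oc)//.
  by rewrite leq_pmul2l// ltnW.
have xg j : (2 * m < j)%N -> (j <= 2 * d)%N -> c j < x.
  by move=> mj jd; rewrite (le_lt_trans _ x1)// (endpoints_le oc).
rewrite /phase (paired_sum_but1 m1 md); last first.
  move=> n n1 nd nm; apply: unseparated => //.
  have [h|h|E] := ltngtP m n; [right|left|by rewrite E eqxx in nm].
    by apply: xg; lia.
  by apply: xl; lia.
rewrite (arg_left (a := c 1%N)) ?xl//; last by lia.
rewrite (arg_right (a := c (2 * d)%N)) ?xg//; last by lia.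
rewrite (arg_left (a := c (2 * m)%N)) ?xl//; last by lia.
rewrite (arg_right (a := c (2 * m).+1)) ?xg//; last by lia.
by field.
Qed.

End PolarForm.

Section CombMap.
Variables (R : realType) (d : nat) (c : nat -> R) (k : {poly R}) (xr : nat -> R).
Hypotheses (d1 : (1 <= d)%N) (oc : ordered_endpoints d c).
Hypotheses (tk : third_kind d c k) (gx : gap_points d c xr) (kE : zeros_at d k xr).
Local Notation eta := (eta d c k).
Local Notation mu := (mu d c).
Local Notation green := (green d c k).
Local Notation theta := (theta d c k).
Local Notation hm := (harmonic_measure d c k).
Local Notation lc := (lead_coef k).
Local Notation a := (c (2 * d)%N).
Implicit Types (z w h : R[i]) (x y p q s t b e : R).

(** * The derivative of the Green function *)

Lemma mu_split z : mu z =
  (\prod_(1 <= j < (2 * d)%N) sqrtc (z - (c j)%:C)) * sqrtc (z - a%:C).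
Proof. by rewrite /Defs.mu big_nat_recr//= muln_gt0. Qed.

Lemma mu_base : mu a%:C = 0.
Proof. by rewrite mu_split subrr sqrtc0 mulr0. Qed.

Lemma eta_base : eta a%:C = 0.
Proof. by rewrite eta_pval mu_base invr0 mulr0. Qed.

(** The integrand of the Green function at z0 + h without its only singularity along the
path, the factor s^(-1/2) due to the base point. *)
Definition regular_part z0 s h : R[i] :=
  (z0 - a%:C + 1%:C * h) * (lc%:C *
  (\prod_(m <- index_iota 1 d) ((a - xr m)%:C + s%:C * (z0 - a%:C) + s%:C * h)) *
  (\prod_(j <- index_iota 1 (2 * d)) (sqrtc ((a - c j)%:C + s%:C * (z0 - a%:C) + s%:C * h))^-1) *
  (sqrtc (z0 - a%:C + 1%:C * h))^-1).

Lemma integrand_split z0 s h : 0 < s -> 0 <= Im (z0 + h) ->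
  (z0 + h - a%:C) * eta (a%:C + s%:C * (z0 + h - a%:C)) =
  (invsqrt s)%:C * regular_part z0 s h.
Proof.
move=> s0 iz.
have iza : 0 <= Im (z0 + h - a%:C) by rewrite cImD /= oppr0 addr0.
have E1 : z0 - a%:C + 1%:C * h = z0 + h - a%:C.
  by rewrite (_ : 1%:C = 1)// mul1r addrAC.
have E2 (x : R) : (a - x)%:C + s%:C * (z0 - a%:C) + s%:C * h =
    a%:C + s%:C * (z0 + h - a%:C) - x%:C.
  by rewrite realCB; ring.
rewrite eta_pval (pval_prod kE) mu_split /regular_part E1.
rewrite [a%:C + _ - a%:C]addrAC subrr add0r sqrtc_scale ?(ltW s0)//.
have -> : \prod_(m <- index_iota 1 d) ((a - xr m)%:C + s%:C * (z0 - a%:C) + s%:C * h) =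
    \prod_(1 <= m < d) (a%:C + s%:C * (z0 + h - a%:C) - (xr m)%:C).
  by apply: eq_bigr => m _.
have -> : \prod_(j <- index_iota 1 (2 * d))
     (sqrtc ((a - c j)%:C + s%:C * (z0 - a%:C) + s%:C * h))^-1 =
    (\prod_(1 <= j < (2 * d)%N) sqrtc (a%:C + s%:C * (z0 + h - a%:C) - (c j)%:C))^-1.
  by rewrite -prodfV; apply: eq_bigr => m _; rewrite E2.
rewrite !invfM -fmorphV /invsqrt gtr0_norm//.
by ring.
Qed.

(** The square roots stay away from 0 along the segment, uniformly in h: close to the base
point because the other endpoints are at a positive distance, elsewhere because the segment
is above the real line. *)
Lemma regular_part_expandable z0 : 0 < Im z0 -> uniformly_expandable (regular_part z0).
Proof.
move=> y0; set y := Im z0 in y0.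
have iz : Im (z0 - a%:C) = y by rewrite cImD /= oppr0 addr0.
have ci (s : R) : {for s, continuous (fun t : R => t)} by exact: cvg_id.
have cw (b : R) (s : R) : 0 < s -> ccvg (nbhs s) (fun t => b%:C + t%:C * (z0 - a%:C))
    (b%:C + s%:C * (z0 - a%:C)).
  move=> _; apply: ccvgD; first exact: ccvg_cst.
  by apply: ccvgM; [apply: ccvg_real; exact: cvg_id|exact: ccvg_cst].
have q1 : uniformly_expandable (fun s h => z0 - a%:C + 1%:C * h).
  apply: (@expandable_affine R (fun=> z0 - a%:C) (fun=> 1) (nm (z0 - a%:C))) => // s _.
  - by rewrite ler01 lexx.
  - exact: ccvg_cst.
  - exact: cvg_cst.
apply: expandableM => //; apply: expandableM; [apply: expandableM; [apply: expandableM|]|].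
- exact: expandable_cst.
- apply: expandable_prod => m _.
  apply: (@expandable_affine R (fun s => (a - xr m)%:C + s%:C * (z0 - a%:C)) (fun s => s)
    (`|a - xr m| + nm (z0 - a%:C))) => //.
  + move=> s /andP[s0 s1]; rewrite (le_trans (nmD _ _))// nm_real lerD2l nmM nm_real.
    by rewrite gtr0_norm// ler_piMl ?nm_ge0.
  + by move=> s /andP[/ltW -> ->].
  + by move=> s; exact: cw.
- apply: expandable_prod => j; rewrite mem_index_iota => /andP[j1 jd].
  pose b := c j - a; have b0 : 0 < b by rewrite subr_gt0; apply: oc.
  pose B := nm (z0 - a%:C) + 1; have B0 : 0 < B by rewrite ltr_wpDl ?nm_ge0.
  (* The modulus is at least L: for s B <= b / 2 the real part is at most - b / 2, and
     otherwise the imaginary part is at least s y / 2. *)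
  pose L := b * y / (4 * B); have L0 : 0 < L by rewrite divr_gt0 ?mulr_gt0.
  have yB : y <= B.
    rewrite -iz (le_trans (ler_norm _))// (le_trans (Im_nm _))// lerDl ler01//.
  apply: (@expandable_isqrt R (fun s => (a - c j)%:C + s%:C * (z0 - a%:C)) (fun s => s)
    (Num.sqrt L) (Num.min 1 (y / 2))) => //.
  + by rewrite sqrtr_gt0.
  + by rewrite lt_min ltr01 divr_gt0.
  + by rewrite ge_min lexx.
  + move=> s h /andP[s0 s1]; rewrite le_min => /andP[h1 hy].
    rewrite sqr_sqrtr ?(ltW L0)//.
    have -> : (a - c j)%:C + s%:C * (z0 - a%:C) + s%:C * h =
              (- b)%:C + s%:C * (z0 - a%:C + h) by rewrite /b opprB; ring.
    set w := z0 - a%:C + h.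
    have wB : nm w <= B by rewrite (le_trans (nmD _ _))// lerD2l.
    have wy : y / 2 <= Im w.
      have := Im_nm h; have := ler_norm (- Im h); rewrite normrN cImD iz; lra.
    have Iw : Im ((- b)%:C + s%:C * w) = s * Im w by rewrite cImD cImZ /= add0r.
    have y2 : 0 < y / 2 by rewrite divr_gt0.
    split; first by rewrite Iw mulr_ge0 ?(ltW s0)// (le_trans _ wy)// ltW.
    have [sB|sB] := leP (s * B) (b / 2).
      apply: (@le_trans _ _ (b / 2)).
        rewrite /L ler_pdivrMr ?mulr_gt0//.
        have -> : b / 2 * (4 * B) = b * (2 * B) by field.
        by rewrite ler_pM2l//; lra.
      apply: le_trans (Re_nm _); rewrite cReD cReZ /=.
      have : `|s * Re w| <= b / 2.
        rewrite normrM gtr0_norm// (le_trans _ sB)// ler_pM2l//.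
        by rewrite (le_trans (Re_nm _)).
      rewrite ler_norml => /andP[_ h3].
      have := ler_norm (- (- b + s * Re w)); rewrite normrN; lra.
    apply: le_trans (Im_nm _); apply: le_trans (ler_norm _); rewrite Iw.
    rewrite /L ler_pdivrMr ?mulr_gt0//.
    have -> : s * Im w * (4 * B) = (s * B) * (Im w * 4) by ring.
    have -> : b * y = (b / 2) * (y / 2 * 4) by field.
    apply: ler_pM; rewrite ?divr_ge0 ?mulr_ge0 ?(ltW b0) ?(ltW y0) ?(ltW sB)//.
    by rewrite ler_pM2r.
  + by move=> s /andP[/ltW -> ->].
  + move=> s s0; have Iw : Im ((a - c j)%:C + s%:C * (z0 - a%:C)) = s * y.
      by rewrite cImD cImZ iz /= add0r.
    split; first by rewrite Iw mulr_ge0// ltW.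
    apply/eqP => /(congr1 Im); rewrite Iw /= => /eqP.
    by rewrite mulf_eq0 !gt_eqF.
  + by move=> s; exact: cw.
- apply: (@expandable_isqrt R (fun s => z0 - a%:C) (fun s => 1)
    (Num.sqrt (y / 2)) (Num.min 1 (y / 2))) => //.
  + by rewrite sqrtr_gt0 divr_gt0.
  + by rewrite lt_min ltr01 divr_gt0.
  + by rewrite ge_min lexx.
  + move=> s h _; rewrite le_min => /andP[h1 hy].
    rewrite sqr_sqrtr ?divr_ge0 ?(ltW y0)// (_ : 1%:C = 1)// mul1r.
    have wy : y / 2 <= Im (z0 - a%:C + h).
      have := Im_nm h; have := ler_norm (- Im h); rewrite normrN cImD iz; lra.
    split; first by rewrite (le_trans _ wy)// divr_ge0// ltW.
    by rewrite (le_trans wy)// (le_trans (ler_norm _))// Im_nm.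
  + by move=> s _; rewrite ler01 lexx.
  + move=> s _; rewrite iz (ltW y0); split => //.
    by apply/eqP => /(congr1 Im); rewrite iz /= => E; rewrite E ltxx in y0.
  + by move=> s _; exact: ccvg_cst.
  + by move=> s _; exact: cvg_cst.
Qed.

Lemma cmeas_segment (D : set R) z : 0 <= Im z -> D `<=` [set t | 0 <= t] ->
  cmeas D (fun s => eta (a%:C + s%:C * (z - a%:C))).
Proof.
move=> z0 D0; apply: cmeas_eta; last exact: cmeas_affine.
by move=> t /D0 /= t0; rewrite cImD cImZ cImD /= oppr0 add0r addr0 mulr_ge0.
Qed.

Lemma itv01_ge0 : `[0, 1]%classic `<=` [set t : R | 0 <= t].
Proof. by move=> t /=; rewrite in_itv/= => /andP[]. Qed.

Lemma invsqrt0 : invsqrt 0 = 0 :> R.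
Proof. by rewrite /invsqrt normr0 sqrtr0 invr0. Qed.

Lemma invsqrt_integrable01 : rintegrable `[0, 1] (@invsqrt R).
Proof.
have := @invsqrt_integrable R 0 1 0 1; rewrite oner_neq0 orbT => /(_ isT).
by rewrite (_ : (fun t : R => _) = @invsqrt R)//; apply/funext => t; rewrite add0r mulr1.
Qed.

Lemma cintegrable_segment z : 0 < Im z ->
  cintegrable `[0, 1] (fun s => eta (a%:C + s%:C * (z - a%:C))).
Proof.
move=> z0; have [p1 [[M [e [M0 e0 e1 H]]] _ _]] := regular_part_expandable z0.
have zn : z - a%:C != 0.
  by apply/eqP => /(congr1 Im); rewrite cImD /= oppr0 addr0 => E; rewrite E ltxx in z0.
rewrite (_ : (fun s => _) = fun s =>
  (z - a%:C)^-1 * ((z - a%:C) * eta (a%:C + s%:C * (z - a%:C)))); last first.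
  by apply/funext => s; rewrite mulKf.
apply: cintegrableZ => //.
apply: (@cintegrable_le _ _ _ (fun s => M * invsqrt s)) => //.
- apply: cmeasM; first exact: cmeas_cst.
  by apply: cmeas_segment; [exact: ltW|exact: itv01_ge0].
- move=> s; rewrite /= in_itv/= => /andP[s0 s1].
  have [->|sn0] := eqVneq s 0.
    by rewrite mul0r addr0 eta_base mulr0 invsqrt0 mulr0 [X in X <= _]nm0.
  have s0' : 0 < s by rewrite lt_def sn0.
  have := integrand_split (z0 := z) (h := 0) s0'; rewrite addr0 => /(_ (ltW z0)) E.
  rewrite -[X in X <= _]/(nm _) E nmM nm_real ger0_norm ?invsqrt_ge0// mulrC ler_wpM2r ?invsqrt_ge0//.
  have s01 : 0 < s <= 1 by rewrite s0'.
  by have [|b _ _] := H s 0 s01; first by rewrite nm0 ltW.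
- by apply: rintegrableZ => //; exact: invsqrt_integrable01.
Qed.

Lemma green_Cint z : 0 < Im z ->
  green z = Cint (fun s => (z - a%:C) * eta (a%:C + s%:C * (z - a%:C))) 0 1.
Proof. by move=> z0; rewrite CintZ//; exact: cintegrable_segment. Qed.

(** Differentiation under the integral sign: the derivative of the integrand with respect to
z is the derivative of s eta(a + s (z - a)) with respect to s, so that it integrates to
eta(z). *)
Lemma green_expansion z0 : 0 < Im z0 -> exists C e, 0 < e /\ forall h, nm h <= e ->
  0 < Im (z0 + h) /\ nm (green (z0 + h) - green z0 - h * eta z0) <= C * nm h ^+ 2.
Proof.
move=> iz0; have [p1 [[M [e' [M0 e'0 e'1 H']]] cp cp1]] := regular_part_expandable iz0.
pose e := Num.min e' (Im z0 / 2).
have e0 : 0 < e by rewrite lt_min e'0 divr_gt0.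
have ih h : nm h <= e -> 0 < Im (z0 + h).
  rewrite le_min => /andP[_ hy]; rewrite cImD.
  have := Im_nm h; have := ler_norm (- Im h); rewrite normrN; lra.
have H s h : 0 < s <= 1 -> nm h <= e -> [/\ nm (regular_part z0 s 0) <= M,
    nm (p1 s) <= M &
    nm (regular_part z0 s h - regular_part z0 s 0 - h * p1 s) <= M * nm h ^+ 2].
  by move=> s01; rewrite le_min => /andP[he _]; exact: H'.
clear H' e'0 e'1.
pose D s := (invsqrt s)%:C * p1 s.
pose F h s := (z0 + h - a%:C) * eta (a%:C + s%:C * (z0 + h - a%:C)).
have FE s h : 0 < s -> nm h <= e -> F h s = (invsqrt s)%:C * regular_part z0 s h.
  by move=> s0 /ih/ltW iz; exact: integrand_split.
have bE s h : 0 < s <= 1 -> nm h <= e ->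
    nm (F h s - F 0 s - h * D s) <= invsqrt s * (M * nm h ^+ 2).
  move=> /[dup] s01 /andP[s0 _] he; have [_ _ b] := H s h s01 he.
  rewrite !FE ?nm0 ?(ltW e0)// /D.
  have -> : (invsqrt s)%:C * regular_part z0 s h - (invsqrt s)%:C * regular_part z0 s 0 -
      h * ((invsqrt s)%:C * p1 s) =
      (invsqrt s)%:C * (regular_part z0 s h - regular_part z0 s 0 - h * p1 s) by ring.
  by rewrite nmM nm_real ger0_norm ?invsqrt_ge0// ler_wpM2l ?invsqrt_ge0.
have F0 h : F h 0 = 0 by rewrite /F mul0r addr0 eta_base mulr0.
have D0 : D 0 = 0 by rewrite /D invsqrt0 mul0r.
have cD s : 0 < s -> ccvg (nbhs s) D (D s).
  move=> s0; apply: ccvgM; last exact: cp1.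
  by apply: ccvg_real; apply: continuous_invsqrt; rewrite gt_eqF.
have mD : cmeas `[0, 1] D.
  split; apply: measurable_itv_oo_cc; apply: subspace_continuous_measurable_fun => //;
    by apply: cont_within => x /=; rewrite in_itv/= => /andP[/cD[]].
have iD : cintegrable `[0, 1] D.
  apply: (@cintegrable_le _ _ _ (fun s => M * invsqrt s)) => //; last first.
    by apply: rintegrableZ => //; exact: invsqrt_integrable01.
  move=> s; rewrite /= in_itv/= => /andP[s0 s1].
  have [->|sn0] := eqVneq s 0; first by rewrite D0 invsqrt0 mulr0 [X in X <= _]nm0.
  have s01 : 0 < s <= 1 by rewrite lt_def sn0 s0.
  have [|_ b _] := H s 0 s01; first by rewrite nm0 ltW.
  rewrite -[X in X <= _]/(nm _) nmM nm_real ger0_norm ?invsqrt_ge0// mulrC.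
  by rewrite ler_wpM2r ?invsqrt_ge0.
have iF h : nm h <= e -> cintegrable `[0, 1] (F h).
  by move=> /ih i; apply: cintegrableZ => //; exact: cintegrable_segment.
have gF h : nm h <= e -> green (z0 + h) = Cint (F h) 0 1.
  by move=> /ih i; rewrite green_Cint.
have zn : z0 - a%:C != 0.
  by apply/eqP => /(congr1 Im); rewrite cImD /= oppr0 addr0 => E; rewrite E ltxx in iz0.
have ID : Cint D 0 1 = eta z0.
  pose G s := s%:C * eta (a%:C + s%:C * (z0 - a%:C)).
  (* Moving s amounts to moving z along the segment. *)
  have GF s t : s != 0 -> G (s + t) = s%:C / (z0 - a%:C) * F ((t / s)%:C * (z0 - a%:C)) s.
    move=> s0; rewrite /F /G.
    have E : z0 + (t / s)%:C * (z0 - a%:C) - a%:C = ((s + t) / s)%:C * (z0 - a%:C).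
      by rewrite mulrDl divff// rmorphD mulrDl mul1r; ring.
    have sn : s%:C != 0 :> R[i] by rewrite -nm_eq0 nm_real normr_eq0.
    rewrite E.
    have -> : a%:C + s%:C * (((s + t) / s)%:C * (z0 - a%:C)) = a%:C + (s + t)%:C * (z0 - a%:C).
      by rewrite mulrA -rmorphM /= mulrCA divff// mulr1.
    have -> : ((s + t) / s)%:C = (s + t)%:C / s%:C by rewrite rmorphM fmorphV.
    by move: (eta _) => w; field; rewrite sn zn.
  have GF0 s : s != 0 -> G s = s%:C / (z0 - a%:C) * F 0 s.
    by move=> s0; rewrite -{1}(addr0 s) GF// mul0r mul0r.
  have qG s : 0 < s <= 1 -> has_expansion G s (D s).
    move=> /[dup] s01 /andP[s0 s1]; have sn0 : s != 0 by rewrite gt_eqF.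
    have N0 : 0 < nm (z0 - a%:C) by rewrite nm_gt0.
    have snC : s%:C != 0 :> R[i] by rewrite -nm_eq0 nm_real normr_eq0.
    exists (s / nm (z0 - a%:C) * (invsqrt s * (M * (nm (z0 - a%:C) / s) ^+ 2))).
    exists (e * s / nm (z0 - a%:C)); split; first by rewrite !mulr_gt0// invr_gt0.
    move=> t; rewrite ltr_pdivlMr// => te.
    pose h := (t / s)%:C * (z0 - a%:C).
    have nh : nm h = nm (z0 - a%:C) / s * `|t|.
      by rewrite nmM nm_real normrM normfV (gtr0_norm s0); ring.
    have he : nm h <= e.
      by rewrite nh mulrAC ler_pdivrMr// mulrC ltW.
    rewrite GF// GF0//.
    have -> : s%:C / (z0 - a%:C) * F ((t / s)%:C * (z0 - a%:C)) s -
        s%:C / (z0 - a%:C) * F 0 s - t%:C * D s =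
        s%:C / (z0 - a%:C) * (F h s - F 0 s - h * D s).
      rewrite -/h /h (_ : (t / s)%:C = t%:C / s%:C); last by rewrite rmorphM fmorphV.
      by move: (F _ s) (F 0 s) (D s) => u v w; field; rewrite snC zn.
    rewrite nmM nmM nmV nm_real gtr0_norm//.
    have -> : s / nm (z0 - a%:C) * (invsqrt s * (M * (nm (z0 - a%:C) / s) ^+ 2)) * t ^+ 2 =
        s / nm (z0 - a%:C) * (invsqrt s * (M * nm h ^+ 2)).
      by rewrite nh -(real_normK (num_real t)); ring.
    by rewrite ler_wpM2l ?divr_ge0 ?(ltW s0) ?nm_ge0// bE.
  have G0 : G 0 = 0 by rewrite /G mul0r.
  have -> : eta z0 = G 1 - G 0.
    by rewrite G0 subr0 /G (_ : 1%:C = 1)// !mul1r addrC subrK.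
  apply: complex_FTC => //.
  - by move=> s /andP[s0 _]; exact: cD.
  - by move=> s /andP[s0 s1]; apply: qG; rewrite s0 ltW.
  - rewrite G0; apply: (@ccvg_nm0 _ _ _ _ _ (fun s => (M / nm (z0 - a%:C)) * Num.sqrt s)).
      near=> s; have s0 : 0 < s by near: s; exact: nbhs_right_gt.
      have s1 : s <= 1 by near: s; apply: nbhs_right_le.
      have sn0 : s != 0 by rewrite gt_eqF.
      rewrite GF0// FE ?nm0 ?(ltW e0)//.
      have s01 : 0 < s <= 1 by rewrite s0.
      have [|b _ _] := H s 0 s01; first by rewrite nm0 ltW.
      move: (regular_part z0 s 0) b => r b.
      rewrite !nmM nmV !nm_real (gtr0_norm s0) ger0_norm ?invsqrt_ge0//.
      have sE : s * invsqrt s = Num.sqrt s.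
        rewrite /invsqrt gtr0_norm// -{1}(sqr_sqrtr (ltW s0)) expr2 mulfK// gt_eqF//.
        by rewrite sqrtr_gt0.
      have -> : s / nm (z0 - a%:C) * (invsqrt s * nm r) =
          nm r / nm (z0 - a%:C) * Num.sqrt s by rewrite -sE; ring.
      by rewrite ler_wpM2r ?sqrtr_ge0// ler_wpM2r// invr_ge0 nm_ge0.
    rewrite -[X in _ --> X](mulr0 (M / nm (z0 - a%:C))); apply: cvgM; first exact: cvg_cst.
    have : Num.sqrt s @[s --> (0 : R)^'+] --> Num.sqrt (0 : R).
      by apply: cvg_at_right_filter; exact: sqrt_continuous.
    by rewrite sqrtr0.
  - have q1 : has_expansion G 1 (D 1) by apply: qG; rewrite ltr01 lexx.
    have [h1 h2] := expansion_ccvg q1.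
    split; apply: cvg_at_left_filter.
      exact: h1.
    exact: h2.
exists (2 * (M * \int[leb]_(s in `[0, 1]) invsqrt s)), e; split => // h he.
split; first exact: ih.
have z0e : nm (0 : R[i]) <= e by rewrite nm0 ltW.
rewrite gF// -{1}(addr0 z0) gF// -ID -CintZ//.
rewrite -CintB//; [|exact: iF|exact: iF].
rewrite -CintB//; last exact: cintegrableZ.
  pose g t := invsqrt t * (M * nm h ^+ 2).
  have ig : rintegrable `[0, 1] g.
    rewrite (_ : g = fun t => (M * nm h ^+ 2) * invsqrt t); last by apply/funext => t; rewrite /g mulrC.
    by apply: rintegrableZ => //; exact: invsqrt_integrable01.
  apply: le_trans (Cint_bound (g:=g) _ _ ig) _.
  - have mF h' : nm h' <= e -> cmeas `[0, 1] (F h').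
      move=> /ih/ltW i; apply: cmeasM; first exact: cmeas_cst.
      by apply: cmeas_segment => //; exact: itv01_ge0.
    have neg (f : R -> R[i]) : cmeas `[0, 1] f -> cmeas `[0, 1] (fun t => - f t).
      move=> mf; apply: (cmeas_ext (f:=fun t => (-1) * f t)); first by move=> t; rewrite mulN1r.
      by apply: cmeasM => //; exact: cmeas_cst.
    apply: cmeasD; last by apply: neg; apply: cmeasM => //; exact: cmeas_cst.
    by apply: cmeasD; [exact: mF|apply: neg; exact: mF].
  - move=> t /andP[t0 t1]; have [->|tn0] := eqVneq t 0.
      by rewrite !F0 D0 mulr0 !subr0 nm0 /g invsqrt0 mul0r.
    by rewrite /g bE// lt_def tn0 t0.
  - rewrite (_ : \int[leb]_(t in `[0, 1]) g t = (M * nm h ^+ 2) * \int[leb]_(t in `[0, 1]) invsqrt t).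
      by rewrite le_eqVlt; apply/orP; left; apply/eqP; ring.
    rewrite -RintegralZl//; last exact: invsqrt_integrable01.
    by apply: eq_Rintegral => t _; rewrite /g mulrC.
apply: cintegrableD => //; first exact: iF.
rewrite (_ : (fun t => _) = (fun t => (-1) * F 0 t)); last by apply/funext => t; rewrite mulN1r.
by apply: cintegrableZ => //; exact: iF.
Unshelve. all: by end_near. Qed.

(** * The Green function up to the real line *)

Lemma green_line z0 w t : 0 < Im (z0 + t%:C * w) ->
  has_expansion (fun t => green (z0 + t%:C * w)) t (w * eta (z0 + t%:C * w)).
Proof.
move=> /green_expansion [C [e [e0 H]]].
have w1 : 0 < nm w + 1 by rewrite ltr_wpDl ?nm_ge0.
exists (C * nm w ^+ 2), (e / (nm w + 1)); split; first by rewrite divr_gt0.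
move=> u; rewrite ltr_pdivlMr// => ue.
have he : nm (u%:C * w) <= e.
  rewrite nmM nm_real (le_trans _ (ltW ue))// ler_wpM2l// lerDl//.
have [_] := H _ he; rewrite nmM nm_real.
have -> : z0 + t%:C * w + u%:C * w = z0 + (t + u)%:C * w by rewrite rmorphD mulrDl addrA.
rewrite exprMn real_normK ?num_real//.
have -> : C * nm w ^+ 2 * u ^+ 2 = C * (u ^+ 2 * nm w ^+ 2) by ring.
by rewrite mulrA.
Qed.

Lemma green_lipschitz z0 : 0 < Im z0 -> exists C e, 0 < e /\ forall h, nm h <= e ->
  0 < Im (z0 + h) /\ nm (green (z0 + h) - green z0) <= C * nm h.
Proof.
move=> /green_expansion [C [e [e0 H]]].
exists (`|C| * e + nm (eta z0)), e; split => // h he; have [ih b] := H h he; split => //.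
have -> : green (z0 + h) - green z0 = (green (z0 + h) - green z0 - h * eta z0) + h * eta z0.
  by ring.
rewrite (le_trans (nmD _ _))// mulrDl nmM [nm h * _]mulrC lerD2r (le_trans b)//.
rewrite expr2 mulrA ler_wpM2r ?nm_ge0//.
apply: (@le_trans _ _ (`|C| * nm h)); first by rewrite ler_wpM2r ?nm_ge0 ?ler_norm.
by rewrite ler_wpM2l.
Qed.

(** A bound in s for the integrand of the Green function at x + i y, uniform in y. *)
Definition majorant x s : R :=
  \prod_(1 <= j < (2 * d).+1) invsqrt ((a - c j) + s * (if j == (2 * d)%N then 1 else x - a)).

Lemma majorant_integrable x : rintegrable `[0, 1] (majorant x).
Proof.
have aj j : (1 <= j < 2 * d)%N -> a - c j != 0.
  by move=> /andP[j1 jd]; rewrite subr_eq0 lt_eqF// oc.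
apply: invsqrt_prod_integrable; first exact: iota_uniq.
  move=> j; rewrite mem_index_iota ltnS => /andP[j1 jd].
  have [_|jn] := eqVneq j (2 * d)%N; first by rewrite oner_neq0 orbT.
  by rewrite aj// j1 ltn_neqAle jn.
have sep j : (1 <= j < 2 * d)%N -> jointly_bounded_below (fun t => a - c (2 * d)%N + t * 1)
    (fun t => a - c j + t * (x - a)).
  move=> hj; apply: jointly_bounded_below_affine; rewrite subrr mul0r mulr1 eq_sym.
  exact: aj.
move=> i j; rewrite !mem_index_iota !ltnS => /andP[i1 id] /andP[j1 jd] ij.
have [Ei|Ni] := eqVneq i (2 * d)%N.
  rewrite Ei in ij *; rewrite eq_sym (negbTE ij).
  by apply: sep; rewrite j1 ltn_neqAle eq_sym ij.
have [Ej|Nj] := eqVneq j (2 * d)%N.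
  have hi : (1 <= i < 2 * d)%N by rewrite i1 ltn_neqAle Ni.
  rewrite Ej; have [e e0 H] := sep i hi.
  by exists e => // t; rewrite orbC.
have [->|xa] := eqVneq x a.
  exists `|a - c i|; first by rewrite normr_gt0 aj// i1 ltn_neqAle Ni.
  by move=> t; rewrite subrr mulr0 addr0 lexx.
apply: jointly_bounded_below_affine; rewrite (inj_eq (mulIf _)) ?subr_eq0//.
rewrite (inj_eq (addrI _)) eqr_opp (endpoints_neq oc) ?i1 ?j1//.
Qed.

Lemma integrand_bound x y s (M : R) : 0 <= y -> 0 < s ->
  (forall j, (1 <= j < 2 * d)%N -> a - c j + s * (x - a) != 0) ->
  nm (pval k (a%:C + s%:C * (x +i* y - a%:C))) <= M ->
  nm ((x +i* y - a%:C) * eta (a%:C + s%:C * (x +i* y - a%:C))) <=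
  Num.sqrt (nm (x +i* y - a%:C)) * (M * majorant x s).
Proof.
move=> y0 s0 cn HM; set w := x +i* y - a%:C.
have Rw : Re w = x - a by [].
rewrite eta_pval mu_split// nmM nmM nmV nmM [a%:C + _ - a%:C]addrAC subrr add0r.
rewrite nm_sqrtc nmM nm_real gtr0_norm// sqrtrM ?(ltW s0)//.
rewrite nm_prod.
have -> : \prod_(1 <= j < (2 * d)%N) nm (sqrtc (a%:C + s%:C * w - (c j)%:C)) =
    \prod_(1 <= j < (2 * d)%N) Num.sqrt (nm (a%:C + s%:C * w - (c j)%:C)).
  by apply: eq_bigr => j _; rewrite nm_sqrtc.
have P0 : 0 <= \prod_(1 <= j < (2 * d)%N) invsqrt (a - c j + s * (x - a)).
  by apply: prodr_ge0 => j _; exact: invsqrt_ge0.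
have Q0 : (\prod_(1 <= j < (2 * d)%N) Num.sqrt (nm (a%:C + s%:C * w - (c j)%:C)))^-1 <=
    \prod_(1 <= j < (2 * d)%N) invsqrt (a - c j + s * (x - a)).
  rewrite -prodfV !big_nat; apply: ler_prod => j hj; rewrite invr_ge0 sqrtr_ge0/=.
  have := @invsqrt_nm_le R (a%:C + s%:C * w) (c j); rewrite cReD cReZ Rw /=.
  have -> : a + s * (x - a) - c j = a - c j + s * (x - a) by ring.
  apply; apply/eqP => E; have := cn j hj.
  by rewrite addrAC E subrr eqxx.
have ME : majorant x s =
    (\prod_(1 <= j < (2 * d)%N) invsqrt (a - c j + s * (x - a))) * invsqrt s.
  rewrite /majorant big_nat_recr//=; last by rewrite muln_gt0.
  rewrite eqxx subrr add0r mulr1; congr (_ * _).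
  rewrite !big_nat; apply: eq_bigr => j /andP[_ jd].
  by rewrite ltn_eqF.
have wE : nm w * (Num.sqrt (nm w))^-1 = Num.sqrt (nm w).
  have [->|wn] := eqVneq (nm w) 0; first by rewrite sqrtr0 mul0r.
  rewrite -{1}(sqr_sqrtr (nm_ge0 w)) expr2 mulfK// sqrtr_eq0 -ltNge lt_def wn nm_ge0//.
rewrite ME !invfM.
set P := \prod_(_ <= _ < _) _ in P0 Q0 *; set Q := (\prod_(_ <= _ < _) _)^-1 in Q0 *.
have sE : (Num.sqrt s)^-1 = invsqrt s by rewrite /invsqrt gtr0_norm.
rewrite sE.
have -> : nm w * (nm (pval k (a%:C + s%:C * w)) * (Q * (invsqrt s * (Num.sqrt (nm w))^-1))) =
   (nm w * (Num.sqrt (nm w))^-1) * (nm (pval k (a%:C + s%:C * w)) * (Q * invsqrt s)) by ring.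
have Qge0 : 0 <= Q.
  by rewrite invr_ge0; apply: prodr_ge0 => j _; exact: sqrtr_ge0.
rewrite wE ler_wpM2l ?sqrtr_ge0// ler_pM ?nm_ge0 ?mulr_ge0 ?invsqrt_ge0//.
by rewrite ler_wpM2r ?invsqrt_ge0.
Qed.

Lemma majorant_ge0 x s : 0 <= majorant x s.
Proof. by apply: prodr_ge0 => j _; exact: invsqrt_ge0. Qed.

Lemma ccvg_seq_axis x (u : nat -> R) : u @ \oo --> (0 : R) ->
  ccvg \oo (fun n => x +i* u n) x%:C.
Proof. by move=> u0; split => //=; exact: cvg_cst. Qed.

(** Dominated convergence: up to a constant the integrands are bounded by the majorant at x. *)
Lemma green_vertical_seq x (u : nat -> R) : (forall n, 0 < u n) -> u @ \oo --> (0 : R) ->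
  ccvg \oo (fun n => green (x +i* u n)) (green x%:C).
Proof.
move=> up u0.
have [U HU] : exists U, forall n, u n <= U.
  have [U [_ HU]] := cvg_seq_bounded (cvgP _ u0).
  exists (U + 1) => n; rewrite (le_trans (ler_norm _))//.
  by have := HU (U + 1) _ n I; apply; rewrite ltrDl.
have U0 : 0 <= U := le_trans (ltW (up 0%N)) (HU 0%N).
pose F n s := (x +i* u n - a%:C) * eta (a%:C + s%:C * (x +i* u n - a%:C)).
pose F0 s := (x%:C - a%:C) * eta (a%:C + s%:C * (x%:C - a%:C)).
have wU n : nm (x +i* u n - a%:C) <= `|x - a| + U.
  rewrite (le_trans (nm_ReIm _))//= lerD2l subr0 ger0_norm//; exact: ltW.
have [M M0 HM] := pval_bounded k (`|a| + (`|x - a| + U)).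
have HMn n s : 0 <= s <= 1 -> nm (pval k (a%:C + s%:C * (x +i* u n - a%:C))) <= M.
  move=> /andP[s0 s1]; apply: HM; rewrite (le_trans (nmD _ _))// nm_real lerD2l nmM nm_real.
  by rewrite ger0_norm// (le_trans _ (wU n))// ler_piMl ?nm_ge0.
(* The parameters at which the segment from a to x passes through an endpoint. *)
pose bad := 0 :: [seq (c j - a) / (x - a) | j <- index_iota 1 (2 * d)%N].
have notbad s : s \notin bad -> 0 <= s -> 0 < s /\
    forall j, (1 <= j < 2 * d)%N -> a - c j + s * (x - a) != 0.
  rewrite in_cons negb_or => /andP[s0 /mapP sb] s0'; split; first by rewrite lt_def s0.
  move=> j hj; have ac : a - c j != 0.
    by case/andP : hj => j1 jd; rewrite subr_eq0 lt_eqF// oc.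
  apply/eqP => E; apply: sb; exists j; first by rewrite mem_index_iota.
  have xa : x - a != 0 by apply: contra_neq ac => xa; move: E; rewrite xa mulr0 addr0.
  by apply: (mulIf xa); rewrite divfK//; move: E; lra.
have bnd n s : s \notin bad -> 0 <= s <= 1 ->
    nm (F n s) <= Num.sqrt (nm (x +i* u n - a%:C)) * (M * majorant x s).
  move=> /notbad nb /[dup] s01 /andP[s0 s1]; have [s0' cn] := nb s0.
  by apply: integrand_bound => //; [exact: ltW|exact: HMn].
have lim s : s \notin bad -> 0 <= s <= 1 -> ccvg \oo (fun n => F n s) (F0 s).
  move=> /[dup] nbs /notbad nb /[dup] s01 /andP[s0 s1]; have [s0' cn] := nb s0.
  have cw : ccvg \oo (fun n => x +i* u n - a%:C) (x%:C - a%:C).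
    by apply: ccvgD; [exact: ccvg_seq_axis|exact: ccvg_cst].
  have [xa|xa] := eqVneq x a.
    rewrite /F0 xa subrr mul0r.
    apply: (@ccvg_nm0 _ _ _ _ _ (fun n => Num.sqrt (nm (x +i* u n - a%:C)) * (M * majorant x s))).
      by apply: nearW => n; exact: bnd.
    rewrite -[X in _ --> X](mul0r (M * majorant x s)); apply: cvgM; last exact: cvg_cst.
    have -> : (0 : R) = Num.sqrt (nm (x%:C - a%:C)) by rewrite xa subrr nm0 sqrtr0.
    by apply: cvg_sqrt; exact: ccvg_nm.
  apply: ccvgM => //; apply: ccvg_eta.
  - by rewrite cImD cImZ cImD /= oppr0 !addr0 mulr0.
  - by apply: nearW => n; rewrite cImD cImZ cImD /= oppr0 addr0 add0r mulr_ge0// ltW.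
  - move=> j /andP[j1 jd]; apply/eqP => /(congr1 Re); rewrite cReD cReZ cReD /= => E.
    have [Ej|Nj] := eqVneq j (2 * d)%N.
      move: E; rewrite Ej => /eqP; rewrite -subr_eq0 addrAC subrr add0r.
      by rewrite mulf_eq0 (gt_eqF s0') subr_eq0 (negbTE xa).
    have := cn j _; rewrite j1 ltn_neqAle Nj jd => /(_ isT)/eqP; apply.
    by rewrite addrAC E subrr.
  - apply: ccvgD; first exact: ccvg_cst.
    by apply: ccvgM => //; exact: ccvg_cst.
pose g s := Num.sqrt (`|x - a| + U) * (M * majorant x s).
have aeF := ae_filter_ringOfSetsType (@lebesgue_measure R).
have mF z : 0 <= Im z -> cmeas `[0, 1] (fun s => (z - a%:C) * eta (a%:C + s%:C * (z - a%:C))).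
  move=> z0; apply: cmeasM; first exact: cmeas_cst.
  by apply: cmeas_segment => //; exact: itv01_ge0.
have := @Cint_dominated R 0 1 F F0 g _ _ _ _ _.
case.
- by move=> n; apply: mF; exact: (ltW (up n)).
- by apply: mF.
- apply: filterS (ae_notin bad) => s sb /=; rewrite in_itv/=; exact: lim.
- apply: filterS (ae_notin bad) => s sb n /=; rewrite in_itv/= => s01.
  apply: (le_trans (bnd n s sb s01)); rewrite ler_wpM2r ?ler_wsqrtr ?wU//.
  by rewrite mulr_ge0 ?majorant_ge0.
- by apply: rintegrableZ => //; apply: rintegrableZ => //; exact: majorant_integrable.
move=> iF0 cF.
have -> : green x%:C = Cint F0 0 1.
  have [xa|xa] := eqVneq x a.
    rewrite /Defs.green /F0 xa subrr mul0r (_ : (fun s => _) = fun=> 0); last first.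
      by apply/funext => s; rewrite mul0r.
    by rewrite /Cint /Rintegral !integral0.
  have xaC : x%:C - a%:C != 0 by rewrite -realCB -nm_eq0 nm_real normr_eq0 subr_eq0.
  rewrite /F0 CintZ//.
  have := cintegrableZ (x%:C - a%:C)^-1 (measurable_itv `[0, 1]) iF0.
  by rewrite (_ : (fun t => _) = fun s => eta (a%:C + s%:C * (x%:C - a%:C)))//;
    apply/funext => s; rewrite /F0 mulKf.
apply: ccvg_ext cF => n; rewrite green_Cint//; exact: up.
Qed.

Lemma green_vertical x : ccvg (0^'+) (fun y => green (x +i* y)) (green x%:C).
Proof.
by split; apply/cvg_at_rightP => u [u0 uc];
  have [] := green_vertical_seq x u0 uc.
Qed.

(** This holds on horizontal lines, whose height is then sent to 0. *)
Lemma green_increment p q : p <= q ->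
  green q%:C - green p%:C = Cint (fun x => eta x%:C) p q.
Proof.
rewrite le_eqVlt => /predU1P[->|pq].
  by rewrite subrr /Cint set_itv1 !Rintegral_set1.
pose u n : R := n.+1%:R^-1.
have up n : 0 < u n by rewrite invr_gt0.
have u0 : u @ \oo --> (0 : R) by exact: cvg_harmonic.
have E n t : (0 +i* u n) + t%:C * 1 = t +i* u n.
  by rewrite mulr1; apply: complexP; rewrite ?cReD ?cImD /= ?add0r ?addr0.
have ce n t : ccvg (nbhs t) (fun s => eta (s +i* u n)) (eta (t +i* u n)).
  apply: ccvg_eta => //=.
  - exact: ltW.
  - by apply: nearW => s; exact: ltW.
  - move=> j _; apply/eqP => /(congr1 Im) /= h.
    by have := up n; rewrite h ltxx.
  - by split; [exact: cvg_id|exact: cvg_cst].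
have ie n : cintegrable `[p, q] (fun t => eta (t +i* u n)).
  split; apply: continuous_compact_integrable; try exact: segment_compact.
    by apply: cont_within => t _; exact: (ce n t).1.
  by apply: cont_within => t _; exact: (ce n t).2.
have F n : green (q +i* u n) - green (p +i* u n) = Cint (fun t => eta (t +i* u n)) p q.
  have L t : has_expansion (fun t => green (t +i* u n)) t (eta (t +i* u n)).
    have := @green_line (0 +i* u n) 1 t; rewrite E /= mul1r => /(_ (up n)).
    by under eq_fun do rewrite E.
  rewrite (@complex_FTC R (fun t => green (t +i* u n)))//.
  - by have [h1 h2] := expansion_ccvg (L p); split; apply: cvg_at_right_filter;
      [exact: h1|exact: h2].
  - by have [h1 h2] := expansion_ccvg (L q); split; apply: cvg_at_left_filter;
      [exact: h1|exact: h2].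
have aeF := ae_filter_ringOfSetsType (@lebesgue_measure R).
have [M M0 HM] := pval_bounded k (`|p| + `|q| + 1).
have u1 n : u n <= 1 by rewrite invf_le1 ?ler1n.
have cl : ccvg \oo (fun n => Cint (fun t => eta (t +i* u n)) p q) (Cint (fun x => eta x%:C) p q).
  pose bad := [seq c j | j <- index_iota 1 (2 * d).+1].
  have nb t j : t \notin bad -> (1 <= j <= 2 * d)%N -> t != c j.
    move=> tb hj; apply: contraNneq tb => ->; apply/mapP; exists j => //.
    by rewrite mem_index_iota ltnS.
  apply: (@Cint_dominated R p q (fun n t => eta (t +i* u n)) (fun t => eta t%:C)
    (fun t => M * weight d c t) _ _ _ _ _).2.
  - move=> n; apply: cmeas_eta => /=; first by move=> *; exact: ltW.
    by split; [exact: measurable_id|exact: measurable_cst].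
  - by apply: cmeas_eta => //=; split; [exact: measurable_id|exact: measurable_cst].
  - apply: filterS (ae_notin bad) => t tb _; apply: ccvg_eta => //.
    + by apply: nearW => n /=; exact: ltW.
    + move=> j hj; apply/eqP => /(congr1 Re) /= h.
      by have := nb t j tb hj; rewrite h eqxx.
    + exact: ccvg_seq_axis.
  - apply: filterS (ae_notin bad) => t tb n /=; rewrite in_itv/= => /andP[pt tq].
    apply: (@nm_eta_le R d c k (t +i* u n)) => //; last by move=> j; exact: nb.
    apply: HM; rewrite (le_trans (nm_ReIm _))//= lerD//; last by rewrite gtr0_norm ?up ?u1.
    have := ler_norm q; have := ler_norm (- p); rewrite normrN => *.
    by rewrite ler_norml; apply/andP; split; have := normr_ge0 p; have := normr_ge0 q; lra.
  - by apply: rintegrableZ => //; exact: weight_integrable.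
have cr : ccvg \oo (fun n => Cint (fun t => eta (t +i* u n)) p q) (green q%:C - green p%:C).
  apply: (ccvg_ext (f:=fun n => green (q +i* u n) + (-1) * green (p +i* u n))).
    by move=> n; rewrite -F mulN1r.
  rewrite -(mulN1r (green p%:C)); apply: ccvgD; first exact: green_vertical_seq.
  by apply: ccvgM; [exact: ccvg_cst|exact: green_vertical_seq].
apply: complexP.
  exact: (cvg_unique _ cr.1 cl.1).
exact: (cvg_unique _ cr.2 cl.2).
Qed.

(** * Monotonicity of theta in the upper half-plane *)

Lemma eta_decay (e : R) : 0 < e -> exists2 M, 0 < M & forall z,
  0 < Im z -> M < nm z -> nm (eta z - z^-1) <= e / nm z.
Proof.
move=> e0; have [_ /(_ e e0)[M HM] _] := tk.
exists (`|M| + 1); first by rewrite ltr_wpDl.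
move=> z z0 Mz; have nz : 0 < nm z by rewrite (le_lt_trans _ Mz)// addr_ge0.
have zn : z != 0 by rewrite -nm_gt0.
have := HM z z0; rewrite (lt_trans _ Mz) ?(le_lt_trans (ler_norm M)) ?ltrDl// => /(_ isT) h.
rewrite ler_pdivlMr// mulrC -nmM mulrBr divff// ltW//.
Qed.

(** On the imaginary axis eta is close to 1 / z, which fixes the sign of its imaginary part. *)
Lemma lead_coef_gt0 : 0 < lead_coef k.
Proof.
have l0 : lead_coef k != 0.
  by rewrite lead_coef_eq0 -size_poly_eq0; have [-> _ _] := tk; rewrite -lt0n.
have [_ /(_ 1 ltr01)[M HM] _] := tk.
pose y := `|M| + 1; have y0 : 0 < y by rewrite ltr_wpDl.
have := HM (0 +i* y) y0; rewrite /= expr0n add0r sqrtr_sqr gtr0_norm//.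
have -> : (M < y) by rewrite (le_lt_trans (ler_norm M))// ltrDl.
move=> /(_ isT) h.
have Iy : 0 < Im (0 +i* y) by [].
have := sg_eta_upper d1 oc gx kE Iy l0.
have : Im (eta (0 +i* y)) < 0.
  have := le_lt_trans (Re_nm _) h; rewrite cReD cReN cReM /= mul0r sub0r => h'.
  rewrite ltNge; apply/negP => I0.
  have : 1 <= `| - (y * Im (eta (0 +i* y))) - 1|.
    rewrite -opprD normrN ger0_norm ?addr_ge0 ?mulr_ge0 ?(ltW y0)//.
    by rewrite lerDr mulr_ge0// ltW.
  by rewrite leNgt h'.
move: l0; rewrite neq_lt => /orP[l0|//] Iy0.
by rewrite (ltr0_sg l0) mulN1r oppr_lt0 => /(lt_trans Iy0); rewrite ltxx.
Qed.

Lemma eta_upper z : 0 < Im z -> Im (eta z) < 0.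
Proof.
move=> z0; have l0 := lead_coef_gt0.
have := sg_eta_upper d1 oc gx kE z0 (lt0r_neq0 l0).
by rewrite gtr0_sg// mul1r.
Qed.

Lemma thetaE z : theta z = ('i%C * (pi^-1)%:C) * green z.
Proof. by rewrite /Defs.theta fmorphV. Qed.

Lemma Re_theta z : Re (theta z) = - (Im (green z) / pi).
Proof. by rewrite thetaE cReM !cReM !cImM /=; ring. Qed.

Lemma Im_theta z : Im (theta z) = Re (green z) / pi.
Proof. by rewrite thetaE cImM !cReM !cImM /=; ring. Qed.

Lemma upper_segment z w t : 0 < Im z -> 0 < Im w -> 0 <= t <= 1 ->
  0 < Im (z + t%:C * (w - z)).
Proof.
move=> z0 w0 /andP[t0 t1]; rewrite cImD cImZ cImD cImN.
have -> : Im z + t * (Im w - Im z) = (1 - t) * Im z + t * Im w by ring.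
have [->|tn] := eqVneq t 0; first by rewrite subr0 mul1r mul0r addr0.
by rewrite ltr_wpDl ?mulr_gt0 ?mulr_ge0 ?subr_ge0 ?(ltW z0)// lt_def tn.
Qed.

Lemma Re_rot z w : Re ('i%C * (pi^-1)%:C * conjc z * (z * w)) =
  - (pi^-1 * nm z ^+ 2 * Im w).
Proof. by rewrite nm_sqr; case: z => x y; case: w => p q; rewrite !(cReM, cImM) /=; ring. Qed.

(** The derivative (i / pi) eta of theta has a positive real part, and so has its mean along
the segment from z to w. *)
Lemma theta_monotone z w : 0 < Im z -> 0 < Im w -> z != w ->
  0 < (Re w - Re z) * (Re (theta w) - Re (theta z)) +
      (Im w - Im z) * (Im (theta w) - Im (theta z)).
Proof.
move=> z0 w0 zw; pose D := w - z; have D0 : D != 0 by rewrite subr_eq0 eq_sym.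
pose f t := ('i%C * (pi^-1)%:C * conjc D) * green (z + t%:C * D).
have df t : 0 <= t <= 1 ->
    is_derive t 1 (Re \o f) (- (pi^-1 * nm D ^+ 2 * Im (eta (z + t%:C * D)))).
  move=> t01; have i := upper_segment z0 w0 t01.
  have := expansion_Re (expansionZ ('i%C * (pi^-1)%:C * conjc D) (green_line i)).
  congr (is_derive _ _ _ _).
  by rewrite Re_rot.
have [t /andP[/ltW t0 /ltW t1]] := mean_value ltr01 df.
have -> : (Re \o f) 1 - (Re \o f) 0 =
   (Re w - Re z) * (Re (theta w) - Re (theta z)) + (Im w - Im z) * (Im (theta w) - Im (theta z)).
  rewrite /f /= (_ : 1%:C = 1)// mul1r (_ : 0%:C = 0)// mul0r addr0 [z + D]addrC subrK.
  rewrite !Re_theta !Im_theta /D; move: (green w) (green z) => [g1 g2] [g3 g4].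
  by case: (z) => z1 z2; case: (w) => w1 w2; rewrite !(cReM, cImM) /=; ring.
move=> ->; rewrite subr0 mulr1 oppr_gt0 pmulr_rlt0.
  by apply: eta_upper; apply: upper_segment => //; rewrite t0.
by rewrite mulr_gt0 ?invr_gt0 ?pi_gt0// exprn_gt0// nm_gt0.
Qed.

Lemma theta_inj z w : 0 < Im z -> 0 < Im w -> theta z = theta w -> z = w.
Proof.
move=> z0 w0 E; apply/eqP; apply/negP => /negP /(theta_monotone z0 w0).
by rewrite E !subrr !mulr0 addr0 ltxx.
Qed.

(** As eta is asymptotic to 1 / z, its modulus is at most 2 / |x| above x. *)
Lemma vertical_variation : exists2 M, 0 < M & forall x y, M < `|x| -> 0 < y ->
  `|Im (green (x +i* y)) - Im (green x%:C)| <= 2 / `|x| * y.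
Proof.
have [M M0 HM] := eta_decay ltr01; exists M => // x y Mx y0.
have x0 : 0 < `|x| := lt_trans M0 Mx.
have b t : 0 < t -> nm (eta (x +i* t)) <= 2 / `|x|.
  move=> t0; have xn : `|x| <= nm (x +i* t) := Re_nm (x +i* t).
  have n0 := lt_le_trans x0 xn.
  have := HM (x +i* t) t0 (lt_le_trans Mx xn).
  have := nmD (eta (x +i* t) - (x +i* t)^-1) (x +i* t)^-1; rewrite subrK nmV.
  have : (nm (x +i* t))^-1 <= `|x|^-1 by rewrite lef_pV2 ?posrE.
  by rewrite !mul1r; set u := (_ ^-1); lra.
have st y' : 0 < y' -> y' <= y ->
    `|Im (green (x +i* y)) - Im (green (x +i* y'))| <= 2 / `|x| * (y - y').
  move=> y'0 y'y.
  have E t : x%:C + t%:C * 'i%C = x +i* t.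
    by apply: complexP; rewrite ?cReD ?cImD ?cReM ?cImM /=; ring.
  apply: (@mean_value_le _ (fun t => Im (green (x +i* t))) (fun t => Im ('i%C * eta (x +i* t)))) => //.
    move=> t /andP[t0 _]; have it : 0 < Im (x%:C + t%:C * 'i%C).
      by rewrite E /= (lt_le_trans y'0).
    have := expansion_Im (green_line it); rewrite E.
    have <- : Im \o (fun s => green (x%:C + s%:C * 'i%C)) = (fun s => Im (green (x +i* s))).
      by apply/funext => s; rewrite -[RHS]/(Im (green (x +i* s))) -(E s).
    by [].
  move=> t /andP[t0 _]; rewrite (le_trans (Im_nm _))// nmM.
  by rewrite nm_i mul1r b// (lt_trans y'0).
have cv : `|Im (green (x +i* y)) - Im (green (x +i* y'))| @[y' --> 0^'+] -->
    `|Im (green (x +i* y)) - Im (green x%:C)|.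
  apply: cvg_norm; apply: cvgB; first exact: cvg_cst.
  exact: (green_vertical x).2.
apply: (cvg_le cv); near=> y'.
have y'0 : 0 < y' by near: y'; exact: nbhs_right_gt.
have y'y : y' <= y by near: y'; exact: nbhs_right_le.
rewrite (le_trans (st y' y'0 y'y))// ler_wpM2l ?divr_ge0//.
by rewrite lerBlDr lerDl ltW.
Unshelve. all: by end_near. Qed.

(** * Boundary values of theta *)

Lemma green_base : green a%:C = 0.
Proof. by rewrite /Defs.green subrr mul0r. Qed.

(** Boundary values of theta from above. *)
Definition bdRe x : R := Re (theta x%:C).
Definition bdIm x : R := Im (theta x%:C).

Lemma bdReE x : bdRe x = - (Im (green x%:C) / pi).
Proof. exact: Re_theta. Qed.

Lemma bdImE x : bdIm x = Re (green x%:C) / pi.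
Proof. exact: Im_theta. Qed.

Lemma flux_integrable p q : rintegrable `[p, q] (fun x => - Im (eta x%:C)).
Proof.
have := rintegrableZ (-1) (measurable_itv `[p, q]) (cintegrable_eta k oc p q).2.
by rewrite (_ : (fun t => _) = fun x => - Im (eta x%:C))//; apply/funext => x; rewrite mulN1r.
Qed.

Lemma Rintegral_cc_oo (f : R -> R) p q : rintegrable `[p, q] f ->
  \int[leb]_(x in `[p, q]) f x = \int[leb]_(x in `]p, q[) f x.
Proof.
move=> fi; rewrite -Rintegral_itv_obnd_cbnd; last first.
  by apply: rintegrableS fi => //; exact: subset_itv_oc_cc.
rewrite -Rintegral_itv_bndo_bndc//.
by apply: rintegrableS fi => //; exact: subset_itv_oo_cc.
Qed.

Lemma bdRe_increment p q : p <= q ->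
  bdRe q - bdRe p = pi^-1 * \int[leb]_(x in `[p, q]) - Im (eta x%:C).
Proof.
move=> pq; have := congr1 Im (green_increment pq).
rewrite cImD cImN -[RHS]/(\int[leb]_(x in `[p, q]) Im (eta x%:C)) => E.
have -> : \int[leb]_(x in `[p, q]) - Im (eta x%:C) = - \int[leb]_(x in `[p, q]) Im (eta x%:C).
  rewrite -mulN1r -RintegralZl//; last exact: (cintegrable_eta k oc p q).2.
  by apply: eq_Rintegral => x _; rewrite mulN1r.
rewrite -E (bdReE q) (bdReE p); generalize (Im (green q%:C)) (Im (green p%:C)) => u v.
by ring.
Qed.

Lemma bdIm_increment p q : p <= q ->
  bdIm q - bdIm p = pi^-1 * \int[leb]_(x in `[p, q]) Re (eta x%:C).
Proof.
move=> pq; have := congr1 Re (green_increment pq).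
rewrite cReD cReN -[RHS]/(\int[leb]_(x in `[p, q]) Re (eta x%:C)) => E.
rewrite -E (bdImE q) (bdImE p); generalize (Re (green q%:C)) (Re (green p%:C)) => u v.
by ring.
Qed.

Lemma Re_integral0 p q : (forall x, p < x < q -> Re (eta x%:C) = 0) ->
  \int[leb]_(x in `[p, q]) Re (eta x%:C) = 0.
Proof.
move=> H; rewrite Rintegral_cc_oo; last exact: (cintegrable_eta k oc p q).1.
rewrite -[RHS](Rintegral_set0 leb (fun=> 0)) (@eq_Rintegral _ _ _ leb _ (fun=> 0)).
  by rewrite /Rintegral !integral0.
by move=> x; rewrite inE /= in_itv/=; exact: H.
Qed.

Lemma Im_integral0 p q : (forall x, p < x < q -> Im (eta x%:C) = 0) ->
  \int[leb]_(x in `[p, q]) - Im (eta x%:C) = 0.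
Proof.
move=> H; rewrite Rintegral_cc_oo; last exact: flux_integrable.
rewrite (@eq_Rintegral _ _ _ leb _ (fun=> 0)); first by rewrite /Rintegral integral0.
by move=> x; rewrite inE /= in_itv/= => /H ->; rewrite oppr0.
Qed.

Local Notation amp x := (lead_coef k * modulus d c xr x%:C).

Lemma amp_gt0 x : (forall m, (1 <= m < d)%N -> x != xr m) ->
  (forall j, (1 <= j <= 2 * d)%N -> x != c j) -> 0 < amp x.
Proof.
move=> xx xc; rewrite mulr_gt0 ?lead_coef_gt0//.
by apply: modulus_gt0 => [m /xx|m /xc]; apply: contra_neq => /(congr1 Re).
Qed.

Lemma eta_real x : eta x%:C = (amp x)%:C * cis (phase d c xr x%:C).
Proof. by rewrite (eta_polar c kE). Qed.

Lemma eta_band m x : (1 <= m <= d)%N -> c (2 * m)%N < x < c (2 * m).-1%N ->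
  Re (eta x%:C) = 0 /\ Im (eta x%:C) = - amp x.
Proof.
move=> md xm; rewrite eta_real (phase_band d1 oc gx md xm) cis_half.
by rewrite cReZ cImZ /=; split; ring.
Qed.

Lemma eta_gapL m x : (1 <= m < d)%N -> c (2 * m).+1 < x < xr m ->
  Re (eta x%:C) = amp x /\ Im (eta x%:C) = 0.
Proof.
move=> /andP[m1 md] /andP[x1 x2]; have /andP[_ h] := gx m1 md.
rewrite eta_real (phase_gap d1 oc gx m1 md); last by rewrite x1 (lt_trans x2).
by rewrite arg_left// subrr cis0 mulr1.
Qed.

Lemma eta_gapR m x : (1 <= m < d)%N -> xr m < x < c (2 * m)%N ->
  Re (eta x%:C) = - amp x /\ Im (eta x%:C) = 0.
Proof.
move=> /andP[m1 md] /andP[x1 x2]; have /andP[h _] := gx m1 md.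
rewrite eta_real (phase_gap d1 oc gx m1 md); last by rewrite x2 (lt_trans _ x1).
by rewrite arg_right// sub0r cis_pi cReZ cImZ /= oppr0 mulr0 mulrN1.
Qed.

Lemma eta_zero m : (1 <= m < d)%N -> eta (xr m)%:C = 0.
Proof.
move=> md; rewrite eta_pval (pval_prod kE) (bigD1_seq m) ?iota_uniq ?mem_index_iota//=.
by rewrite subrr mul0r mulr0 mul0r.
Qed.

Lemma not_endpoint_band m x j : (1 <= m <= d)%N -> c (2 * m)%N < x < c (2 * m).-1%N ->
  (1 <= j <= 2 * d)%N -> x != c j.
Proof.
move=> /andP[m1 md] /andP[x1 x2] /andP[j1 jd].
have [h|h] := leqP (2 * m) j.
  by rewrite gt_eqF// (le_lt_trans _ x1)// (endpoints_le oc)//; lia.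
by rewrite lt_eqF// (lt_le_trans x2)// (endpoints_le oc)//; lia.
Qed.

Lemma not_endpoint_gap m x j : (1 <= m < d)%N -> c (2 * m).+1 < x < c (2 * m)%N ->
  (1 <= j <= 2 * d)%N -> x != c j.
Proof.
move=> /andP[m1 md] /andP[x1 x2] /andP[j1 jd].
have [h|h] := leqP (2 * m).+1 j.
  by rewrite gt_eqF// (le_lt_trans _ x1)// (endpoints_le oc)//; lia.
by rewrite lt_eqF// (lt_le_trans x2)// (endpoints_le oc)//; lia.
Qed.

Lemma not_zero_band m x i : (1 <= m <= d)%N -> c (2 * m)%N < x < c (2 * m).-1%N ->
  (1 <= i < d)%N -> x != xr i.
Proof.
move=> /andP[m1 md] /andP[x1 x2] /andP[i1 id]; have /andP[g1 g2] := gx i1 id.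
have [h|h] := leqP m i.
  rewrite gt_eqF// (lt_trans g2)// (le_lt_trans _ x1)// (endpoints_le oc)//; lia.
rewrite lt_eqF// (lt_trans _ g1)// (lt_le_trans x2)// (endpoints_le oc)//; lia.
Qed.

Lemma not_zero_gap m x i : (1 <= m < d)%N -> c (2 * m).+1 < x < c (2 * m)%N ->
  x != xr m -> (1 <= i < d)%N -> x != xr i.
Proof.
move=> /andP[m1 md] /andP[x1 x2] xm /andP[i1 id]; have /andP[g1 g2] := gx i1 id.
have [h|h|<-//] := ltngtP m i.
  rewrite gt_eqF// (lt_trans g2)// (le_lt_trans _ x1)// (endpoints_le oc)//; lia.
rewrite lt_eqF// (lt_trans _ g1)// (lt_le_trans x2)// (endpoints_le oc)//; lia.
Qed.

Lemma amp_band m x : (1 <= m <= d)%N -> c (2 * m)%N < x < c (2 * m).-1%N -> 0 < amp x.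
Proof.
move=> md xm; apply: amp_gt0 => [i|j]; first exact: not_zero_band md xm.
exact: not_endpoint_band md xm.
Qed.

Lemma amp_gap m x : (1 <= m < d)%N -> c (2 * m).+1 < x < c (2 * m)%N -> x != xr m ->
  0 < amp x.
Proof.
move=> md xm xx; apply: amp_gt0 => [i|j]; first exact: not_zero_gap md xm xx.
exact: not_endpoint_gap md xm.
Qed.

Lemma bdRe_band_lt m p q : (1 <= m <= d)%N -> c (2 * m)%N <= p -> p < q ->
  q <= c (2 * m).-1%N -> bdRe p < bdRe q.
Proof.
move=> md p1 pq q1; rewrite -subr_gt0 bdRe_increment ?ltW// mulr_gt0 ?invr_gt0 ?pi_gt0//.
apply: Rintegral_gt0 => //; first exact: flux_integrable.
move=> x /andP[px xq].
have xm : c (2 * m)%N < x < c (2 * m).-1%N by rewrite (le_lt_trans p1) ?(lt_le_trans xq).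
by have [_ ->] := eta_band md xm; rewrite opprK (amp_band md xm).
Qed.

Lemma bdIm_band m p q : (1 <= m <= d)%N -> c (2 * m)%N <= p -> p <= q ->
  q <= c (2 * m).-1%N -> bdIm p = bdIm q.
Proof.
move=> md p1 pq q1; apply/eqP; rewrite eq_sym -subr_eq0 bdIm_increment// Re_integral0 ?mulr0//.
move=> x /andP[px xq].
have xm : c (2 * m)%N < x < c (2 * m).-1%N by rewrite (le_lt_trans p1) ?(lt_le_trans xq).
by have [-> _] := eta_band md xm.
Qed.

Lemma bdRe_gap m p q : (1 <= m < d)%N -> c (2 * m).+1 <= p -> p <= q ->
  q <= c (2 * m)%N -> bdRe p = bdRe q.
Proof.
move=> md p1 pq q1; apply/eqP; rewrite eq_sym -subr_eq0 bdRe_increment// Im_integral0 ?mulr0//.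
move=> x /andP[px xq].
have /andP[xm1 xm2] : c (2 * m).+1 < x < c (2 * m)%N.
  by rewrite (le_lt_trans p1) ?(lt_le_trans xq).
have [h|h|->] := ltgtP x (xr m).
- by have [|_ ->] := eta_gapL (m := m) (x := x) md; rewrite ?xm1.
- by have [|_ ->] := eta_gapR (m := m) (x := x) md; rewrite ?xm2 ?h.
- by rewrite eta_zero.
Qed.

Lemma bdIm_gapR m p q : (1 <= m < d)%N -> xr m <= p -> p < q -> q <= c (2 * m)%N ->
  bdIm q < bdIm p.
Proof.
move=> md p1 pq q1; rewrite -subr_gt0 -opprB oppr_gt0 bdIm_increment ?ltW//.
rewrite pmulr_rlt0 ?invr_gt0 ?pi_gt0// -oppr_gt0 -mulN1r -RintegralZl//; last first.
  exact: (cintegrable_eta k oc p q).1.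
apply: Rintegral_gt0 => //.
  by apply: rintegrableZ => //; exact: (cintegrable_eta k oc p q).1.
move=> x /andP[px xq].
have x1 := le_lt_trans p1 px; have x2 := lt_le_trans xq q1.
have x12 : xr m < x < c (2 * m)%N by rewrite x1.
have /andP[m1 m2] := md; have /andP[g1 _] := gx m1 m2.
have [-> _] := eta_gapR md x12.
by rewrite mulN1r opprK (amp_gap md)// ?gt_eqF// x2 andbT (lt_trans g1).
Qed.

Lemma bdRe_left x : x <= a -> bdRe x = 0.
Proof.
move=> xa; have ba : bdRe a = 0.
  by rewrite bdReE green_base mul0r oppr0.
rewrite -[RHS]ba; apply/eqP; rewrite eq_sym -subr_eq0 bdRe_increment// Im_integral0 ?mulr0//.
move=> y /andP[_ ya]; rewrite eta_real (phase_left d1 oc gx ya) cis_pi.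
by rewrite cImZ /= oppr0 mulr0.
Qed.

Lemma bdRe_right x : c 1%N <= x -> bdRe x = bdRe (c 1%N).
Proof.
move=> xc; apply/eqP; rewrite -subr_eq0 bdRe_increment// Im_integral0 ?mulr0//.
move=> y /andP[ya _]; rewrite eta_real (phase_right d1 oc gx ya) cis0.
by rewrite cImZ /= mulr0.
Qed.

(** On a band eta lies on the negative imaginary axis, so that |eta| = - Im eta is pi times
the derivative of Re theta. *)
Lemma harmonic_measureE m : (1 <= m <= d)%N -> hm m = bdRe (c (2 * m).-1%N) - bdRe (c (2 * m)%N).
Proof.
move=> /[dup] md /andP[m1 m2].
have cc : c (2 * m)%N < c (2 * m).-1%N by apply: oc; lia.
have ni : rintegrable `[c (2 * m)%N, c (2 * m).-1%N] (fun x => nm (eta x%:C)).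
  have [i1 i2] := cintegrable_eta k oc (c (2 * m)%N) (c (2 * m).-1%N).
  have ir (f : R -> R) p q : rintegrable `[p, q] f -> rintegrable `[p, q] (fun x => `|f x|).
    by move=> fi; exact: (integrable_norm fi).
  apply: (@rintegrable_le _ _ _ (fun x => `|Re (eta x%:C)| + `|Im (eta x%:C)|)) => //.
  - apply: cmeas_nm; apply: cmeas_eta => //=.
    by split; [exact: measurable_id|exact: measurable_cst].
  - by move=> x _; rewrite ger0_norm ?nm_ge0 ?nm_ReIm.
  - by apply: rintegrableD => //; apply: ir.
rewrite bdRe_increment ?ltW// /harmonic_measure; congr (_ * _).
rewrite !Rintegral_cc_oo//; last first.
  exact: flux_integrable.
apply: eq_Rintegral => x; rewrite inE /= in_itv/= => xm.
have [e1 e2] := eta_band md xm.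
rewrite -[LHS]/(nm (eta x%:C)) e2 opprK eta_real nmM nm_cis mulr1 nm_real gtr0_norm//.
exact: amp_band xm.
Qed.

(** From the base point on, Re theta gains the harmonic measure of every band and nothing in
the gaps. *)
Lemma bdRe_sum n : (n < d)%N -> bdRe (c (2 * (d - n))%N) = \sum_(d.+1 - n <= m < d.+1) hm m.
Proof.
elim: n => [|n ih] nd; first by rewrite !subn0 big_geq// bdRe_left.
have nd' := ltnW nd; have m1 : (1 <= d - n.+1 < d)%N by lia.
have -> : bdRe (c (2 * (d - n.+1))%N) = bdRe (c (2 * (d - n)).-1%N).
  have E : ((2 * (d - n)).-1 = (2 * (d - n.+1)).+1)%N by lia.
  rewrite E; apply/esym; apply: (bdRe_gap m1) => //; apply: ltW; apply: oc; lia.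
have E1 : (d.+1 - n.+1 = d - n)%N by lia.
have E2 : (d.+1 - n = (d - n).+1)%N by lia.
rewrite E1 big_ltn; last by lia.
by rewrite -E2 -ih// harmonic_measureE ?subrK//; lia.
Qed.

(** The slit with index j belongs to the gap with index d - j, on which Re theta is constant. *)
Lemma frequencyE j : (1 <= j < d)%N -> frequency d c k j = bdRe (xr (d - j)).
Proof.
move=> /andP[j1 jd]; apply: etrans (esym (bdRe_sum jd)) _.
have m1 : (1 <= d - j < d)%N by lia.
have /andP[m2 m3] := m1; have /andP[g1 g2] := gx m2 m3.
by apply/esym; apply: (bdRe_gap m1) => //; exact: ltW.
Qed.

(** The integrals of eta over the gaps vanish, and Re eta vanishes on the bands. *)
Lemma bdIm_endpoint n : (n < d)%N ->
  bdIm (c (2 * (d - n))%N) = 0 /\ bdIm (c (2 * (d - n)).-1%N) = 0.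
Proof.
have band m : (1 <= m <= d)%N -> bdIm (c (2 * m)%N) = bdIm (c (2 * m).-1%N).
  by move=> md; apply: (bdIm_band md) => //; apply: ltW; apply: oc; lia.
have gap m : (1 <= m)%N -> (m < d)%N -> bdIm (c (2 * m).+1) = bdIm (c (2 * m)%N).
  move=> m1 md; apply/eqP; rewrite eq_sym -subr_eq0 bdIm_increment; last first.
    by apply: ltW; exact: (gap_lt oc).
  have [_ _ /(_ m m1 md)/(congr1 Re)/= ->] := tk.
  by rewrite mulr0.
elim: n => [|n ih] nd.
  rewrite subn0 -band ?d1 ?leqnn//.
  by rewrite bdImE green_base mul0r.
have [_ h] := ih (ltnW nd).
have E : bdIm (c (2 * (d - n.+1))%N) = 0.
  rewrite -gap; try lia.
  by have -> : ((2 * (d - n.+1)).+1 = (2 * (d - n)).-1)%N by lia.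
by rewrite -band ?E//; lia.
Qed.

Lemma bdIm_even m : (1 <= m <= d)%N -> bdIm (c (2 * m)%N) = 0.
Proof.
move=> /andP[m1 md]; have [|h _] := @bdIm_endpoint (d - m) _; first by lia.
by rewrite -[m](subKn md).
Qed.

Lemma bdIm_in_band m x : (1 <= m <= d)%N -> c (2 * m)%N <= x <= c (2 * m).-1%N -> bdIm x = 0.
Proof. by move=> md /andP[x1 x2]; rewrite -(bdIm_even md); apply/esym; exact: (bdIm_band md). Qed.

(** From the zero of eta to the right end of the gap, Im theta decreases to 0. *)
Lemma bdIm_critical_gt0 m : (1 <= m < d)%N -> 0 < bdIm (xr m).
Proof.
move=> /[dup] md /andP[m1 m2]; have /andP[g1 g2] := gx m1 m2.
rewrite -(bdIm_even (m:=m)); last by rewrite m1 ltnW.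
by apply: (bdIm_gapR md).
Qed.

Lemma locate x : a <= x < c 1%N ->
  (exists2 m, (1 <= m <= d)%N & c (2 * m)%N <= x < c (2 * m).-1%N) \/
  (exists2 m, (1 <= m < d)%N & c (2 * m).+1 <= x < c (2 * m)%N).
Proof.
move=> /andP[ax xc].
have [j [j1 jd jx]] : exists j, [/\ (1 <= j)%N, (j < 2 * d)%N & c j.+1 <= x < c j].
  have : forall n, (n < 2 * d)%N -> c n.+1 <= x ->
      exists j, [/\ (1 <= j)%N, (j < 2 * d)%N & c j.+1 <= x < c j].
    elim=> [|n ih] nd nx; first by move: xc; rewrite ltNge nx.
    have [h|h] := leP (c n.+1) x; first by apply: ih => //; exact: ltnW.
    by exists n.+1; rewrite nx h.
  have d2 : (0 < 2 * d)%N by lia.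
  by move=> /(_ (2 * d).-1); rewrite prednK//; apply.
have jE := odd_double_half j; rewrite -mul2n in jE.
case: (boolP (odd j)) => oj; rewrite ?oj ?(negbTE oj) ?add1n ?add0n in jE.
  left; exists (j./2).+1; first by lia.
  have -> : (2 * (j./2).+1 = j.+1)%N by lia.
  by rewrite /=.
by right; exists j./2; [lia|rewrite jE].
Qed.

(** * The width of the image of theta *)

Lemma horizontal_expansion y t : 0 < y ->
  has_expansion (fun x => green (x +i* y)) t (eta (t +i* y)).
Proof.
move=> y0; have E s : (0 +i* y) + s%:C * 1 = s +i* y.
  by rewrite mulr1; apply: complexP; rewrite ?cReD ?cImD /= ?add0r ?addr0.
have i : 0 < Im ((0 +i* y) + t%:C * 1) by rewrite E.
have := green_line i; rewrite E mul1r; apply: eq_expansion => s.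
by rewrite E.
Qed.

Lemma vertical_expansion x t : 0 < t ->
  has_expansion (fun y => green (x +i* y)) t ('i%C * eta (x +i* t)).
Proof.
move=> t0; have E s : x%:C + s%:C * 'i%C = x +i* s.
  by apply: complexP; rewrite ?cReD ?cImD ?cReM ?cImM /=; ring.
have i : 0 < Im (x%:C + t%:C * 'i%C) by rewrite E.
have := green_line i; rewrite E; apply: eq_expansion => s.
by rewrite E.
Qed.

(** On a horizontal line far from the origin eta is close to 1 / z, whose imaginary part
integrates to an arctangent; descending to the real line at the two ends costs little. *)
Lemma arctan_comparison (N : R) : 1 <= N ->
  `|2 * atan N - pi * bdRe (c 1%N)| <= 6 / N.
Proof.
move=> N1; have N0 : 0 < N by exact: lt_le_trans N1.
have e0 : 0 < N ^- 2 by rewrite invr_gt0 exprn_gt0.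
have [Me Me0 He] := eta_decay e0.
have [Mv Mv0 Hv] := vertical_variation.
(* At distance r both asymptotic estimates hold, and all endpoints lie in [-r, r]. *)
pose r := Me + Mv + `|c 1%N| + `|a| + 1.
have n1 := normr_ge0 (c 1%N); have n2 := normr_ge0 a.
have rMe : Me < r by rewrite /r; lra.
have rMv : Mv < r by rewrite /r; lra.
have rc : c 1%N <= r by have := ler_norm (c 1%N); rewrite /r; lra.
have ra : - r <= a by have := ler_norm (- a); rewrite normrN /r; lra.
have r0 : 0 < r := lt_trans Me0 rMe.
have Nr : r <= N * r by rewrite ler_peMl// ltW.
have Nra : - (N * r) <= a by lra.
have Nr0 : 0 < N * r by rewrite mulr_gt0.
have rn : r != 0 by rewrite gt_eqF.
pose f x := Im (green (x +i* r)) + atan (x / r).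
have df t : - (N * r) <= t <= N * r ->
    is_derive t 1 f (Im (eta (t +i* r)) + (1 + (t / r) ^+ 2)^-1 * r^-1).
  move=> _; apply: is_deriveD; first exact: (expansion_Im (horizontal_expansion t r0)).
  apply: is_derive1_comp.
  apply: (@quad_derive _ _ _ _ 0 1) => // u _.
  by rewrite mul0r mulrDl [t / r + _]addrC addrK subrr normr0.
have b1 : `|f (N * r) - f (- (N * r))| <= N ^- 2 / r * (N * r - - (N * r)).
  apply: (mean_value_le _ df); first by lra.
  move=> t _; have nr : r <= nm (t +i* r).
    by rewrite (le_trans _ (Im_nm _))//= ler_norm.
  have := He (t +i* r) r0 (lt_le_trans rMe nr) => h.
  have E : Im (eta (t +i* r)) + (1 + (t / r) ^+ 2)^-1 * r^-1 =
      Im (eta (t +i* r) - (t +i* r)^-1).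
    rewrite cImD cImN cImV /= mulNr opprK; congr (_ + _); field.
    by rewrite rn andbT gt_eqF// ltr_wpDl ?sqr_ge0// exprn_gt0.
  rewrite E (le_trans (Im_nm _))// (le_trans h)// ler_wpM2l ?(ltW e0)//.
  by rewrite lef_pV2 ?posrE// (lt_le_trans r0).
have Mv1 : Mv < `|N * r| by rewrite gtr0_norm// (lt_le_trans rMv).
have v1 := Hv (N * r) r Mv1 r0.
have v2 : `|Im (green (- (N * r) +i* r)) - Im (green (- (N * r))%:C)| <= 2 / `|N * r| * r.
  by have := Hv (- (N * r)) r _ r0; rewrite normrN; apply.
have B1 : Im (green (- (N * r))%:C) = 0.
  have : bdRe (- (N * r)) = 0 by exact: bdRe_left.
  rewrite bdReE => /eqP; rewrite oppr_eq0 mulf_eq0 invr_eq0 (gt_eqF (pi_gt0 R)) orbF.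
  by move=> /eqP.
have B2 : Im (green (N * r)%:C) = - (pi * bdRe (c 1%N)).
  have gE (g b : R) : - (g / pi) = b -> g = - (pi * b).
    by move=> <-; rewrite mulrN opprK [RHS]mulrC divfK// gt_eqF// pi_gt0.
  by apply: gE; rewrite -bdReE; exact: (bdRe_right (le_trans rc Nr)).
have aN : atan (N * r / r) = atan N by rewrite mulfK.
have aN' : atan (- (N * r) / r) = - atan N by rewrite mulNr atanN mulfK.
have e1 : N ^- 2 / r * (N * r - - (N * r)) = 2 / N by field; rewrite rn gt_eqF.
have e2 : 2 / `|N * r| * r = 2 / N by rewrite gtr0_norm//; field; rewrite rn gt_eqF.
have -> : 6 / N = 3 * (2 / N) by ring.
apply: (@three_term_estimate _ (Im (green (N * r +i* r))) (Im (green (- (N * r) +i* r)))).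
- by rewrite -{1}aN -aN' -e1; exact: b1.
- by rewrite -e2 -B2; exact: v1.
- by rewrite -e2 -{1}B1; exact: v2.
Qed.

(** Half a turn around infinity: 2 atan N tends to pi. *)
Lemma total_mass : bdRe (c 1%N) = 1.
Proof.
have pi0 := @pi_gt0 R.
suff E : `|2 * (pi / 2) - pi * bdRe (c 1%N)| <= 0.
  move: E; rewrite normr_le0 mulrC divfK// -{1}(mulr1 pi) -mulrBr mulf_eq0 gt_eqF//=.
  by rewrite subr_eq0 => /eqP.
apply/ler_addgt0Pr => e e0; rewrite add0r.
have cv : `|2 * atan N - pi * bdRe (c 1%N)| @[N --> +oo] --> `|2 * (pi / 2) - pi * bdRe (c 1%N)|.
  apply: cvg_norm; apply: cvgB; last exact: cvg_cst.
  by apply: cvgM; [exact: cvg_cst|exact: cvgy_atan].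
apply: (cvg_le cv); near=> N.
have N1 : 1 <= N by near: N; apply: nbhs_pinfty_ge; exact: num_real.
have N2 : 6 / e <= N by near: N; apply: nbhs_pinfty_ge; exact: num_real.
have N0 : 0 < N by exact: lt_le_trans N1.
rewrite (le_trans (arctan_comparison N1))// ler_pdivrMr//.
by move: N2; rewrite ler_pdivrMr// mulrC.
Unshelve. all: by end_near. Qed.

Lemma Re_theta_far y e : 0 < y -> 0 < e -> exists2 r, 0 < r & forall x, r < x ->
  Re (theta (- x +i* y)) <= e /\ - e <= Re (theta (- x +i* y)) /\
  1 - e <= Re (theta (x +i* y)) /\ Re (theta (x +i* y)) <= 1 + e.
Proof.
move=> y0 e0; have [M M0 HM] := vertical_variation.
have pi0 := @pi_gt0 R.
have [T [T0 TE]] : exists T : R, 0 < T /\ T = 2 * y / (e * pi).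
  by exists (2 * y / (e * pi)); rewrite divr_gt0 ?mulr_gt0.
exists (M + `|c 1%N| + `|a| + T); first by rewrite ltr_wpDl// !addr_ge0// ltW.
move=> x rx.
have n1 := normr_ge0 (c 1%N); have n2 := normr_ge0 a.
have c1 : c 1%N <= x by have := ler_norm (c 1%N); lra.
have ca : - x <= a by have := ler_norm (- a); rewrite normrN; lra.
have x0 : 0 < x by lra.
have Mx : M < `|x| by rewrite gtr0_norm//; lra.
have Tx : T <= x by lra.
have Mx' : M < `|- x| by rewrite normrN.
have bx : 2 / `|x| * y <= e * pi.
  rewrite gtr0_norm// mulrAC ler_pdivrMr//.
  by move: Tx; rewrite TE ler_pdivrMr ?mulr_gt0// [x * _]mulrC.
have V1 := le_trans (HM x y Mx y0) bx.
have V2 : `|Im (green (- x +i* y)) - Im (green (- x)%:C)| <= e * pi.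
  have h := HM (- x) y Mx' y0; rewrite (normrN x) in h; exact: le_trans h bx.
have B1 : bdRe (- x) = 0 by exact: bdRe_left.
have B2 : bdRe x = 1 by rewrite (bdRe_right c1) total_mass.
have [h1 h2] := near_value pi0 V2 (etrans (esym (bdReE (- x))) B1).
have [h3 h4] := near_value pi0 V1 (etrans (esym (bdReE x)) B2).
rewrite -(Re_theta (- x +i* y)) sub0r in h1.
rewrite -(Re_theta (- x +i* y)) add0r in h2.
rewrite -(Re_theta (x +i* y)) in h3.
rewrite -(Re_theta (x +i* y)) in h4.
exact: (conj h2 (conj h1 (conj h3 h4))).
Qed.

Lemma Re_theta_mono x p y : 0 < y -> x < p -> Re (theta (x +i* y)) < Re (theta (p +i* y)).
Proof.
move=> y0 xp; have xyp : x +i* y != p +i* y.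
  by apply/eqP => -[E]; move: xp; rewrite E ltxx.
have H : 0 < (p - x) * (Re (theta (p +i* y)) - Re (theta (x +i* y))) +
    (y - y) * (Im (theta (p +i* y)) - Im (theta (x +i* y))).
  exact: (@theta_monotone (x +i* y) (p +i* y) y0 y0 xyp).
exact: (same_height_lt xp H).
Qed.

(** On a horizontal line Re theta increases between its limits 0 and 1 at the two ends. *)
Lemma theta_strip z : 0 < Im z -> 0 < Re (theta z) < 1.
Proof.
case: z => x y /= y0; apply/andP; split.
  apply: (@le_lt_trans _ _ (Re (theta ((x - 1) +i* y)))); last first.
    by apply: Re_theta_mono => //; lra.
  apply/ler_addgt0Pr => e e0; rewrite -lerBlDr sub0r.
  have [r r0 Hr] := Re_theta_far y0 e0.
  pose X := r + `|x - 1| + 1.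
  have [|_ [h _]] := Hr X; first by rewrite /X; have := normr_ge0 (x - 1); lra.
  have xX : - X < x - 1.
    by rewrite /X; have := ler_norm (- (x - 1)); rewrite normrN; lra.
  exact: le_trans h (ltW (Re_theta_mono y0 xX)).
apply: (@lt_le_trans _ _ (Re (theta ((x + 1) +i* y)))).
  by apply: Re_theta_mono => //; lra.
apply/ler_addgt0Pr => e e0.
have [r r0 Hr] := Re_theta_far y0 e0.
pose X := r + `|x + 1| + 1.
have [|_ [_ [_ h]]] := Hr X; first by rewrite /X; have := normr_ge0 (x + 1); lra.
have xX : x + 1 < X by rewrite /X; have := ler_norm (x + 1); lra.
exact: le_trans (ltW (Re_theta_mono y0 xX)) h.
Qed.

(** * Feet of the level curves of Re theta *)

Lemma theta_dist z w : nm (theta z - theta w) = nm (green z - green w) / pi.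
Proof.
rewrite (thetaE z) (thetaE w) -mulrBr nmM nmM nm_real.
rewrite ger0_norm ?invr_ge0 ?pi_ge0//.
by rewrite nm_i mul1r mulrC.
Qed.

Lemma theta_cont x y e : 0 < y -> 0 < e -> exists2 r, 0 < r & forall x' y',
  `|x' - x| < r -> `|y' - y| < r -> nm (theta (x' +i* y') - theta (x +i* y)) < e.
Proof.
move=> y0 e0; have pi0 := @pi_gt0 R.
have [C [r [r0 H]]] := green_lipschitz (y0 : 0 < Im (x +i* y)).
have C1 : 0 < `|C| + 1 by rewrite ltr_wpDl.
pose r' := Num.min (r / 2) (e * pi / (2 * (`|C| + 1))).
have r'0 : 0 < r' by rewrite lt_min !divr_gt0 ?mulr_gt0.
exists r' => // x' y' hx hy.
pose h := (x' - x) +i* (y' - y).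
have nh : nm h < r' + r' by rewrite (le_lt_trans (nm_ReIm _))//= ltrD.
have r1 : r' <= r / 2 by rewrite ge_min lexx.
have r2 : r' <= e * pi / (2 * (`|C| + 1)) by rewrite ge_min lexx orbT.
have E : x' +i* y' = x +i* y + h by apply: complexP; rewrite ?cReD ?cImD /=; ring.
have [|_ b] := H h; first by apply: ltW; apply: lt_le_trans nh _; lra.
rewrite E theta_dist ltr_pdivrMr//; apply: (le_lt_trans b).
apply: (@le_lt_trans _ _ ((`|C| + 1) * nm h)).
  by rewrite ler_wpM2r ?nm_ge0// (le_trans (ler_norm C))// lerDl.
apply: (@lt_le_trans _ _ ((`|C| + 1) * (r' + r'))); first by rewrite ltr_pM2l.
have -> : (`|C| + 1) * (r' + r') = r' * (2 * (`|C| + 1)) by ring.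
by rewrite -ler_pdivlMr ?mulr_gt0.
Qed.

Lemma Re_le_dist z w : `|Re z - Re w| <= nm (z - w).
Proof. by rewrite -cReN -cReD Re_nm. Qed.
Lemma Im_le_dist z w : `|Im z - Im w| <= nm (z - w).
Proof. by rewrite -cImN -cImD Im_nm. Qed.

Lemma theta_level y q : 0 < y -> 0 < q < 1 -> exists x, Re (theta (x +i* y)) = q.
Proof.
move=> y0 /andP[q0 q1].
pose e := Num.min (q / 2) ((1 - q) / 2).
have e0 : 0 < e by rewrite lt_min !divr_gt0// subr_gt0.
have e1 : e <= q / 2 by rewrite ge_min lexx.
have e2 : e <= (1 - q) / 2 by rewrite ge_min lexx orbT.
have [r r0 H] := Re_theta_far y0 e0.
have rr : r < r + 1 by rewrite ltrDl.
have rr' : - (r + 1) <= r + 1 by lra.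
have [h1 [_ [h2 _]]] := H (r + 1) rr.
pose f x := Re (theta (x +i* y)).
have cf : {within `[- (r + 1), r + 1], continuous f}.
  apply: cont_within => x _; apply/cvgrPdist_lt => s s0.
  have [s' s'0 Hs] := theta_cont x y0 s0; exists s' => // x' /= xx.
  apply: (le_lt_trans (Re_le_dist _ _)); rewrite nmB; apply: Hs; first by rewrite distrC.
  by rewrite subrr normr0.
have h1' : f (- (r + 1)) <= q by apply: le_trans h1 _; lra.
have h2' : q <= f (r + 1) by apply: le_trans h2; lra.
have [x _ fx] := reach rr' cf h1' h2'.
by exists x.
Qed.

(** The points of the real line at which the level curves of Re theta end. In a gap, where
Re theta is constant, this is the zero of eta. *)
Definition foot b := (exists2 m, (1 <= m <= d)%N & c (2 * m)%N < b < c (2 * m).-1%N) \/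
  (exists2 m, (1 <= m < d)%N & b = xr m).

(** Re theta is continuous on the real line and runs from 0 to 1. A value that it takes in a
closed gap is taken at the zero of eta as well. *)
Lemma foot_exists q : 0 < q < 1 -> exists2 b, foot b & bdRe b = q.
Proof.
move=> /andP[q0 q1]; have ac : a < c 1%N by apply: oc; lia.
have ba : bdRe a = 0 by exact: bdRe_left.
pose f x := pi^-1 * parameterized_integral leb a x (fun x => - Im (eta x%:C)).
have fE x : a <= x -> f x = bdRe x.
  by move=> ax; rewrite -[RHS]subr0 -ba (bdRe_increment ax).
have ii := flux_integrable a (c 1%N).
have cf : {within `[a, c 1%N], continuous f}.
  move=> x; apply: cvgM; first exact: cvg_cst.
  by apply: parameterized_integral_continuous => //; exact: ltW.
have fa : f a = 0 by rewrite fE.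
have fc : f (c 1%N) = 1 by rewrite fE ?ltW//; exact: total_mass.
have [||x /andP[ax xc]] := reach (ltW ac) cf (q := q).
- by rewrite fa ltW.
- by rewrite fc ltW.
rewrite fE// => bx.
have xc1 : x < c 1%N.
  rewrite lt_neqAle xc andbT; apply/eqP => E.
  by move: q1; rewrite -bx E total_mass ltxx.
have crit m : (1 <= m < d)%N -> c (2 * m).+1 <= x <= c (2 * m)%N -> exists2 b, foot b & bdRe b = q.
  move=> md /andP[x1 x2]; exists (xr m); first by right; exists m.
  have /andP[m1 m2] := md; have /andP[g1 g2] := gx m1 m2.
  rewrite -bx; have [h|h] := leP x (xr m).
    by apply/esym; apply: (bdRe_gap md) => //; exact: ltW.
  by apply: (bdRe_gap md) => //; exact: ltW.
have axc : a <= x < c 1%N by rewrite ax.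
have [[m md /andP[x1 x2]]|[m md /andP[x1 x2]]] := locate axc; last first.
  by exact: (crit m md (introT andP (conj x1 (ltW x2)))).
have [E|N] := eqVneq x (c (2 * m)%N); last first.
  by exists x => //; left; exists m => //; rewrite lt_def N x1.
have [Em|Nm] := eqVneq m d.
  by move: q0; rewrite -bx E Em ba ltxx.
have md' : (1 <= m < d)%N by case/andP : md => -> md; rewrite ltn_neqAle Nm.
apply: (crit m) => //; rewrite E lexx andbT; apply: ltW; apply: oc => //; lia.
Qed.

Lemma foot_isolated b : foot b -> exists2 r, 0 < r & forall x j,
  `|x - b| < r -> (1 <= j <= 2 * d)%N -> r <= `|x - c j|.
Proof.
have key p q : p < b < q -> (forall x j, p < x < q -> (1 <= j <= 2 * d)%N -> x != c j) ->
    exists2 r, 0 < r & forall x j,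
    `|x - b| < r -> (1 <= j <= 2 * d)%N -> r <= `|x - c j|.
  move=> /andP[pb bq] H; pose r := Num.min ((b - p) / 2) ((q - b) / 2).
  have r1 : r <= (b - p) / 2 by rewrite ge_min lexx.
  have r2 : r <= (q - b) / 2 by rewrite ge_min lexx orbT.
  exists r; first by rewrite lt_min !divr_gt0// subr_gt0.
  move=> x j; rewrite ltr_norml => /andP[x1 x2] hj.
  have [cp|pc] := leP (c j) p.
    by rewrite (le_trans _ (ler_norm _))//; lra.
  have [qc|cq] := leP q (c j).
    by rewrite distrC (le_trans _ (ler_norm _))//; lra.
  by have := H (c j) j _ hj; rewrite pc cq eqxx => /(_ isT).
move=> [[m md bm]|[m md bE]].
  by apply: key bm _ => x j xm; exact: (not_endpoint_band md xm).
have /andP[m1 m2] := md; have := gx m1 m2; rewrite -bE => bm.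
apply: key bm _ => x j xm.
exact: (not_endpoint_gap md xm).
Qed.

Lemma horizontal_bound p q y m : 0 < y -> p <= q ->
  (forall t, p < t < q -> nm (eta (t +i* y)) <= m) ->
  `|Im (theta (q +i* y)) - Im (theta (p +i* y))| <= m / pi * (q - p).
Proof.
move=> y0 pq H.
have D t : p <= t <= q ->
    is_derive t 1 (Re \o (fun x => green (x +i* y))) (Re (eta (t +i* y))).
  by move=> _; exact: expansion_Re (horizontal_expansion t y0).
have B t : p < t < q -> `|Re (eta (t +i* y))| <= m.
  by move=> pt; exact: le_trans (Re_nm _) (H t pt).
have M := mean_value_le pq D B.
have -> : Im (theta (q +i* y)) - Im (theta (p +i* y)) =
    Re (green (q +i* y)) / pi - Re (green (p +i* y)) / pi.
  by congr (_ - _); exact: Im_theta.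
exact: scaled_bound (@pi_gt0 R) M.
Qed.

(** There is no endpoint close to a foot, so that eta is bounded near it. *)
Lemma foot_slope b : foot b -> exists B r, [/\ 0 <= B, 0 < r & forall x y,
  `|x - b| < r -> 0 < y < r -> `|Im (theta (x +i* y)) - Im (theta (b +i* y))| <= B * `|x - b|].
Proof.
move=> /foot_isolated [r0 r00 H]; pose r := Num.min r0 1.
have r1 : r <= 1 by rewrite ge_min lexx orbT.
have rr0 : r <= r0 by rewrite ge_min lexx.
have rp : 0 < r by rewrite lt_min r00 ltr01.
have [M M0 HM] := pval_bounded k (`|b| + 1 + 1).
pose W : R := \prod_(1 <= j < (2 * d).+1) invsqrt r0.
have W0 : 0 <= W by apply: prodr_ge0 => j _; exact: invsqrt_ge0.
have bnd x y : `|x - b| < r -> 0 < y < r -> nm (eta (x +i* y)) <= M * W.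
  move=> xb /andP[y0 yr].
  have xb0 : `|x - b| < r0 := lt_le_trans xb rr0.
  apply: (@le_trans _ _ (M * weight d c x)).
    apply: (@nm_eta_le R d c k (x +i* y)) => //.
      apply: HM; rewrite (le_trans (nm_ReIm _))//= (gtr0_norm y0).
      have := ler_normD (x - b) b; rewrite subrK; have := lt_le_trans xb r1.
      by have := lt_le_trans yr r1; lra.
    move=> j hj /=; have := H x j xb0 hj; apply: contraTneq => ->.
    by rewrite subrr normr0 -ltNge.
  rewrite ler_wpM2l// /weight /W !big_nat; apply: ler_prod => j; rewrite ltnS => hj.
  by rewrite invsqrt_ge0 invsqrt_le// H.
have pi0 := @pi_gt0 R.
exists (M * W / pi), r; split => //; first by rewrite divr_ge0 ?mulr_ge0// ltW.
have mv p q y : p <= q -> `|p - b| < r -> `|q - b| < r -> 0 < y < r ->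
    `|Im (theta (q +i* y)) - Im (theta (p +i* y))| <= M * W / pi * (q - p).
  move=> pq pb qb /[dup] yr /andP[y0 _].
  apply: horizontal_bound => // t pt.
  apply: bnd => //.
  move: pt pb qb; rewrite !ltr_norml => /andP[t1 t2] /andP[p1 p2] /andP[q1 q2].
  by apply/andP; split; lra.
move=> x y xb yr; have b0 : `|b - b| < r by rewrite subrr normr0.
have [h|h] := leP x b.
  rewrite distrC [X in _ <= _ * X]distrC [X in _ <= _ * X]ger0_norm ?subr_ge0//.
  exact: mv.
by rewrite [X in _ <= _ * X]gtr0_norm ?subr_gt0//; apply: mv => //; exact: ltW.
Qed.

(** * Boundary behaviour at the feet *)

Lemma Re_theta_vertical x : (fun y => Re (theta (x +i* y))) @ 0^'+ --> bdRe x.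
Proof.
have [_ I] := green_vertical x.
rewrite (bdReE x) (_ : (fun y => _) = fun y => - (Im (green (x +i* y)) / pi)).
  by apply: cvgN; apply: cvgM => //; exact: cvg_cst.
by apply/funext => y; exact: (Re_theta (x +i* y)).
Qed.

Lemma Im_theta_vertical x : (fun y => Im (theta (x +i* y))) @ 0^'+ --> bdIm x.
Proof.
have [I _] := green_vertical x.
rewrite (bdImE x) (_ : (fun y => _) = fun y => Re (green (x +i* y)) / pi).
  by apply: cvgM => //; exact: cvg_cst.
by apply/funext => y; exact: (Im_theta (x +i* y)).
Qed.

Lemma Re_theta_derive x t : 0 < t ->
  is_derive t 1 (fun y => Re (theta (x +i* y))) (- (Re (eta (x +i* t)) / pi)).
Proof.
move=> t0; have D := expansion_Im (vertical_expansion x t0).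
rewrite (_ : (fun y => _) = fun y => - (pi^-1 *: (Im \o (fun y => green (x +i* y))) y)).
  rewrite (_ : Re (eta (x +i* t)) = Im ('i%C * eta (x +i* t))).
    by rewrite mulrC; apply: is_deriveN; exact: is_deriveZ.
  by rewrite cImM /= mul0r mul1r add0r.
apply/funext => y; rewrite (Re_theta (x +i* y)) mulrC; reflexivity.
Qed.

Lemma eta_vertical x : (forall j, (1 <= j <= 2 * d)%N -> x != c j) ->
  (fun y => Re (eta (x +i* y))) @ 0^'+ --> Re (eta x%:C).
Proof.
move=> xc.
have [] // : ccvg (0^'+) (fun y => eta (x +i* y)) (eta x%:C).
apply: ccvg_eta => //=.
- by near=> y; apply/ltW; near: y; exact: nbhs_right_gt.
- move=> j hj; apply: contra_neq (xc j hj); exact: complexI.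
- by split; [exact: cvg_cst|apply: cvg_at_right_filter; exact: cvg_id].
Unshelve. all: by end_near. Qed.

(** In a gap the boundary value of Re theta is constant, and the sign of eta on the real line
decides on which side of it Re theta lies just above. *)
Lemma left_of_critical m x : (1 <= m < d)%N -> c (2 * m).+1 < x < xr m ->
  exists2 e, 0 < e & forall y, 0 < y < e -> Re (theta (x +i* y)) < bdRe x.
Proof.
move=> md xm; have /andP[m1 m2] := md; have /andP[x1 x2] := xm.
have /andP[g1 g2] := gx m1 m2.
have xg : c (2 * m).+1 < x < c (2 * m)%N by rewrite x1 (lt_trans x2).
have A := amp_gap md xg (negbT (lt_eqF x2)).
have [ER _] := eta_gapL md xm; rewrite -ER in A.
have xc j : (1 <= j <= 2 * d)%N -> x != c j by exact: (not_endpoint_gap md xg).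
have [e e0 H] := cvg_right0 (eta_vertical xc) A.
exists e => // y0 ye0; refine (below_limit (Re_theta_derive x) _ (@Re_theta_vertical x) ye0).
move=> y ye; have := H y ye; rewrite ltr_norml => /andP[h _].
by rewrite oppr_lt0 divr_gt0 ?pi_gt0//; move: h; rewrite ltrBrDl addrN.
Qed.

Lemma right_of_critical m x : (1 <= m < d)%N -> xr m < x < c (2 * m)%N ->
  exists2 e, 0 < e & forall y, 0 < y < e -> bdRe x < Re (theta (x +i* y)).
Proof.
move=> md xm; have /andP[m1 m2] := md; have /andP[x1 x2] := xm.
have /andP[g1 g2] := gx m1 m2.
have xg : c (2 * m).+1 < x < c (2 * m)%N by rewrite x2 (lt_trans g1).
have A := amp_gap md xg (negbT (gt_eqF x1)).
have [ER _] := eta_gapR md xm; rewrite -oppr_lt0 -ER in A.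
have xc j : (1 <= j <= 2 * d)%N -> x != c j by exact: (not_endpoint_gap md xg).
have A' : 0 < - Re (eta x%:C) by rewrite oppr_gt0.
have [e e0 H] := cvg_right0 (eta_vertical xc) A'.
exists e => // y0 ye0; refine (above_limit (Re_theta_derive x) _ (@Re_theta_vertical x) ye0).
move=> y ye; have := H y ye; rewrite ltr_norml => /andP[_ h].
rewrite oppr_gt0 pmulr_llt0 ?invr_gt0 ?pi_gt0//.
by move: h; rewrite ltrBlDl addrN.
Qed.

(** * The image of theta *)

Lemma left_of_foot b : foot b -> exists2 r, 0 < r & forall x, b - r < x < b ->
  exists2 e, 0 < e & forall y, 0 < y < e -> Re (theta (x +i* y)) < bdRe b.
Proof.
move=> [[m md /andP[b1 b2]]|[m md ->]].
  exists (b - c (2 * m)%N); rewrite ?subr_gt0// => x; rewrite subKr => /andP[x1 x2].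
  have xb := bdRe_band_lt md (ltW x1) x2 (ltW b2).
  have e0 : 0 < bdRe b - bdRe x by rewrite subr_gt0.
  have [e e1 H] := cvg_right0 (Re_theta_vertical (x := x)) e0.
  by exists e; [exact: e1|move=> y ye; exact: near_lt (H y ye)].
have /andP[m1 m2] := md; have /andP[g1 g2] := gx m1 m2.
exists (xr m - c (2 * m).+1); rewrite ?subr_gt0// => x; rewrite subKr => xm.
have /andP[x1 x2] := xm.
rewrite -(bdRe_gap md (ltW x1) (ltW x2) (ltW g2)).
exact: (left_of_critical md xm).
Qed.

Lemma right_of_foot b : foot b -> exists2 r, 0 < r & forall x, b < x < b + r ->
  exists2 e, 0 < e & forall y, 0 < y < e -> bdRe b < Re (theta (x +i* y)).
Proof.
move=> [[m md /andP[b1 b2]]|[m md ->]].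
  exists (c (2 * m).-1%N - b); rewrite ?subr_gt0// => x; rewrite addrC subrK => /andP[x1 x2].
  have xb := bdRe_band_lt md (ltW b1) x1 (ltW x2).
  have e0 : 0 < bdRe x - bdRe b by rewrite subr_gt0.
  have [e e1 H] := cvg_right0 (Re_theta_vertical (x := x)) e0.
  by exists e; [exact: e1|move=> y ye; exact: near_gt (H y ye)].
have /andP[m1 m2] := md; have /andP[g1 g2] := gx m1 m2.
exists (c (2 * m)%N - xr m); rewrite ?subr_gt0// => x; rewrite addrC subrK => xm.
have /andP[x1 x2] := xm.
rewrite (bdRe_gap md (ltW g1) (ltW x1) (ltW x2)).
exact: (right_of_critical md xm).
Qed.

Let u x y := Re (theta (x +i* y)).
Let v x y := Im (theta (x +i* y)).

Lemma theta_mono_xy x y x' y' : 0 < y -> 0 < y' -> (x != x') || (y != y') ->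
  0 < (x' - x) * (u x' y' - u x y) + (y' - y) * (v x' y' - v x y).
Proof.
move=> y0 y'0 ne; apply: (@theta_monotone (x +i* y) (x' +i* y')) => //.
by move: ne; apply: contraTneq => -[-> ->]; rewrite !eqxx.
Qed.

Lemma theta_cont_xy x y e : 0 < y -> 0 < e -> exists2 r, 0 < r & forall x' y',
  `|x' - x| < r -> `|y' - y| < r -> `|u x' y' - u x y| < e /\ `|v x' y' - v x y| < e.
Proof.
move=> y0 e0; have [r r0 H] := theta_cont x y0 e0; exists r => // x' y' hx hy.
by split; [apply: le_lt_trans (Re_le_dist _ _) _|apply: le_lt_trans (Im_le_dist _ _) _]; exact: H.
Qed.

(** Every point of the upper half-plane lies on a level curve of Re theta, and that curve ends
at the foot with the same value. *)
Lemma theta_above z b : foot b -> 0 < Im z -> Re (theta z) = bdRe b -> bdIm b < Im (theta z).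
Proof.
case: z => x y fb /= y0 E.
have lev t : 0 < t -> exists x, u x t = bdRe b.
  move=> t0; rewrite -E; apply: (theta_level t0).
  exact: (theta_strip (z := x +i* y)).
apply: (@level_gt R u v (bdRe b) b (bdIm b) theta_mono_xy lev
  (fun e => cvg_right0 (Re_theta_vertical (x := b)) (e := e))
  (fun e => cvg_right0 (Im_theta_vertical (x := b)) (e := e)) x y y0 E).
Qed.

Lemma bdIm_foot b : foot b -> 0 <= bdIm b.
Proof.
move=> [[m md /andP[b1 b2]]|[m md ->]]; last exact/ltW/bdIm_critical_gt0.
by rewrite (bdIm_in_band md)// !ltW.
Qed.

Lemma Im_theta_gt0 z : 0 < Im z -> 0 < Im (theta z).
Proof.
move=> z0; have [b fb bz] := foot_exists (theta_strip z0).
exact: le_lt_trans (bdIm_foot fb) (theta_above fb z0 (esym bz)).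
Qed.

(** Along a ray the Green function grows at least like half the logarithm, because eta is
asymptotic to 1 / z. *)
Lemma Im_theta_grows A : exists M, forall z, 0 < Im z -> M < nm z -> A < Im (theta z).
Proof.
have h0 : 0 < 2^-1 :> R by rewrite invr_gt0.
have [M M0 H] := eta_decay h0.
pose r := M + 1; have r0 : 0 < r by rewrite ltr_wpDl ?ltW.
have Mr : M < r by rewrite ltrDl.
have pi0 := @pi_gt0 R.
exists (r * expR (2 * (pi * `|A|))) => z z0.
pose n := nm z => nz; have e1 : 1 <= expR (2 * (pi * `|A|)).
  by rewrite -expR0 ler_expR !mulr_ge0// ltW.
have rn : r < n by apply: le_lt_trans nz; rewrite ler_peMr// ltW.
have n0 : 0 < n := lt_trans r0 rn.
pose w := n^-1%:C * z.
have nw : nm w = 1 by rewrite nmM nm_real gtr0_norm ?invr_gt0// mulVf ?gt_eqF.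
have w0 : 0 < Im w by rewrite cImZ mulr_gt0 ?invr_gt0.
have iw t : 0 < t -> 0 < Im (0 + t%:C * w) by move=> t0; rewrite add0r cImZ mulr_gt0.
have zE : 0 + n%:C * w = z.
  by rewrite add0r mulrA -rmorphM divff ?gt_eqF// mul1r.
pose g t := Re (green (0 + t%:C * w)).
pose F t := g t - 2^-1 * ln t.
pose dF t := Re (w * eta (0 + t%:C * w)) - 2^-1 * t^-1.
have D t : r <= t <= n -> is_derive t 1 F (dF t).
  move=> /andP[rt _]; have t0 := lt_le_trans r0 rt.
  have Dg : is_derive t 1 g (Re (w * eta (0 + t%:C * w))).
    exact: expansion_Re (green_line (iw t t0)).
  have Dl := is_derive1_ln t0.
  rewrite /dF (_ : F = g - (2^-1 *: @ln R)); last by apply/funext.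
  by apply: is_deriveB; exact: is_deriveZ.
have [t /andP[rt _] E] := mean_value rn D.
have t0 := lt_trans r0 rt.
have dF0 : 0 <= dF t.
  have Mt : M < nm (0 + t%:C * w).
    by rewrite add0r nmM nm_real nw mulr1 gtr0_norm// (lt_trans Mr rt).
  have := H _ (iw t t0) Mt; rewrite /dF add0r nmM nm_real nw mulr1 gtr0_norm//.
  exact: radial_bound.
have Fn : F r <= F n by rewrite -subr_ge0 E mulr_ge0// subr_ge0 ltW.
have gr : 0 <= g r.
  have := Im_theta_gt0 (iw r r0); rewrite (Im_theta _) => h.
  by apply/ltW; rewrite -(pmulr_lgt0 _ (_ : 0 < pi^-1)) ?invr_gt0.
have l1 : ln r + 2 * (pi * `|A|) < ln n.
  by rewrite -[X in _ + X]expRK -lnM ?posrE ?expR_gt0// ltr_ln ?posrE ?mulr_gt0 ?expR_gt0.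
have gz : pi * `|A| < g n.
  by move: Fn gr l1; rewrite /F; move: (g n) (g r) (ln n) (ln r) => p1 p2 p3 p4; lra.
rewrite /g zE in gz; rewrite (Im_theta z) ltr_pdivlMr//.
by apply: le_lt_trans gz; rewrite mulrC ler_pM2l// ler_norm.
Qed.

(** The level curve is followed from its foot to infinity, where Im theta is unbounded. *)
Lemma theta_onto b q t : foot b -> bdRe b = q -> 0 < q < 1 -> bdIm b < t ->
  exists2 z, 0 < Im z & theta z = q +i* t.
Proof.
move=> fb <- q01 bt.
have lev y : 0 < y -> exists x, u x y = bdRe b.
  by move=> y0; apply: (theta_level y0).
have grow A : exists M, forall x y, 0 < y -> M < y -> A < v x y.
  have [M H] := Im_theta_grows A; exists M => x y y0 My; apply: H => //.
  by apply: (lt_le_trans My); rewrite (le_trans _ (Im_nm _))//= ler_norm.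
have [x [y [y0 ux vx]]] := @level_onto R u v (bdRe b) b (bdIm b) theta_mono_xy theta_cont_xy lev
  (left_of_foot fb) (right_of_foot fb) (foot_slope fb)
  (fun e => cvg_right0 (Im_theta_vertical (x := b)) (e := e)) grow t bt.
by exists (x +i* y); [exact: y0|apply: complexP; [exact: ux|exact: vx]].
Qed.

(** * The comb of a differential of the third kind *)

(** The quadratic error of the Green function gives complex differentiability. *)
Lemma theta_holomorphic : holomorphic_on (@upper_half_plane R) theta.
Proof.
move=> z z0; pose l := 'i%C * (pi^-1)%:C * eta z.
have [C [e [e0 H]]] := green_expansion z0.
pose K := `|C| / pi + 1; have pi0 := @pi_gt0 R.
have K0 : 0 < K by rewrite ltr_wpDl ?divr_ge0// ltW.
have bound h : nm h <= e -> nm (theta (z + h) - theta z - h * l) <= K * nm h ^+ 2.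
  move=> he; have [_ b] := H h he.
  have -> : theta (z + h) - theta z - h * l =
      'i%C * (pi^-1)%:C * (green (z + h) - green z - h * eta z).
    by rewrite (thetaE (z + h)) (thetaE z) /l; ring.
  have -> : nm ('i%C * (pi^-1)%:C * (green (z + h) - green z - h * eta z)) =
      nm (green (z + h) - green z - h * eta z) / pi.
    rewrite nmM nmM nm_real ger0_norm ?invr_ge0 ?ltW//.
    by rewrite nm_i mul1r mulrC.
  rewrite ler_pdivrMr// (le_trans b)// /K mulrAC mulrDl mulfVK ?gt_eqF// mul1r.
  by rewrite ler_wpM2r ?exprn_ge0 ?nm_ge0//; have := ler_norm C; lra.
apply/cvg_ex; exists l; apply/cvgrPdist_lt => eps eps0.
have epsE : eps = (Re eps)%:C by apply/esym/RRe_real/gtr0_real.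
have r0 : 0 < Re eps by move: eps0; rewrite epsE ltcR.
have B0 : 0 < Num.min e (Re eps / K) by rewrite lt_min e0 divr_gt0.
apply/nbhs_plane; exists (Num.min e (Re eps / K)) => // h.
rewrite subr0 lt_min => /andP[he hK] h0.
have nh : 0 < nm h by rewrite nm_gt0.
rewrite epsE normE ltcR.
have -> : l - h^-1 *: (theta (h *: 1 + z) - theta z) =
    - (h^-1 * (theta (z + h) - theta z - h * l)).
  rewrite /GRing.scale/= mulr1 [h + z]addrC [in RHS]mulrBr (mulKf h0).
  by rewrite opprB.
rewrite nmN nmM nmV mulrC ltr_pdivrMr// (le_lt_trans (bound h (ltW he)))//.
by rewrite expr2 mulrA ltr_pM2r// mulrC -ltr_pdivlMr.
Qed.

Lemma harmonic_measure_gt0 m : (1 <= m <= d)%N -> 0 < hm m.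
Proof.
move=> md; rewrite (harmonic_measureE md) subr_gt0.
apply: (bdRe_band_lt md) => //; apply: oc; lia.
Qed.

Let cumulated n := \sum_(d.+1 - n <= m < d.+1) hm m.

Lemma partial_measure_lt i j : (i < j)%N -> (j <= d)%N -> cumulated i < cumulated j.
Proof.
move=> ij jd; rewrite /cumulated [ltRHS](big_cat_nat (n := d.+1 - i)) /=; [|lia|lia].
rewrite ltrDr big_ltn; last by lia.
rewrite ltr_pwDl ?harmonic_measure_gt0//; first by lia.
by rewrite big_nat; apply: sumr_ge0 => m ?; apply/ltW/harmonic_measure_gt0; lia.
Qed.

Lemma measure_total : cumulated d = 1.
Proof.
rewrite /cumulated subSn// subnn big_ltn; last by lia.
have dd : (d.-1 < d)%N by lia.
have := bdRe_sum dd; rewrite (_ : d.+1 - d.-1 = 2)%N; last by lia.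
rewrite (_ : d - d.-1 = 1)%N; last by lia.
rewrite muln1 => <-; have d1' : (1 <= 1 <= d)%N by lia.
by rewrite (harmonic_measureE d1') muln1 subrK; exact: total_mass.
Qed.

Local Notation height := (fun j => bdIm (xr (d - j))).

Lemma standard_comb_parameters : comb_parameters d (frequency d c k) height.
Proof.
split=> [j j1 jd|i j i1 ij jd]; last exact/partial_measure_lt/ltnW.
split; last by apply: bdIm_critical_gt0; lia.
have s0 : cumulated 0 = 0 by rewrite /cumulated subn0 big_geq.
rewrite -{1}s0 -measure_total; apply/andP; split; apply: partial_measure_lt => //.
exact: ltnW.
Qed.

(** The level curve at abscissa x fills the vertical line above the height of its foot: this
height is 0 when the foot is in a band, and that of the slit when it is critical. *)
Lemma theta_comb : set_bij (@upper_half_plane R) (open_comb d (frequency d c k) height) theta.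
Proof.
have idx m : (1 <= m < d)%N -> (1 <= d - m < d)%N by lia.
split.
- move=> z z0; split; [exact: theta_strip|exact: Im_theta_gt0|].
  move=> j jd E; apply: theta_above => //; last first.
    by rewrite E (frequencyE jd).
  by right; exists (d - j)%N => //; exact: idx.
- move=> z w; rewrite !inE; exact: theta_inj.
- move=> [x y] [/= x01 y0 H].
  have [b fb bx] := foot_exists x01.
  have by' : bdIm b < y.
    case: (fb) => [[m md /andP[b1 b2]]|[m md bE]].
      by rewrite (bdIm_in_band md)// !ltW.
    have dm := idx m md; have dK : (d - (d - m) = m)%N by lia.
    have := H (d - m)%N dm; rewrite dK -bE; apply.
    by rewrite (frequencyE dm) dK -bE.
  by have [z z0 zE] := theta_onto fb bx x01 by'; exists z.
Qed.

Lemma standard_comb_map : comb_map d c k (frequency d c k) height.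
Proof.
split; first exact: standard_comb_parameters.
  by rewrite interior_comb; split; [exact: theta_holomorphic|exact: theta_comb].
move=> A; have [M H] := Im_theta_grows A; exists M => z z0 zM.
by apply: lt_le_trans (H z z0 zM) _; apply: le_trans (Im_nm _); exact: ler_norm.
Qed.

(** Both combs have the image of theta as their interior. *)
Lemma comb_map_unique (q h : nat -> R) : comb_map d c k q h ->
  forall j, (1 <= j < d)%N -> q j = frequency d c k j /\ h j = height j.
Proof.
move=> [P [_ B] _] j jd; apply: (open_comb_inj P standard_comb_parameters) => //.
have [_ [_ B'] _] := standard_comb_map.
have im D : set_bij (@upper_half_plane R) D theta -> theta @` (@upper_half_plane R) = D.
  by move=> [hom _ sur]; apply: surj_image_eq => //; exact/image_subP.
by rewrite -!interior_comb -(im _ B) -(im _ B').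
Qed.

(** Elsewhere in the gap eta is real and nonzero. *)
Lemma critical_pointP m x : (1 <= m < d)%N -> critical_point d c k m x <-> x = xr m.
Proof.
move=> md; have /andP[m1 m2] := md; split=> [[xg x0]|->]; last first.
  by split; [exact: gx|exact: (eta_zero md)].
have /andP[x1 x2] := xg; apply/eqP; apply: contraT => xm.
have := amp_gap md xg xm; case/orP: (lt_total xm) => l.
  by have [+ _] := eta_gapL md (introT andP (conj x1 l)); rewrite x0 => /= <-; rewrite ltxx.
have [+ _] := eta_gapR md (introT andP (conj l x2)); rewrite x0 => /= h.
by rewrite -oppr_lt0 -h ltxx.
Qed.

Lemma theta_critical j : (1 <= j < d)%N ->
  theta (xr (d - j))%:C = frequency d c k j +i* height j.
Proof.
by move=> jd; rewrite (frequencyE jd); apply: complexP.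
Qed.

End CombMap.

Theorem theorem5 (R : realType) (d : nat) (J : interval R)
    (c : R -> nat -> R) (k : R -> {poly R}) :
  (1 <= d)%N ->
  isoharmonic_deformation d J c k ->
  (forall t : R, t \in J -> exists h : nat -> R,
     comb_map d (c t) (k t) (frequency d (c t) (k t)) h) /\
  (forall (s t : R) (q h q' h' : nat -> R), s \in J -> t \in J ->
     comb_map d (c s) (k s) q h ->
     comb_map d (c t) (k t) q' h' ->
     forall j : nat, (1 <= j)%N -> (j < d)%N ->
     [/\ q' j = q j,
         exists! x : R, critical_point d (c t) (k t) (d - j) x
       & forall x : R, critical_point d (c t) (k t) (d - j) x ->
           theta d (c t) (k t) x%:C = q j +i* h' j]).
Proof.
move=> d1 [_ oc tk iso].
have zeros t : t \in J -> exists x, gap_points d (c t) x /\ zeros_at d (k t) x.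
  by move=> tJ; exact: third_kind_zeros d1 (oc t tJ) (tk t tJ).
split=> [t tJ|s t q h q' h' sJ tJ Cs Ct j j1 jd].
  have [x [gx kE]] := zeros t tJ.
  by eexists; exact: standard_comb_map d1 (oc t tJ) (tk t tJ) gx kE.
have jd' : (1 <= j < d)%N by rewrite j1.
have [x [gx kE]] := zeros s sJ; have [x' [gx' kE']] := zeros t tJ.
have [qE _] := comb_map_unique d1 (oc s sJ) (tk s sJ) gx kE Cs jd'.
have [qE' hE'] := comb_map_unique d1 (oc t tJ) (tk t tJ) gx' kE' Ct jd'.
have fE : frequency d (c s) (k s) j = frequency d (c t) (k t) j.
  by apply: eq_big_nat => m md; apply: iso => //; lia.
have dj : (1 <= d - j < d)%N by lia.
have cp y := critical_pointP d1 (oc t tJ) (tk t tJ) gx' kE' y dj.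
split; first exact: etrans qE' (etrans (esym fE) (esym qE)).
  by exists (x' (d - j)%N); split; [exact/cp|move=> y /cp ->; reflexivity].
move=> y /cp ->; rewrite (theta_critical d1 (oc t tJ) (tk t tJ) gx' kE' jd').
by rewrite qE fE hE'.
Qed.
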